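(* Let $\mathfrak L=\mathfrak L_0\oplus\mathfrak L_1$ be a Lie superalgebra over $\mathbb C$ with universal enveloping algebra $U=U(\mathfrak L)$. For $k\ge0$ put $C_k(\mathfrak L)=\bigoplus_{p+q=k}\Lambda^p(\mathfrak L_0)\otimes S^q(\mathfrak L_1)$ and $M_k=U\otimes_{\mathbb C}C_k(\mathfrak L)$, and put $M_{-1}=\mathbb C$. For $k\ge1$ define $\partial_k:M_k\to M_{k-1}$ by $$\begin{aligned}&\partial_k\big(u\otimes(x_1\wedge\cdots\wedge x_p)\otimes(y_1\cdots y_q)\big)\\&=\sum_{1\le s<t\le p}(-1)^{s+t}u\otimes([x_s,x_t]\wedge x_1\wedge\cdots\wedge\widehat{x_s}\wedge\cdots\wedge\widehat{x_t}\wedge\cdots\wedge x_p)\otimes(y_1\cdots y_q)\\&\quad+\sum_{s=1}^p\sum_{t=1}^q(-1)^su\otimes(x_1\wedge\cdots\wedge\widehat{x_s}\wedge\cdots\wedge x_p)\otimes([x_s,y_t]y_1\cdots\widehat{y_t}\cdots y_q)\\&\quad-\sum_{1\le s<t\le q}u\otimes([y_s,y_t]\wedge x_1\wedge\cdots\wedge x_p)\otimes(y_1\cdots\widehat{y_s}\cdots\widehat{y_t}\cdots y_q)\\&\quad+\sum_{s=1}^p(-1)^{s+1}(u\cdot x_s)\otimes(x_1\wedge\cdots\wedge\widehat{x_s}\wedge\cdots\wedge x_p)\otimes(y_1\cdots y_q)\\&\quad+(-1)^p\sum_{t=1}^q(u\cdot y_t)\otimes(x_1\wedge\cdots\wedge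 x_p)\otimes(y_1\cdots\widehat{y_t}\cdots y_q)\end{aligned}$$ for $u\in U$, $x_i\in\mathfrak L_0$, $y_j\in\mathfrak L_1$, $p+q=k$; let $\partial_0:M_0=U\to\mathbb C$ be the augmentation map (extracting the constant term) and $\partial_{-1}=0$. Then the chain complex $M=(M_k,\partial_k)$ is a free resolution of the trivial one-dimensional left $U$-module $\mathbb C$; that is, each $M_k$ ($k\ge0$) is a free left $U$-module and $\cdots\to M_1\xrightarrow{\partial_1}M_0\xrightarrow{\partial_0}\mathbb C\to0$ is exact.
   Context: A Lie superalgebra is a $\mathbb Z_2$-graded complex vector space $\mathfrak L=\mathfrak L_0\oplus\mathfrak L_1$ with bilinear bracket satisfying $[\mathfrak L_a,\mathfrak L_b]\subset\mathfrak L_{a+b}$, $[x,y]=-(-1)^{ab}[y,x]$ and $[x,[y,z]]=[[x,y],z]+(-1)^{ab}[y,[x,z]]$ for $x\in\mathfrak L_a$, $y\in\mathfrak L_b$. $U(\mathfrak L)$ is the quotient of the tensor algebra by the relations $[x,y]=xy-(-1)^{ab}yx$. $\Lambda^p(\mathfrak L_0)$ and $S^q(\mathfrak L_1)$ are the ordinary exterior and symmetric powers of the underlying vector spaces; $U$ acts on $M_k$ by left multiplication on the first factor. A hat denotes omission. *)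

(* Defs.v *)
From HB Require Import structures.
From mathcomp Require Import all_boot all_order all_fingroup all_algebra.
From mathcomp Require Import generic_quotient ring_quotient.
From mathcomp Require Import boolp classical_sets reals complex.
From mathcomp Require Import finmap monalg.

Set Implicit Arguments.
Unset Strict Implicit.
Unset Printing Implicit Defensive.

Import GRing.Theory.
Local Open Scope ring_scope.
Local Open Scope quotient_scope.

Section ModuleQuotient.
Variables (K : pzRingType) (V : lmodType K).
Implicit Type S : set V.

(* The submodule generated by S: the intersection of all submodules that
   contain S. *)
Definition span S : {pred V} :=
  fun v => `[< forall P : {pred V}, submod_closed P ->
                 (forall x, S x -> x \in P) -> v \in P >].

Lemma spanP S v :
  reflect (forall P : {pred V}, submod_closed P ->
             (forall x, S x -> x \in P) -> v \in P) (v \in span S).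
Proof. exact: asboolP. Qed.

Lemma span_gen S x : S x -> x \in span S.
Proof. by move=> Sx; apply/spanP => P _; apply. Qed.

Lemma span_submod S : submod_closed (span S).
Proof.
split; first by apply/spanP => P [].
move=> a u v /spanP uS /spanP vS; apply/spanP => P cP PS.
by have [_ cPl] := cP; apply: cPl; [apply: uS|apply: vS].
Qed.

HB.instance Definition _ S := GRing.isSubmodClosed.Build K V (span S)
  (span_submod S).

Definition quotmod S : Type := Quotient.quot (span S).

HB.instance Definition _ S := GRing.Zmodule.on (quotmod S).

(* Locked, for otherwise comparing two classes unfolds the whole quotient
   construction. *)
Fact qmod_key : unit. Proof. by []. Qed.
Definition qmod S : V -> quotmod S :=
  locked_with qmod_key (fun v => \pi_(Quotient.quot (span S)) v).

Lemma qmodE S v : qmod S v = \pi_(Quotient.quot (span S)) v.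
Proof. by rewrite /qmod unlock. Qed.

Lemma qmod_repr S (x : quotmod S) : qmod S (repr (x : Quotient.quot (span S))) = x.
Proof. rewrite qmodE; exact: reprK. Qed.

Lemma qmodP S (u v : V) : (qmod S u = qmod S v) <-> (u - v \in span S).
Proof.
rewrite !qmodE; split=> [/eqmodP|].
  by rewrite /= Quotient.equivE.
by move=> h; apply/eqmodP; rewrite /= Quotient.equivE.
Qed.

Lemma qmodD S : {morph qmod S : u v / u + v}.
Proof. by move=> u v; rewrite !qmodE; apply: raddfD. Qed.

Definition qscale S (a : K) (x : quotmod S) : quotmod S :=
  qmod S (a *: repr (x : Quotient.quot (span S))).

Lemma qscaleE S a v : qscale a (qmod S v) = qmod S (a *: v).
Proof.
apply/qmodP; rewrite -scalerBr rpredZ //.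
by apply/qmodP; rewrite qmod_repr.
Qed.

Lemma quot_ind S (P : quotmod S -> Prop) : (forall v, P (qmod S v)) -> forall x, P x.
Proof. by move=> H x; rewrite -(qmod_repr x). Qed.

Fact qscalerA S a b (x : quotmod S) : qscale a (qscale b x) = qscale (a * b) x.
Proof. by elim/quot_ind: x => v; rewrite !qscaleE scalerA. Qed.
Fact qscale1r S : left_id 1 (@qscale S).
Proof. by elim/quot_ind=> v; rewrite qscaleE scale1r. Qed.
Fact qscalerDr S : right_distributive (@qscale S) +%R.
Proof.
move=> a; elim/quot_ind=> u; elim/quot_ind=> v.
by rewrite -qmodD !qscaleE scalerDr qmodD.
Qed.
Fact qscalerDl S x : {morph (@qscale S)^~ x : a b / a + b}.
Proof. by move=> a b; elim/quot_ind: x => v; rewrite !qscaleE scalerDl qmodD. Qed.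

HB.instance Definition _ S := GRing.Zmodule_isLmodule.Build K (quotmod S)
  (@qscalerA S) (@qscale1r S) (@qscalerDr S) (@qscalerDl S).

Fact qmod_linear S : linear (qmod S).
Proof. by move=> a u v; rewrite qmodD -qscaleE. Qed.

HB.instance Definition _ S := GRing.isLinear.Build K V (quotmod S) *:%R (qmod S)
  (@qmod_linear S).

End ModuleQuotient.

Section AlgebraQuotient.
Variables (K : fieldType) (A : algType K).
Implicit Type S : set A.

(* The K-span of ideal_gens S is the two-sided ideal generated by S. *)
Definition ideal_gens S : set A :=
  fun r => exists a s b, S s /\ r = a * s * b.

Lemma ideal_mull S (c a : A) :
  a \in span (ideal_gens S) -> c * a \in span (ideal_gens S).
Proof.
move=> /spanP/(_ [pred x | c * x \in span (ideal_gens S)]); apply.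
  split=> [|k u v]; rewrite !inE ?mulr0 ?rpred0 // => hu hv.
  by rewrite mulrDr -scalerAr rpredD // rpredZ.
move=> _ [x [s [y [Ss ->]]]]; rewrite inE; apply: span_gen.
by exists (c * x), s, y; rewrite !mulrA.
Qed.

Lemma ideal_mulr S (c a : A) :
  a \in span (ideal_gens S) -> a * c \in span (ideal_gens S).
Proof.
move=> /spanP/(_ [pred x | x * c \in span (ideal_gens S)]); apply.
  split=> [|k u v]; rewrite !inE ?mul0r ?rpred0 // => hu hv.
  by rewrite mulrDl -scalerAl rpredD // rpredZ.
move=> _ [x [s [y [Ss ->]]]]; rewrite inE; apply: span_gen.
by exists x, s, (y * c); rewrite !mulrA.
Qed.

Definition algquot S : Type := quotmod (ideal_gens S).

HB.instance Definition _ S := GRing.Lmodule.on (algquot S).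

Definition qalg S (a : A) : algquot S := qmod (ideal_gens S) a.

Definition qrepr S (x : algquot S) : A :=
  repr (x : Quotient.quot (span (ideal_gens S))).

Lemma qreprK S (x : algquot S) : qalg S (qrepr x) = x.
Proof. exact: qmod_repr. Qed.

Lemma qalgP S (u v : A) : qalg S u = qalg S v <-> u - v \in span (ideal_gens S).
Proof. exact: qmodP. Qed.

Lemma qreprP S (a : A) : qrepr (qalg S a) - a \in span (ideal_gens S).
Proof. by apply/qalgP; rewrite qreprK. Qed.

Lemma qalgD S : {morph qalg S : u v / u + v}.
Proof. exact: qmodD. Qed.

Lemma qalgZ S k u : qalg S (k *: u) = k *: qalg S u.
Proof. exact: linearZ. Qed.

Fact qmul_key : unit. Proof. by []. Qed.
Definition qmul S : algquot S -> algquot S -> algquot S :=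
  locked_with qmul_key (fun x y => qalg S (qrepr x * qrepr y)).

Lemma qmulE S a b : qmul (qalg S a) (qalg S b) = qalg S (a * b).
Proof.
rewrite /qmul unlock; apply/qalgP.
have -> : qrepr (qalg S a) * qrepr (qalg S b) - a * b
  = (qrepr (qalg S a) - a) * qrepr (qalg S b) + a * (qrepr (qalg S b) - b).
  by rewrite mulrBl mulrBr addrA subrK.
by apply: rpredD; [apply: ideal_mulr|apply: ideal_mull]; exact: qreprP.
Qed.

Lemma algquot_ind S (P : algquot S -> Prop) :
  (forall a, P (qalg S a)) -> forall x, P x.
Proof. by move=> H x; rewrite -(qreprK x). Qed.

Fact qmulA S : associative (@qmul S).
Proof.
by elim/algquot_ind=> a; elim/algquot_ind=> b; elim/algquot_ind=> c; rewrite !qmulE mulrA.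
Qed.
Fact qmul1l S : left_id (qalg S 1) (@qmul S).
Proof. by elim/algquot_ind=> a; rewrite qmulE mul1r. Qed.
Fact qmul1r S : right_id (qalg S 1) (@qmul S).
Proof. by elim/algquot_ind=> a; rewrite qmulE mulr1. Qed.
Fact qmulDl S : left_distributive (@qmul S) +%R.
Proof.
elim/algquot_ind=> a; elim/algquot_ind=> b; elim/algquot_ind=> c.
by rewrite -qalgD !qmulE mulrDl qalgD.
Qed.
Fact qmulDr S : right_distributive (@qmul S) +%R.
Proof.
elim/algquot_ind=> a; elim/algquot_ind=> b; elim/algquot_ind=> c.
by rewrite -qalgD !qmulE mulrDr qalgD.
Qed.

HB.instance Definition _ S := GRing.Zmodule_isPzRing.Build (algquot S)
  (@qmulA S) (@qmul1l S) (@qmul1r S) (@qmulDl S) (@qmulDr S).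

Lemma qalgM S : {morph qalg S : a b / a * b}.
Proof. by move=> a b; rewrite -qmulE. Qed.

Lemma algquot_scalerAl S (k : K) (x y : algquot S) : k *: (x * y) = (k *: x) * y.
Proof.
elim/algquot_ind: x => a; elim/algquot_ind: y => b.
by rewrite -qalgM -!qalgZ -qalgM scalerAl.
Qed.

Lemma algquot_scalerAr S (k : K) (x y : algquot S) : k *: (x * y) = x * (k *: y).
Proof.
elim/algquot_ind: x => a; elim/algquot_ind: y => b.
by rewrite -qalgM -!qalgZ -qalgM scalerAr.
Qed.

(* A character of A that kills S factors through the quotient by the ideal
   generated by S. *)
Definition qchar S (f : A -> K) (x : algquot S) : K := f (qrepr x).

Section Character.
Variables (S : set A) (f : A -> K).
Hypothesis fD : zmod_morphism f.
Hypothesis fZ : scalable_for *%R f.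
Hypothesis fM : monoid_morphism f.
Hypothesis fS : forall s, S s -> f s = 0.

Lemma qcharE a : qchar f (qalg S a) = f a.
Proof.
have f0 : f 0 = 0 by rewrite -(subrr 0) fD subrr.
have fadd : {morph f : u v / u + v}.
  by move=> u v; rewrite -{1}[v]opprK fD -(sub0r v) fD f0 sub0r opprK.
apply/eqP; rewrite -subr_eq0 /qchar -fD.
have /spanP/(_ [pred x | f x == 0]) := qreprP S a; apply.
  split=> [|k u v]; rewrite !inE ?f0 // => /eqP hu /eqP hv.
  by rewrite fadd fZ hu hv mulr0 addr0.
move=> _ [x [s [y [Ss ->]]]]; rewrite inE !fM.2 (fS Ss).
by rewrite mulr0 mul0r.
Qed.

Lemma qchar_zmod : zmod_morphism (@qchar S f).
Proof.
elim/algquot_ind=> a; elim/algquot_ind=> b.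
have -> : qalg S a - qalg S b = qalg S (a - b).
  by rewrite qalgD -[- b]scaleN1r qalgZ scaleN1r.
by rewrite !qcharE fD.
Qed.

Lemma qchar_scalable : scalable_for *%R (@qchar S f).
Proof. by move=> k; elim/algquot_ind=> a; rewrite -qalgZ !qcharE fZ. Qed.

Lemma qchar_monoid : monoid_morphism (@qchar S f).
Proof.
split; first by rewrite -fM.1 -qcharE.
by elim/algquot_ind=> a; elim/algquot_ind=> b; rewrite -qalgM !qcharE fM.2.
Qed.

Lemma algquot_neq0 : (1 : algquot S) != 0.
Proof.
apply/eqP => /(congr1 (@qchar S f)); rewrite qchar_monoid.1.
by rewrite -(subrr 0) qchar_zmod subrr => /eqP; rewrite oner_eq0.
Qed.

End Character.
End AlgebraQuotient.

Section TensorAlgebra.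
Variables (K : fieldType) (V : lmodType K).

Fact malg_scalerAr (k : K) (x y : {malg K[{fmonom V}]}) :
  k *: (x * y) = x * (k *: y).
Proof.
apply/malgP => m; rewrite mcoeffZ.
rewrite [X in k * X](mcoeffMl x y) mulr_sumr.
rewrite [RHS](mcoeffMlw m (fsubset_refl _) (msuppZ_le k y)).
apply: eq_bigr => i _; rewrite mulr_sumr; apply: eq_bigr => j _.
by rewrite mcoeffZ mulrnAr mulrCA.
Qed.

(* Its elements are linear combinations of words on the underlying set of V;
   the product is concatenation. *)
Definition freealg : Type := {malg K[{fmonom V}]}.

HB.instance Definition _ := GRing.Lalgebra.on freealg.

Fact freealg_scalerAr (k : K) (x y : freealg) : k *: (x * y) = x * (k *: y).
Proof. exact: malg_scalerAr. Qed.

HB.instance Definition _ := GRing.Lalgebra_isAlgebra.Build K freealg freealg_scalerAr.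

Definition letter (x : V) : freealg := mkmalgU (fmu x) 1.

Definition linear_rel : set freealg :=
  fun r => exists (a : K) (x y : V),
    r = letter (a *: x + y) - (a *: letter x + letter y).

(* Degree by degree, this is the quotient of the span of the words of length n
   by multilinearity, hence the n-th tensor power of V: the tensor algebra. *)
Definition talg : Type := algquot linear_rel.

HB.instance Definition _ := GRing.Lmodule.on talg.
HB.instance Definition _ := GRing.PzRing.on talg.

Definition tin (x : V) : talg := qalg linear_rel (letter x).

(* The coefficient of the empty word. *)
Definition constant_term (f : freealg) : K :=
  @mcoeff {fmonom V} K (fmone V) f.

Definition taug (t : talg) : K := qchar constant_term t.

Lemma constant_term_letter x : constant_term (letter x) = 0.
Proof. by rewrite /constant_term mcoeffU fmP fmuE fmoneE. Qed.

Lemma constant_term_rel r : linear_rel r -> constant_term r = 0.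
Proof.
move=> [a [x [y ->]]]; rewrite /constant_term mcoeffB mcoeffD mcoeffZ.
have l0 z : mcoeff (fmone V) (letter z) = 0 by exact: constant_term_letter.
by rewrite 3!l0 mulr0 addr0 subr0.
Qed.

Fact constant_term_zmod : zmod_morphism constant_term.
Proof. exact: mcoeffB. Qed.

Fact constant_term_scalable : scalable_for *%R constant_term.
Proof. by move=> a u; exact: mcoeffZ. Qed.

Fact constant_term_monoid : monoid_morphism constant_term.
Proof.
have [hM h1] := mcoeff1g_is_multiplicative {fmonom V} K.
by split.
Qed.

Lemma taug_zmod : zmod_morphism taug.
Proof.
exact: (qchar_zmod constant_term_zmod constant_term_scalable
  constant_term_monoid constant_term_rel).
Qed.

Lemma taug_scalable : scalable_for *%R taug.
Proof.
exact: (qchar_scalable constant_term_zmod constant_term_scalable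
  constant_term_monoid constant_term_rel).
Qed.

Lemma taug_monoid : monoid_morphism taug.
Proof.
exact: (qchar_monoid constant_term_zmod constant_term_scalable
  constant_term_monoid constant_term_rel).
Qed.

Lemma taug_tin x : taug (tin x) = 0.
Proof.
rewrite /taug /tin qcharE ?constant_term_letter //.
- exact: constant_term_zmod.
- exact: constant_term_scalable.
- exact: constant_term_monoid.
- exact: constant_term_rel.
Qed.

HB.instance Definition _ := GRing.PzSemiRing_isNonZero.Build talg
  (algquot_neq0 constant_term_zmod constant_term_scalable
     constant_term_monoid constant_term_rel).
HB.instance Definition _ := GRing.Lmodule_isLalgebra.Build K talg
  (@algquot_scalerAl _ _ linear_rel).
HB.instance Definition _ := GRing.Lalgebra_isAlgebra.Build K talg
  (@algquot_scalerAr _ _ linear_rel).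

End TensorAlgebra.

(* v is homogeneous of degree a, where false is the degree 0 and true is 1. *)
Definition homogeneous (K : fieldType) (V0 V1 : lmodType K) (a : bool)
    (v : V0 * V1) : Prop :=
  if a then v.1 = 0 else v.2 = 0.

(* The graded space is even_part (+) odd_part, encoded as the product. *)
Record lieSuper (K : fieldType) := LieSuper {
  even_part : lmodType K;
  odd_part : lmodType K;
  bracket : even_part * odd_part -> even_part * odd_part -> even_part * odd_part;
  bracket_linearl : forall y, linear (fun x => bracket x y);
  bracket_linearr : forall x, linear (bracket x);
  bracket_graded : forall (a b : bool) x y,
    homogeneous a x -> homogeneous b y -> homogeneous (a (+) b) (bracket x y);
  bracket_skew : forall (a b : bool) x y,
    homogeneous a x -> homogeneous b y ->
    bracket x y = - ((-1) ^+ (a && b) *: bracket y x);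
  bracket_jacobi : forall (a b : bool) x y z,
    homogeneous a x -> homogeneous b y ->
    bracket x (bracket y z) =
      bracket (bracket x y) z + (-1) ^+ (a && b) *: bracket y (bracket x z)
}.

Section Enveloping.
Variables (K : fieldType) (L : lieSuper K).

Definition total_space : lmodType K := (even_part L * odd_part L)%type.

(* The relations [x, y] = x y - (-1)^(ab) y x for homogeneous x and y. *)
Definition env_rel : set (talg total_space) :=
  fun r => exists (a b : bool) (x y : total_space),
    [/\ homogeneous a x, homogeneous b y &
        r = tin (bracket x y : total_space)
            - (tin x * tin y - (-1) ^+ (a && b) *: (tin y * tin x))].

Definition env : Type := algquot env_rel.

HB.instance Definition _ := GRing.Lmodule.on env.
HB.instance Definition _ := GRing.PzRing.on env.

Definition env_in (x : total_space) : env := qalg env_rel (tin x).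

Definition aug (u : env) : K := qchar (@taug K total_space) u.

Lemma taug_env_rel r : env_rel r -> taug r = 0.
Proof.
move=> [a [b [x [y [_ _ ->]]]]].
have tM (p q : talg total_space) : taug (p * q) = taug p * taug q.
  by have [_] := taug_monoid total_space; exact.
have t0 (p q : talg total_space) : taug q = 0 -> taug (p * q) = 0.
  by rewrite tM => ->; rewrite mulr0.
rewrite [LHS]taug_zmod [in LHS]taug_zmod taug_scalable.
rewrite (t0 (tin x)); last exact: taug_tin.
rewrite (t0 (tin y)); last exact: taug_tin.
rewrite taug_tin.
by rewrite mulr0 subrr subr0.
Qed.

Lemma aug_zmod : zmod_morphism aug.
Proof.
exact: (qchar_zmod (@taug_zmod _ _) (@taug_scalable _ _) (@taug_monoid _ _)
  taug_env_rel).
Qed.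

Lemma aug_monoid : monoid_morphism aug.
Proof.
exact: (qchar_monoid (@taug_zmod _ _) (@taug_scalable _ _) (@taug_monoid _ _)
  taug_env_rel).
Qed.

Lemma aug_scalable : scalable_for *%R aug.
Proof.
exact: (qchar_scalable (@taug_zmod _ _) (@taug_scalable _ _) (@taug_monoid _ _)
  taug_env_rel).
Qed.

Lemma aug_env_in x : aug (env_in x) = 0.
Proof.
rewrite /aug /env_in (qcharE (@taug_zmod _ _) (@taug_scalable _ _) (@taug_monoid _ _)
  taug_env_rel); exact: taug_tin.
Qed.

HB.instance Definition _ := GRing.PzSemiRing_isNonZero.Build env
  (algquot_neq0 (@taug_zmod _ _) (@taug_scalable _ _) (@taug_monoid _ _)
     taug_env_rel).
HB.instance Definition _ := GRing.Lmodule_isLalgebra.Build K env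
  (@algquot_scalerAl _ _ env_rel).
HB.instance Definition _ := GRing.Lalgebra_isAlgebra.Build K env
  (@algquot_scalerAr _ _ env_rel).
HB.instance Definition _ := GRing.isZmodMorphism.Build env K aug aug_zmod.
HB.instance Definition _ := GRing.isMonoidMorphism.Build env K aug aug_monoid.

(* The one-dimensional U(L)-module on which U(L) acts through aug. *)
Definition trivial (_ : lieSuper K) : Type := K.

HB.instance Definition _ := GRing.Zmodule.on (trivial L).

Definition trivial_act (u : env) (c : trivial L) : trivial L := aug u * (c : K).

Fact trivial_actA u v c : trivial_act u (trivial_act v c) = trivial_act (u * v) c.
Proof. by rewrite /trivial_act rmorphM /= mulrA. Qed.
Fact trivial_act1 : left_id 1 trivial_act.
Proof. by move=> c; rewrite /trivial_act rmorph1 mul1r. Qed.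
Fact trivial_actDr : right_distributive trivial_act +%R.
Proof. by move=> u b c; exact: mulrDr. Qed.
Fact trivial_actDl c : {morph trivial_act^~ c : u v / u + v}.
Proof. by move=> u v; rewrite /trivial_act rmorphD /= mulrDl. Qed.

HB.instance Definition _ := GRing.Zmodule_isLmodule.Build env (trivial L)
  trivial_actA trivial_act1 trivial_actDr trivial_actDl.

End Enveloping.

Section FreeModule.
Variables (K : fieldType) (X : choiceType) (W : lmodType K).

Definition malg_lift (h : X -> W) (g : {malg K[X]}) : W :=
  \sum_(k <- msupp g) g@_k *: h k.

Lemma malg_liftEw h (d : {fset X}) g : (msupp g `<=` d)%fset ->
  malg_lift h g = \sum_(k <- d) g@_k *: h k.
Proof.
move=> le; rewrite /malg_lift (big_fset_incl _ le) //= => x xd /mcoeff_outdom ->.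
by rewrite scale0r.
Qed.

Lemma malg_lift_linear h : linear (malg_lift h).
Proof.
move=> a f g; pose d := (msupp f `|` msupp g `|` msupp (a *: f + g))%fset.
have df : (msupp f `<=` d)%fset by rewrite /d -fsetUA fsubsetUl.
have dg : (msupp g `<=` d)%fset.
  by rewrite /d (fsubset_trans (fsubsetUr (msupp f) _)) // fsubsetUl.
have ds : (msupp (a *: f + g) `<=` d)%fset by rewrite /d fsubsetUr.
rewrite (malg_liftEw h df) (malg_liftEw h dg) (malg_liftEw h ds).
rewrite scaler_sumr -big_split /=; apply: eq_bigr => k _.
by rewrite mcoeffD mcoeffZ scalerDl scalerA.
Qed.

Lemma malg_liftU h x : malg_lift h << x >> = h x.
Proof. by rewrite (malg_liftEw h msuppU_le) big_seq_fset1 mcoeffUU scale1r. Qed.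

End FreeModule.

Section Tensor.
Variables (K : fieldType) (V W : lmodType K).

Definition bilinear_rel : set {malg K[(V * W)%type]} :=
  fun r =>
    (exists (a : K) (v v' : V) (w : W),
       r = << (a *: v + v', w) >> - (a *: << (v, w) >> + << (v', w) >>))
    \/ (exists (a : K) (v : V) (w w' : W),
       r = << (v, a *: w + w') >> - (a *: << (v, w) >> + << (v, w') >>)).

Definition tensor : Type := quotmod bilinear_rel.

HB.instance Definition _ := GRing.Lmodule.on tensor.

Definition tens (v : V) (w : W) : tensor := qmod bilinear_rel << (v, w) >>.

Lemma tens_linearl w : linear (tens^~ w).
Proof.
move=> a v v'; rewrite /tens -linearP; apply/qmodP; apply: span_gen.
by left; exists a, v, v', w.
Qed.

Lemma tens_linearr v : linear (tens v).
Proof.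
move=> a w w'; rewrite /tens -linearP; apply/qmodP; apply: span_gen.
by right; exists a, v, w, w'.
Qed.

Lemma tensor_ind (P : tensor -> Prop) :
  (forall v w, P (tens v w)) -> (forall x y, P x -> P y -> P (x + y)) ->
  forall x, P x.
Proof.
move=> Pt PD; elim/quot_ind=> g.
have Z a v w : a *: tens v w = tens (a *: v) w.
  have t0 : tens 0 w = 0.
    have /esym/eqP := tens_linearl w (-1) 0 0.
    by rewrite scaler0 addr0 scaleN1r addNr eq_sym => /eqP.
  by rewrite -[a *: v]addr0 tens_linearl t0 addr0.
have P0 : P 0 by rewrite -(scale0r (tens 0 0)) Z.
rewrite [g]monalgE linear_sum /=; elim/big_ind: _ => // -[v w] _.
have -> : << g@_(v, w) *g (v, w) >> = g@_(v, w) *: << (v, w) >> :> {malg K[_]}.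
  by apply/malgP => k; rewrite mcoeffZ !mcoeffU mulrnAr mulr1.
by rewrite linearZ /= -/(tens v w) Z.
Qed.

Section Lift.
Variables (X : lmodType K) (h : V -> W -> X).

Definition tensor_lift (x : tensor) : X :=
  malg_lift (fun p => h p.1 p.2) (repr (x : Quotient.quot (span bilinear_rel))).

Hypothesis hl : forall w, linear (h^~ w).
Hypothesis hr : forall v, linear (h v).

Lemma tensor_lift_qmod g :
  tensor_lift (qmod bilinear_rel g) = malg_lift (fun p => h p.1 p.2) g.
Proof.
pose f := malg_lift (fun p : V * W => h p.1 p.2).
have fL : linear f := malg_lift_linear _.
have f0 : f 0 = 0 by rewrite /f /malg_lift msupp0 big_seq_fset0.
have fB u v : f (u - v) = f u - f v.
  by rewrite [u - v]addrC -[- v]scaleN1r fL scaleN1r addrC.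
apply/eqP; rewrite -subr_eq0 /tensor_lift -!/(f _) -fB.
have : repr (qmod bilinear_rel g : Quotient.quot (span bilinear_rel)) - g
    \in span bilinear_rel by apply/qmodP; rewrite qmod_repr.
move/spanP/(_ [pred x | f x == 0]); apply.
  split=> [|k u v]; rewrite !inE ?f0 // => /eqP hu /eqP hv.
  by rewrite fL hu hv scaler0 addr0.
move=> r [[a [v [v' [w ->]]]]|[a [v [w [w' ->]]]]]; rewrite inE fB fL /f.
  by rewrite !malg_liftU /= (hl w) subrr.
by rewrite !malg_liftU /= (hr v) subrr.
Qed.

Lemma tensor_liftE v w : tensor_lift (tens v w) = h v w.
Proof. by rewrite /tens tensor_lift_qmod malg_liftU. Qed.

Lemma tensor_lift_linear : linear tensor_lift.
Proof.
move=> a; elim/quot_ind=> u; elim/quot_ind=> v.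
by rewrite -linearP !tensor_lift_qmod malg_lift_linear.
Qed.

End Lift.
End Tensor.

(* For a K-algebra A and a K-vector space W, A (x) W is a left A-module, A
   acting by left multiplication on the first factor. *)
Section Extension.
Variables (K : fieldType) (A : algType K) (W : lmodType K).

Definition extension : Type := tensor A W.

HB.instance Definition _ := GRing.Zmodule.on extension.

Fact ext_act_key : unit. Proof. by []. Qed.
Definition ext_act : A -> extension -> extension :=
  locked_with ext_act_key (fun a (m : tensor A W) =>
    tensor_lift (fun (b : A) (w : W) => tens (a * b) w) m).

Let hl a (w : W) : linear (fun b : A => tens (a * b) w).
Proof. by move=> k b c; rewrite mulrDr -scalerAr tens_linearl. Qed.
Let hr a b : linear (fun w : W => tens (a * b : A) w).
Proof. exact: tens_linearr. Qed.

Lemma ext_actE a b w : ext_act a (tens b w) = tens (a * b) w.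
Proof. rewrite /ext_act unlock; exact: (tensor_liftE (hl a) (hr a)). Qed.

Fact ext_actDr : right_distributive ext_act +%R.
Proof.
move=> a m n; rewrite /ext_act unlock; have := tensor_lift_linear (hl a) (hr a) 1 m n.
by rewrite !scale1r.
Qed.
Fact ext_actA a b m : ext_act a (ext_act b m) = ext_act (a * b) m.
Proof.
elim/tensor_ind: m => [c w|m n IHm IHn]; first by rewrite !ext_actE mulrA.
by rewrite !ext_actDr IHm IHn.
Qed.
Fact ext_act1 : left_id 1 ext_act.
Proof.
elim/tensor_ind=> [c w|m n IHm IHn]; first by rewrite ext_actE mul1r.
by rewrite ext_actDr IHm IHn.
Qed.
Fact ext_actDl m : {morph ext_act^~ m : a b / a + b}.
Proof.
move=> a b; elim/tensor_ind: m => [c w|m n IHm IHn].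
  by rewrite !ext_actE mulrDl -{1}[a * c]scale1r tens_linearl scale1r.
by rewrite !ext_actDr IHm IHn addrACA.
Qed.

HB.instance Definition _ := GRing.Zmodule_isLmodule.Build A extension
  ext_actA ext_act1 ext_actDr ext_actDl.

End Extension.

Section Powers.
Variables (K : fieldType) (V : lmodType K).

Definition subst n (v : {ffun 'I_n -> V}) (i : 'I_n) (x : V) : {ffun 'I_n -> V} :=
  [ffun j => if j == i then x else v j].

Definition multilinear_rel n : set {malg K[{ffun 'I_n -> V}]} :=
  fun r => exists (v : {ffun 'I_n -> V}) (i : 'I_n) (a : K) (x y : V),
    r = << subst v i (a *: x + y) >>
        - (a *: << subst v i x >> + << subst v i y >>).

Definition tpower n : Type := quotmod (@multilinear_rel n).
HB.instance Definition _ n := GRing.Lmodule.on (tpower n).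

Definition tpure n (v : {ffun 'I_n -> V}) : tpower n :=
  qmod (@multilinear_rel n) << v >>.

Definition alternating_rel n : set (tpower n) :=
  fun r => exists (v : {ffun 'I_n -> V}) (i j : 'I_n),
    [/\ i != j, v i = v j & r = tpure v].

Definition exterior n : Type := quotmod (@alternating_rel n).
HB.instance Definition _ n := GRing.Lmodule.on (exterior n).

Definition symmetric_rel n : set (tpower n) :=
  fun r => exists (v : {ffun 'I_n -> V}) (s : 'S_n),
    r = tpure [ffun i => v (s i)] - tpure v.

Definition sympower n : Type := quotmod (@symmetric_rel n).
HB.instance Definition _ n := GRing.Lmodule.on (sympower n).

(* Meant for sequences of size n: longer ones are truncated, shorter ones are
   padded with 0. *)
Definition wedge n (xs : seq V) : exterior n :=
  qmod (@alternating_rel n) (tpure [ffun i : 'I_n => nth 0 xs i]).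

Definition symprod n (ys : seq V) : sympower n :=
  qmod (@symmetric_rel n) (tpure [ffun i : 'I_n => nth 0 ys i]).

End Powers.

Section DirectSum.
Variables (K : fieldType) (I : finType) (V : I -> lmodType K).

Definition dsum : Type := forall i, V i.

HB.instance Definition _ := Choice.copy dsum (forall i, V i).

Let add (f g : dsum) : dsum := fun i => f i + g i.
Let opp (f : dsum) : dsum := fun i => - f i.
Let scale (a : K) (f : dsum) : dsum := fun i => a *: f i.

Fact dsum_addA : associative add.
Proof. by move=> f g h; apply: functional_extensionality_dep => i; exact: addrA. Qed.
Fact dsum_addC : commutative add.
Proof. by move=> f g; apply: functional_extensionality_dep => i; exact: addrC. Qed.
Fact dsum_add0 : left_id ((fun i => 0) : dsum) add.
Proof. by move=> f; apply: functional_extensionality_dep => i; exact: add0r. Qed.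
Fact dsum_addN : left_inverse ((fun i => 0) : dsum) opp add.
Proof. by move=> f; apply: functional_extensionality_dep => i; exact: addNr. Qed.

HB.instance Definition _ :=
  GRing.isZmodule.Build dsum dsum_addA dsum_addC dsum_add0 dsum_addN.

Fact dsum_scaleA a b f : scale a (scale b f) = scale (a * b) f.
Proof. by apply: functional_extensionality_dep => i; exact: scalerA. Qed.
Fact dsum_scale1 : left_id 1 scale.
Proof. by move=> f; apply: functional_extensionality_dep => i; exact: scale1r. Qed.
Fact dsum_scaleDr : right_distributive scale +%R.
Proof. by move=> a f g; apply: functional_extensionality_dep => i; exact: scalerDr. Qed.
Fact dsum_scaleDl f : {morph scale^~ f : a b / a + b}.
Proof. by move=> a b; apply: functional_extensionality_dep => i; exact: scalerDl. Qed.

HB.instance Definition _ := GRing.Zmodule_isLmodule.Build K dsum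
  dsum_scaleA dsum_scale1 dsum_scaleDr dsum_scaleDl.

Definition dsum_in (i : I) (x : V i) : dsum := dfwith (fun j => 0 : V j) x.

End DirectSum.

Section Resolution.
Variables (A : pzRingType).

Definition is_basis (M : lmodType A) (I : choiceType) (b : I -> M) : Prop :=
  forall m : M, exists! c : {malg A[I]}, m = \sum_(i <- msupp c) c@_i *: b i.

Definition is_free (M : lmodType A) : Prop :=
  exists (I : choiceType) (b : I -> M), is_basis b.

Definition free_resolution (N : lmodType A) (M : nat -> lmodType A)
    (d : forall k, M k.+1 -> M k) (e : M 0 -> N) : Prop :=
  [/\ forall k, is_free (M k),
      linear e /\ (forall k, linear (d k)),
      forall n, exists m, e m = n,
      forall m, e m = 0 <-> exists m', d 0%N m' = m &
      forall k m, d k m = 0 <-> exists m', d k.+1 m' = m].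

End Resolution.

Section Complex.
Variables (K : fieldType) (L : lieSuper K).

Definition superpower k : Type :=
  dsum (fun p : 'I_k.+1 =>
    tensor (exterior (even_part L) p) (sympower (odd_part L) (k - p))
      : lmodType K).
HB.instance Definition _ k := GRing.Lmodule.on (superpower k).

Definition cmod k : lmodType (env L) := extension (env L) (superpower k).

(* The element u (x) (x_1 /\ ... /\ x_p) (x) (y_1 ... y_q) of M_k, for sequences
   xs and ys of sizes p and q with p + q = k. *)
Definition cgen k (u : env L) (xs : seq (even_part L)) (ys : seq (odd_part L)) :
    cmod k :=
  tens u (dsum_in (i := inord (size xs) : 'I_k.+1)
            (tens (wedge _ xs) (symprod _ ys)) : superpower k).

Definition ev (x : even_part L) : total_space L := (x, 0).
Definition od (y : odd_part L) : total_space L := (0, y).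

Definition omit (T : Type) i (s : seq T) : seq T := take i s ++ drop i.+1 s.

(* Indices are counted from 0, so that each sign (-1)^s of the usual formula
   becomes (-1)^(s+1). *)
Definition boundary k (u : env L) (xs : seq (even_part L))
    (ys : seq (odd_part L)) : cmod k :=
  let p := size xs in let q := size ys in
  let x i := nth 0 xs i in let y i := nth 0 ys i in
  \sum_(s < p) \sum_(t < p | (s < t)%N) (-1) ^+ (s.+1 + t.+1) *:
     cgen k u ((bracket (ev (x s)) (ev (x t))).1 :: omit s (omit t xs)) ys
  + \sum_(s < p) \sum_(t < q) (-1) ^+ s.+1 *:
     cgen k u (omit s xs) ((bracket (ev (x s)) (od (y t))).2 :: omit t ys)
  - \sum_(s < q) \sum_(t < q | (s < t)%N)
     cgen k u ((bracket (od (y s)) (od (y t))).1 :: xs) (omit s (omit t ys))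
  + \sum_(s < p) (-1) ^+ s.+2 *: cgen k (u * env_in (ev (x s))) (omit s xs) ys
  + (-1) ^+ p *: \sum_(t < q) cgen k (u * env_in (od (y t))) xs (omit t ys).

(* The tensors cgen u xs ys generate the additive group M_(k+1), so these
   conditions determine d. *)
Definition is_differential (d : forall k, cmod k.+1 -> cmod k) : Prop :=
  forall k, zmod_morphism (d k) /\
    forall u xs ys, (size xs + size ys)%N = k.+1 ->
      d k (cgen k.+1 u xs ys) = boundary k u xs ys.

(* Through u |-> cgen 0 u [::] [::], U is identified with
   M_0 = U (x) (Lambda^0 (x) S^0). *)
Definition is_augmentation (e : cmod 0 -> trivial L) : Prop :=
  zmod_morphism e /\ forall u, e (cgen 0 u [::] [::]) = aug u.

End Complex.

(* Main.v *)
(* Let C be the cone of L: a copy of L together with a copy in which each element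
   x has a barred, parity-reversed twin, and with the bracket in which two barred
   elements commute. Unbarring is an odd derivation d of A = U(C) of square zero.
   By the Poincare-Birkhoff-Witt theorem for C, with unbarred letters sorted before
   barred even letters and these before barred odd ones, A is the direct sum of the
   M_k: u (x) x1 ^ ... ^ xp (x) y1 ... yq corresponds to u x1' ... xp' y1' ... yq',
   and d restricts to the boundary. Barring letters one at a time gives a map h such
   that dh + hd multiplies the words of length n by n modulo shorter words; hence in
   characteristic 0 every cycle of A is a boundary up to a scalar. *)
Require Import Defs.
From HB Require Import structures.
From mathcomp Require Import all_boot all_fingroup all_algebra.
From mathcomp Require Import generic_quotient ring_quotient.
From mathcomp Require Import boolp classical_sets wochoice reals complex.
From mathcomp Require Import finmap monalg zify.

(* Some names of Defs, such as span, are otherwise shadowed by MathComp. *)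
Import Defs.

Set Implicit Arguments.
Unset Strict Implicit.
Unset Printing Implicit Defensive.

Import GRing.Theory.
Local Open Scope ring_scope.
Local Open Scope quotient_scope.

(** The signs of the cone follow the bidegree (bar, parity) in Z/2 x Z/2 and not the total parity:
    two letters get the product of the sign of their bars and the sign of their parities. Barred
    even letters then anticommute and barred odd ones commute, as exterior and symmetric powers
    require, and d sees only the bar sign. Hence straightening is proved for color brackets, that
    is, for a symmetric sign rule to which brackets contribute additively. Unbarring respects the
    relations of the cone, but barring does not: the Leibniz rule sends [x, y] to [x', y] + [x, y']
    = 2 [x, y]' and not to [x, y]'. So h cannot be a derivation. It is prescribed on normal words,
    which their linear independence permits, and it satisfies the Leibniz rule only modulo shorter
    words; this is why the homotopy formula is used along the length filtration. All M_k sit in A at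
    once. The projections onto them commute with d, so exactness passes from A to each degree; the
    scalars that survive in A lie in M_0, where the augmentation detects them. *)

(** * Identities in abelian groups, by reflection *)

Inductive zexp := ZVar of nat | ZZero | ZAdd of zexp & zexp | ZOpp of zexp.

Fixpoint zeval (V : zmodType) (env : seq V) (e : zexp) : V :=
  match e with
  | ZVar n => nth 0 env n
  | ZZero => 0
  | ZAdd a b => zeval env a + zeval env b
  | ZOpp a => - zeval env a
  end.

Fixpoint zcoef (e : zexp) (i : nat) : int :=
  match e with
  | ZVar n => (n == i)%:Z
  | ZZero => 0
  | ZAdd a b => zcoef a i + zcoef b i
  | ZOpp a => - zcoef a i
  end.

Fixpoint zvar_lt (n : nat) (e : zexp) : bool :=
  match e with
  | ZVar k => (k < n)%N
  | ZZero => true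
  | ZAdd a b => zvar_lt n a && zvar_lt n b
  | ZOpp a => zvar_lt n a
  end.

Lemma zevalE (V : zmodType) (env : seq V) e : zvar_lt (size env) e ->
  zeval env e = \sum_(i < size env) env`_i *~ zcoef e i.
Proof.
elim: e => /= [n ltn| _ |a IHa b IHb /andP[/IHa-> /IHb->]|a IHa /IHa->].
- rewrite (bigD1 (Ordinal ltn)) //= eqxx big1 ?addr0 // => i.
  by rewrite -val_eqE /= eq_sym => /negPf->.
- by rewrite big1.
- by rewrite -big_split /=; apply: eq_bigr => i _; rewrite mulrzDr.
- by rewrite -sumrN; apply: eq_bigr => i _; rewrite mulrNz.
Qed.

(** Reflection principle: the hypothesis compares integer coefficients and is proved by
    computation. *)
Lemma zmodP (V : zmodType) (env : seq V) e1 e2 :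
  [&& zvar_lt (size env) e1, zvar_lt (size env) e2
    & all (fun i => zcoef e1 i == zcoef e2 i) (iota 0 (size env))] ->
  zeval env e1 = zeval env e2.
Proof.
move=> /and3P[h1 h2 /allP h]; rewrite !zevalE //; apply: eq_bigr => i _.
by rewrite (eqP (h i _)) // mem_iota /=.
Qed.

Ltac zmod_index x s :=
  lazymatch s with
  | ?y :: ?s' =>
      match goal with
      | _ => let _ := match goal with _ => unify x y end in constr:(0%N)
      | _ => let n := zmod_index x s' in constr:(n.+1)
      end
  end.

Ltac zmod_vars s t :=
  lazymatch t with
  | (?a + ?b)%R => let s1 := zmod_vars s a in zmod_vars s1 b
  | (- ?a)%R => zmod_vars s a
  | 0%R => s
  | ?x => match goal with
          | _ => let n := zmod_index x s in s
          | _ => constr:(x :: s)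
          end
  end.

Ltac zmod_reify s t :=
  lazymatch t with
  | (?a + ?b)%R =>
      let a1 := zmod_reify s a in let b1 := zmod_reify s b in constr:(ZAdd a1 b1)
  | (- ?a)%R => let a1 := zmod_reify s a in constr:(ZOpp a1)
  | 0%R => constr:(ZZero)
  | ?x => let n := zmod_index x s in constr:(ZVar n)
  end.

(* Decides the identities that hold in every abelian group. *)
Ltac zmod :=
  lazymatch goal with
  | |- @eq ?T ?a ?b =>
      let s0 := constr:(@nil T) in
      let s1 := zmod_vars s0 a in
      let s := zmod_vars s1 b in
      let e1 := zmod_reify s a in
      let e2 := zmod_reify s b in
      exact: (@zmodP _ s e1 e2 isT)
  end.

Lemma eq_addr (V : zmodType) (a b c d : V) : a = b -> c = d -> a + c = b + d.
Proof. by move=> -> ->. Qed.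

(** Linear combination: when a - b and c - d agree identically, a = b follows from c = d. The second
    hypothesis is that identity without subtraction, left to [zmod]. *)
Lemma zmod_from (V : zmodType) (a b c d : V) : c = d -> a + d = b + c -> a = b.
Proof. by move=> -> /addIr. Qed.

(** * Linear maps and linear extension from a basis *)

(** Turns a proof of linearity into a bundled map, to which the lemmas on linear maps apply. *)
Lemma linear_bundle (K : pzRingType) (U V : lmodType K) (f : U -> V) : linear f ->
  exists g : {linear U -> V}, g =1 f.
Proof.
move=> fL; pose F := GRing.isLinear.Build K U V *:%R f fL.
pose g : {linear U -> V} := HB.pack f F.
by exists g.
Qed.

Lemma linear_zero (K : pzRingType) (U V : lmodType K) (f : U -> V) : linear f -> f 0 = 0.
Proof. by move=> /linear_bundle[g e]; rewrite -e linear0. Qed.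

Section MalgLift.
Variables (K : fieldType) (X : choiceType) (W : lmodType K).
Implicit Types (h : X -> W) (g : {malg K[X]}).

HB.instance Definition _ h :=
  GRing.isLinear.Build K {malg K[X]} W *:%R (malg_lift h) (malg_lift_linear h).

Lemma malgU_scale (c : K) (x : X) : << c *g x >> = c *: << x >> :> {malg K[X]}.
Proof. by apply/malgP => k; rewrite mcoeffZ !mcoeffU mulrnAr mulr1. Qed.

Lemma malg_lin_ind (P : {malg K[X]} -> Prop) :
  P 0 -> (forall c u v, P u -> P v -> P (c *: u + v)) ->
  (forall x, P << x >>) -> forall g, P g.
Proof.
move=> P0 PD PU g; rewrite [g]monalgE; elim/big_rec: _ => // x y _ Py.
by rewrite malgU_scale; apply: PD.
Qed.

Lemma eq_malg_lift h h' g : {in msupp g, h =1 h'} ->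
  malg_lift h g = malg_lift h' g.
Proof.
move=> e; rewrite /malg_lift big_seq [RHS]big_seq.
by apply: eq_bigr => k /e->.
Qed.

Lemma malg_liftD h h' g :
  malg_lift (fun k => h k + h' k) g = malg_lift h g + malg_lift h' g.
Proof.
by rewrite /malg_lift -big_split; apply: eq_bigr => k _; rewrite scalerDr.
Qed.

Lemma malg_liftZ (c : K) h g :
  malg_lift (fun k => c *: h k) g = c *: malg_lift h g.
Proof.
rewrite /malg_lift scaler_sumr; apply: eq_bigr => k _.
by rewrite !scalerA mulrC.
Qed.

Lemma malg_lift_comp (W' : lmodType K) (f : W -> W') h g : linear f ->
  f (malg_lift h g) = malg_lift (fun k => f (h k)) g.
Proof.
move=> /linear_bundle[f1 e]; rewrite -e /malg_lift linear_sum.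
by apply: eq_bigr => k _; rewrite linearZ e.
Qed.

End MalgLift.

Lemma malg_liftA (K : fieldType) (X Y : choiceType) (W : lmodType K)
    (h : Y -> W) (h' : X -> {malg K[Y]}) (g : {malg K[X]}) :
  malg_lift h (malg_lift h' g) = malg_lift (fun k => malg_lift h (h' k)) g.
Proof. exact/malg_lift_comp/malg_lift_linear. Qed.

(** * Straightening and the Poincare-Birkhoff-Witt theorem *)

(* x and y anticommute up to br x y if sg x y holds, and commute up to br x y
   otherwise. *)
Section PBW.
Variables (K : fieldType) (B : choiceType) (le : rel B).
Variables (sg : rel B) (br : B -> B -> {malg K[B]}) (X : lmodType K).

Definition sgn (x y : B) : K := (-1) ^+ (sg x y).

(* F (a v b), F being extended linearly in the middle letter. *)
Definition bracketed (F : seq B -> X) (a : seq B) (v : {malg K[B]}) (b : seq B) : X :=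
  malg_lift (fun k => F (a ++ k :: b)) v.

Definition straightens (F : seq B -> X) : Prop := forall a x y b,
  F (a ++ x :: y :: b) = sgn x y *: F (a ++ y :: x :: b) + bracketed F a (br x y) b.

(* A letter x with sg x x anticommutes with itself up to shorter words, so it may
   not be repeated. *)
Definition ordered_pair (x y : B) := le x y && ((x != y) || ~~ sg x x).

Definition normal_word (w : seq B) := sorted ordered_pair w.

Fixpoint first_descent (w : seq B) : option (seq B * B * B * seq B) :=
  if w is x :: w' then
    if w' is y :: b then
      if ordered_pair x y then
        omap (fun t => let: (a, u, v, c) := t in (x :: a, u, v, c)) (first_descent w')
      else Some ([::], x, y, b)
    else None
  else None.

Fixpoint inversions (w : seq B) : nat :=
  if w is x :: w' then (count (fun y => ~~ le x y) w' + inversions w')%N else 0%N.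

(* Rewriting always at the first descent determines a unique extension F of f from
   normal words to all words. That F satisfies the relation at every position is
   proved by induction on the length and the number of inversions; the two critical
   cases are those in which the first descent overlaps the given position and in
   which it is disjoint from it. *)
Section Straightening.
Variable f : seq B -> X.

Definition straighten_step (F G : seq B -> X) (w : seq B) : X :=
  if first_descent w is Some (a, x, y, b) then
    if x == y then 2^-1 *: bracketed F a (br x x) b
    else sgn x y *: G (a ++ y :: x :: b) + bracketed F a (br x y) b
  else f w.

(** [F] serves the shorter words created by brackets, the recursion the words of the same length
    with fewer inversions. The number [m] is fuel; the value at 0 is not reached as long as [m]
    exceeds the number of inversions. *)
Fixpoint straighten_inv (F : seq B -> X) (m : nat) : seq B -> X :=
  if m is m'.+1 then straighten_step F (straighten_inv F m') else f.

Fixpoint straighten_size (n : nat) : seq B -> X :=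
  if n is n'.+1 then fun w => straighten_inv (straighten_size n') (inversions w).+1 w
  else f.

Definition straighten (w : seq B) : X := straighten_size (size w).+1 w.

Hypothesis le_refl : reflexive le.
Hypothesis le_anti : antisymmetric le.
Hypothesis le_total : total le.

(** The exchange changes the relative position of the pair (x, y) and of no other pair. *)
Lemma inversions_swap a x y b : ~~ le x y ->
  inversions (a ++ x :: y :: b) = (inversions (a ++ y :: x :: b)).+1.
Proof.
move=> nle; have lyx : le y x by case/orP: (le_total x y) nle => ->.
elim: a => [|z a IH] /=; last first.
  rewrite IH addnS; congr (_ + _).+1.
  by apply/seq.permP; rewrite perm_cat2l; apply/seq.permP => p /=; rewrite addnCA.
by rewrite lyx nle /=; lia.
Qed.

Lemma first_descent_cons x y w : first_descent (x :: y :: w) =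
  if ordered_pair x y then
    omap (fun t => let: (a, u, v, c) := t in (x :: a, u, v, c)) (first_descent (y :: w))
  else Some ([::], x, y, w).
Proof. by []. Qed.

Lemma first_descentP w a x y b : first_descent w = Some (a, x, y, b) ->
  w = a ++ x :: y :: b /\ ~~ ordered_pair x y.
Proof.
elim: w a => [//|u [//|v w] IH] a.
rewrite first_descent_cons; case: ifPn => o; last by case=> <- <- <- <-.
case e: (first_descent (v :: w)) => [[[[a' x'] y'] b']|] // [<- ex ey eb].
by rewrite ex ey eb in e; have [-> ?] := IH _ e.
Qed.

Lemma first_descent_None w : first_descent w = None -> normal_word w.
Proof.
elim: w => [//|u [//|v w] IH]; rewrite first_descent_cons.
case: ifPn => // o; case e: (first_descent _) => [[[[? ?] ?] ?]|] // _.
by rewrite /normal_word /= o; exact: IH.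
Qed.

Lemma first_descent_normal w : normal_word w -> first_descent w = None.
Proof.
elim: w => [//|u [//|v w] IH] nw.
have /andP[o h] : ordered_pair u v && normal_word (v :: w) := nw.
by rewrite first_descent_cons o IH.
Qed.

(** The trichotomy behind confluence: the given descent is itself the first one, shares its letter
    [x] with the first one, or is disjoint from it. *)
Lemma first_descent_cat a x y b : ~~ ordered_pair x y ->
  [\/ first_descent (a ++ x :: y :: b) = Some (a, x, y, b),
      exists a' u, [/\ a = rcons a' u, ~~ ordered_pair u x &
        first_descent (a ++ x :: y :: b) = Some (a', u, x, y :: b)]
    | exists a' u v c, [/\ a = a' ++ u :: v :: c, ~~ ordered_pair u v &
        first_descent (a ++ x :: y :: b) = Some (a', u, v, c ++ x :: y :: b)]].
Proof.
move=> nxy; elim: a => [|z a IH].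
  by apply: Or31; rewrite /= (negPf nxy).
case: a IH => [|t a] IH.
  have [o|no] := boolP (ordered_pair z x).
    by apply: Or31; rewrite /= o (negPf nxy).
  by apply: Or32; exists [::], z; rewrite /= (negPf no).
have [o|no] := boolP (ordered_pair z t); last first.
  by apply: Or33; exists [::], z, t, a; rewrite /= (negPf no).
have -> : first_descent ((z :: t :: a) ++ x :: y :: b) =
    omap (fun t => let: (a, u, v, c) := t in (z :: a, u, v, c))
      (first_descent ((t :: a) ++ x :: y :: b)) by rewrite /= o.
case: IH => [->|[a' [u [-> nu ->]]]|[a' [u [v [c [-> nu ->]]]]]].
- exact: Or31.
- by apply: Or32; exists (z :: a'), u.
- by apply: Or33; exists (z :: a'), u, v, c.
Qed.

Lemma nordered_pair x y : ~~ ordered_pair x y -> x != y -> ~~ le x y.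
Proof. by move=> + nxy; rewrite /ordered_pair nxy andbT. Qed.

Lemma nordered_eq x : ~~ ordered_pair x x = sg x x.
Proof. by rewrite /ordered_pair eqxx le_refl /= negbK. Qed.

Lemma eq_bracketed F F' a v b :
  (forall k, F (a ++ k :: b) = F' (a ++ k :: b)) ->
  bracketed F a v b = bracketed F' a v b.
Proof. by move=> e; apply: eq_malg_lift => k _; apply: e. Qed.

Lemma straighten_inv_stable F m m' w : (inversions w < m)%N -> (inversions w < m')%N ->
  straighten_inv F m w = straighten_inv F m' w.
Proof.
elim: m m' w => [//|m IH] [//|m'] w lt lt' /=; rewrite /straighten_step.
case e: first_descent => [[[[a x] y] b]|] //.
have [ew nxy] := first_descentP e.
case: eqVneq => // neq; congr (_ *: _ + _).
have := inversions_swap a b (nordered_pair nxy neq).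
by rewrite -ew => ei; apply: IH; lia.
Qed.

Lemma eq_straighten_inv F F' m w :
  (forall w', (size w' < size w)%N -> F w' = F' w') ->
  straighten_inv F m w = straighten_inv F' m w.
Proof.
elim: m w => [//|m IH] w e /=; rewrite /straighten_step.
case ed: first_descent => [[[[a x] y] b]|] //.
have [ew _] := first_descentP ed.
have eb v : bracketed F a v b = bracketed F' a v b.
  by apply: eq_bracketed => k; apply: e; rewrite ew !size_cat /=; lia.
rewrite !eb; case: ifP => // _; congr (_ *: _ + _); apply: IH => w' lt.
by apply: e; move: lt; rewrite ew !size_cat.
Qed.

Lemma straighten_size_stable n n' w : (size w < n)%N -> (size w < n')%N ->
  straighten_size n w = straighten_size n' w.
Proof.
elim: n n' w => [//|n IH] [//|n'] w lt lt'.
rewrite [LHS]/= [RHS]/=; apply: (@eq_straighten_inv _ _ (inversions w).+1) => w' ltw.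
by apply: IH; lia.
Qed.

(** The recursion without fuel, from which the later properties of [straighten] are derived. *)
Lemma straightenE w : straighten w = straighten_step straighten straighten w.
Proof.
rewrite /straighten [LHS]/= /straighten_step.
case ed: first_descent => [[[[a x] y] b]|] //.
have [ew nxy] := first_descentP ed.
have eb v : bracketed (straighten_size (size w)) a v b = bracketed straighten a v b.
  apply: eq_bracketed => k; apply: straighten_size_stable => //.
  by rewrite ew !size_cat /=; lia.
rewrite !eb; case: eqVneq => // neq; congr (_ *: _ + _).
have ei := inversions_swap a b (nordered_pair nxy neq).
have -> : size (a ++ y :: x :: b) = size w by rewrite ew !size_cat.
rewrite [RHS]/=.
rewrite (@straighten_inv_stable _ _ (inversions (a ++ y :: x :: b)).+1) // ?ew ?ei //.
Qed.

Lemma straighten_normal w : normal_word w -> straighten w = f w.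
Proof.
by move=> nw; rewrite straightenE /straighten_step first_descent_normal.
Qed.

Hypothesis le_trans : transitive le.
Hypothesis two_neq0 : 2 != 0 :> K.
Hypothesis three_neq0 : 3 != 0 :> K.
Hypothesis sgC : symmetric sg.
Hypothesis br_skew : forall x y, br x y = - (sgn x y *: br y x).
Hypothesis br_sg : forall x y k z, k \in msupp (br x y) -> sg k z = sg x z (+) sg y z.
Hypothesis br_jacobi : forall u x y,
  malg_lift (br u) (br x y) =
  malg_lift (br^~ y) (br u x) + sgn u x *: malg_lift (br x) (br u y).

Let straightens_at (F : seq B -> X) a x y b := F (a ++ x :: y :: b) =
  sgn x y *: F (a ++ y :: x :: b) + bracketed F a (br x y) b.

Lemma double_inj (V : lmodType K) (p q : V) : p + p = q + q -> p = q.
Proof.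
by rewrite -!mulr2n -!scaler_nat => /(scalerI two_neq0).
Qed.

Lemma br_even x : ~~ sg x x -> br x x = 0.
Proof.
move=> e; apply: double_inj; rewrite {1}br_skew /sgn (negPf e) scale1r; zmod.
Qed.

Lemma bracketed0 F a b : bracketed F a 0 b = 0.
Proof. exact: linear0. Qed.

Lemma bracketedN F a v b : bracketed F a (- v) b = - bracketed F a v b.
Proof. exact: linearN. Qed.

Lemma bracketedZ F a c v b : bracketed F a (c *: v) b = c *: bracketed F a v b.
Proof. exact: linearZ. Qed.

Lemma bracketedD F a v w b :
  bracketed F a (v + w) b = bracketed F a v b + bracketed F a w b.
Proof. exact: linearD. Qed.

Lemma straightens_at_sym F a x y b :
  straightens_at F a y x b -> straightens_at F a x y b.
Proof.
rewrite /straightens_at => ->; rewrite (br_skew x) bracketedN bracketedZ /sgn sgC.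
case: (sg y x); rewrite ?expr1 ?expr0 ?scaleN1r ?scale1r; zmod.
Qed.

(** Skew-symmetry makes the relations for (x, y) and (y, x) equivalent, so only descents need a
    proof. Equal letters that form an ordered pair commute with themselves, and then [x, x] = 0. *)
Lemma straightens_at_ordered F a x y b :
  (~~ ordered_pair y x -> straightens_at F a y x b) ->
  ordered_pair x y -> straightens_at F a x y b.
Proof.
case: (eqVneq x y) => [<- _|neq h] o.
  have : ~~ sg x x by rewrite -nordered_eq o.
  move=> e; rewrite /straightens_at br_even // bracketed0 addr0 /sgn.
  by rewrite (negPf e) scale1r.
apply: straightens_at_sym; apply: h; case/andP: o => lxy _.
apply/negP => /andP[lyx _].
by case/eqP: neq; apply: le_anti; rewrite lxy.
Qed.

(** Moves [y] to the left of all letters of [v] at once; they all have the same sign with [y], so it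
    can be taken out of the sum. *)
Lemma bracketed_straighten F a v y b t : {in msupp v, forall k, sg k y = t} ->
  (forall k, straightens_at F a k y b) ->
  bracketed F a v (y :: b) = (-1) ^+ t *: bracketed F (rcons a y) v b
    + bracketed F a (malg_lift (br^~ y) v) b.
Proof.
move=> tv h; rewrite /bracketed malg_liftA -malg_liftZ -malg_liftD.
by apply: eq_malg_lift => k /tv <-; rewrite cat_rcons; apply: h.
Qed.

Lemma bracketed_straighten_r F a v y b t : {in msupp v, forall k, sg k y = t} ->
  (forall k, straightens_at F a y k b) ->
  bracketed F (rcons a y) v b = (-1) ^+ t *: bracketed F a v (y :: b)
    + bracketed F a (malg_lift (br y) v) b.
Proof.
move=> tv h; rewrite /bracketed malg_liftA -malg_liftZ -malg_liftD.
by apply: eq_malg_lift => k /tv <-; rewrite cat_rcons sgC; apply: h.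
Qed.

Let F := straighten.

(** Immediate from the recursion for distinct letters. For equal ones the relation reads 2 xx =
    [x, x], which is the origin of the factor 1/2 in [straighten_step]. *)
Lemma straightens_at_first a x y b :
  first_descent (a ++ x :: y :: b) = Some (a, x, y, b) -> straightens_at F a x y b.
Proof.
move=> e; have [_ nxy] := first_descentP e.
rewrite /straightens_at [LHS]straightenE /straighten_step e.
have [exy|//] := eqVneq x y; subst y; move: nxy; rewrite nordered_eq => oxx.
have -> : F (a ++ x :: x :: b) = 2^-1 *: bracketed F a (br x x) b.
  by rewrite [LHS]straightenE /straighten_step e eqxx.
set v := bracketed _ _ _ _.
have e2 : 2^-1 *: v + 2^-1 *: v = v.
  by rewrite -scalerDl -[_ + _]mulr2n -[_ *+ 2]mulr_natr mulVf // scale1r.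
by rewrite /sgn oxx expr1 scaleN1r; apply: (zmod_from e2); zmod.
Qed.

Section Step.
Variables (N m : nat).
Hypothesis IHN : forall a x y b, (size (a ++ x :: y :: b) < N)%N ->
  straightens_at F a x y b.
Hypothesis IHm : forall a x y b, ~~ ordered_pair x y ->
  size (a ++ x :: y :: b) = N -> (inversions (a ++ x :: y :: b) < m)%N ->
  straightens_at F a x y b.

(** The critical word u x y. Its two reductions use relations at words that are shorter or have
    fewer inversions, and the double brackets left over cancel by the Jacobi identity. *)
Lemma straighten_overlap a u x y b : ~~ ordered_pair u x -> ~~ ordered_pair x y ->
  size (a ++ u :: x :: y :: b) = N -> inversions (a ++ u :: x :: y :: b) = m ->
  straightens_at F a u x (y :: b) -> straightens_at F (rcons a u) x y b.
Proof.
move=> nux nxy sN im R1.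
have small a' b' k k' : (size a' + size b' = size a + size b)%N ->
    straightens_at F a' k k' b'.
  by move=> e; apply: IHN; move: sN; rewrite !size_cat /=; lia.
have szr v : (size (rcons a v) + size b = size a + size (v :: b))%N.
  by rewrite size_rcons addSnnS.
have Jac : bracketed F a (malg_lift (br u) (br x y)) b =
    bracketed F a (malg_lift (br^~ y) (br u x)) b
    + sgn u x *: bracketed F a (malg_lift (br x) (br u y)) b.
  by rewrite br_jacobi bracketedD bracketedZ.
have Su : bracketed F (rcons a u) (br x y) b =
    (-1) ^+ (sg x u (+) sg y u) *: bracketed F a (br x y) (u :: b)
    + bracketed F a (malg_lift (br u) (br x y)) b.
  by apply: bracketed_straighten_r => k; [exact: br_sg|exact: small].
have Sy : bracketed F a (br u x) (y :: b) =
    (-1) ^+ (sg u y (+) sg x y) *: bracketed F (rcons a y) (br u x) b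
    + bracketed F a (malg_lift (br^~ y) (br u x)) b.
  by apply: bracketed_straighten => k; [exact: br_sg|exact: small].
have Sx : bracketed F (rcons a x) (br u y) b =
    (-1) ^+ (sg u x (+) sg y x) *: bracketed F a (br u y) (x :: b)
    + bracketed F a (malg_lift (br x) (br u y)) b.
  by apply: bracketed_straighten_r => k; [exact: br_sg|exact: small].
have [eux|neux] := eqVneq u x.
  subst u; move: (nux); rewrite nordered_eq => ox.
  have [exy|nexy] := eqVneq x y.
    subst y.
    (* For a letter that anticommutes with itself the Jacobi identity reads 3 [x, [x, x]] = 0. *)
    have J3 : bracketed F a (malg_lift (br x) (br x x)) b = 0.
      have sk : malg_lift (br^~ x) (br x x) = - malg_lift (br x) (br x x).
        rewrite -scaleN1r -malg_liftZ; apply: eq_malg_lift => k kx.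
        by rewrite br_skew /sgn (br_sg _ kx) addbb scale1r scaleN1r.
      move: Jac; rewrite sk bracketedN /sgn ox expr1 scaleN1r => e.
      apply: (scalerI three_neq0); rewrite scaler0 scaler_nat !mulrS mulr0n.
      by rewrite {1}e; zmod.
    move: R1 Su; rewrite /straightens_at cat_rcons J3 /sgn ox /= expr1 expr0.
    by rewrite !scaleN1r scale1r addr0 => + ->.
  have lyx := nordered_pair nxy nexy.
  have iy : inversions (a ++ x :: x :: y :: b)
          = (inversions (a ++ x :: y :: x :: b)).+1.
    by have := inversions_swap (rcons a x) b lyx; rewrite !cat_rcons.
  have iy' := inversions_swap a (x :: b) lyx.
  have R2 : straightens_at F a x y (x :: b).
    by apply: IHm => //; [move: sN; rewrite !size_cat|lia].
  have R3 : straightens_at F (rcons a y) x x b.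
    by apply: IHm => //; rewrite ?cat_rcons; [move: sN; rewrite !size_cat|lia].
  (* Since u = x, the relation [R1] reads 2 xxy = [x, x] y plus shorter terms absorbed in the
     bracket, so it controls only the double of the word. *)
  apply: double_inj.
  move: R1 R2 R3 Jac Su Sy Sx; rewrite /straightens_at !cat_rcons.
  rewrite /sgn (sgC y x) ox /=.
  case: (sg x y); rewrite /= ?expr1 ?expr0 ?scaleN1r ?scale1r;
    move=> R1 R2 R3 Jac Su Sy Sx; rewrite Su R2;
    apply: (zmod_from (eq_addr (eq_addr R1 Sy) (eq_addr (esym R3) (esym Jac)))); zmod.
have nle_ux := nordered_pair nux neux.
have nle_uy : ~~ le u y.
  have [<- //|nxy'] := eqVneq x y.
  apply: contra (nle_ux) => luy; apply: le_trans luy _.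
  by have := nordered_pair nxy nxy'; case/orP: (le_total x y) => // ->.
have nuy : ~~ ordered_pair u y by rewrite /ordered_pair negb_and nle_uy.
have iux := inversions_swap a (y :: b) nle_ux.
have iuy : inversions (a ++ x :: u :: y :: b) = (inversions (a ++ x :: y :: u :: b)).+1.
  by have := inversions_swap (rcons a x) b nle_uy; rewrite !cat_rcons.
have R2 : straightens_at F (rcons a x) u y b.
  by apply: IHm => //; rewrite cat_rcons; [move: sN; rewrite !size_cat|lia].
have R3 : straightens_at F a x y (u :: b).
  by apply: IHm => //; [move: sN; rewrite !size_cat|lia].
have R4 : straightens_at F a u y (x :: b).
  have [exy|nxy'] := eqVneq x y; first by subst y.
  have ixy : inversions (a ++ u :: x :: y :: b) = (inversions (a ++ u :: y :: x :: b)).+1.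
    by have := inversions_swap (rcons a u) b (nordered_pair nxy nxy'); rewrite !cat_rcons.
  by apply: IHm => //; [move: sN; rewrite !size_cat|lia].
have R5 : straightens_at F (rcons a y) u x b.
  have [exy|nxy'] := eqVneq x y; first by subst y.
  have ixy : inversions (a ++ u :: x :: y :: b) = (inversions (a ++ u :: y :: x :: b)).+1.
    by have := inversions_swap (rcons a u) b (nordered_pair nxy nxy'); rewrite !cat_rcons.
  have iuy' := inversions_swap a (x :: b) nle_uy.
  by apply: IHm => //; rewrite cat_rcons; [move: sN; rewrite !size_cat|lia].
move: R1 R2 R3 R4 R5 Jac Su Sy Sx; rewrite /straightens_at !cat_rcons.
move=> -> -> -> -> -> -> -> -> ->; rewrite /sgn (sgC x u) (sgC y u) (sgC y x).
case: (sg x y); case: (sg u x); case: (sg u y); rewrite /= ?expr1 ?expr0.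
all: rewrite ?(scaleN1r, scale1r); zmod.
Qed.

(** Reductions at disjoint places commute: both sides are first reduced at (u, v), and the induction
    hypotheses apply to every word that results. *)
Lemma straighten_disjoint a u v c x y b : ~~ ordered_pair u v -> ~~ ordered_pair x y ->
  size (a ++ u :: v :: c ++ x :: y :: b) = N ->
  inversions (a ++ u :: v :: c ++ x :: y :: b) = m ->
  straightens_at F a u v (c ++ x :: y :: b) ->
  straightens_at F (a ++ u :: v :: c) x y b.
Proof.
move=> nuv nxy sN im R1.
have Buv : bracketed F a (br u v) (c ++ x :: y :: b) =
    sgn x y *: bracketed F a (br u v) (c ++ y :: x :: b)
    + malg_lift (fun k => bracketed F (a ++ k :: c) (br x y) b) (br u v).
  rewrite /bracketed -malg_liftZ -malg_liftD; apply: eq_malg_lift => k _.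
  have E z : a ++ k :: c ++ z = (a ++ k :: c) ++ z by rewrite -catA.
  rewrite !E.
  by apply: IHN; move: sN; rewrite !size_cat /= !size_cat /=; lia.
have Bxy : bracketed F (a ++ u :: v :: c) (br x y) b =
    sgn u v *: bracketed F (a ++ v :: u :: c) (br x y) b
    + malg_lift (fun k => bracketed F (a ++ k :: c) (br x y) b) (br u v).
  (* Bracketing at both places gives a double sum, in which the order of summation may be
     exchanged. *)
  have -> : malg_lift (fun k => bracketed F (a ++ k :: c) (br x y) b) (br u v)
      = malg_lift (fun l => bracketed F a (br u v) (c ++ l :: b)) (br x y).
    rewrite /bracketed /malg_lift; under eq_bigr do rewrite scaler_sumr.
    rewrite exchange_big; apply: eq_bigr => l _; rewrite scaler_sumr.
    apply: eq_bigr => k _; rewrite !scalerA mulrC; congr (_ *: F _).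
    by rewrite -catA.
  rewrite {1 2}/bracketed -malg_liftZ -malg_liftD; apply: eq_malg_lift => l _.
  rewrite -!catA /=; apply: IHN.
  by move: sN; rewrite !size_cat /= !size_cat /=; lia.
have H : straightens_at F a u v (c ++ y :: x :: b).
  have [exy|nexy] := eqVneq x y; first by subst y.
  have := inversions_swap (a ++ u :: v :: c) b (nordered_pair nxy nexy).
  rewrite -!catA /= => ixy.
  by apply: IHm => //; [move: sN; rewrite !size_cat /= !size_cat|lia].
have [euv|neuv] := eqVneq u v.
  subst v; move: nuv; rewrite nordered_eq => ou.
  apply: double_inj; move: R1 H Buv Bxy; rewrite /straightens_at -!catA /= /sgn ou.
  rewrite expr1 !scaleN1r; case: (sg x y); rewrite ?(expr0, expr1) ?(scaleN1r, scale1r).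
    move=> R1 H Buv Bxy.
    by apply: (zmod_from (eq_addr (eq_addr R1 Buv) (eq_addr H (esym Bxy)))); zmod.
  move=> R1 H Buv Bxy.
  by apply: (zmod_from (eq_addr (eq_addr R1 Buv) (eq_addr (esym H) (esym Bxy)))); zmod.
have iuv := inversions_swap a (c ++ x :: y :: b) (nordered_pair nuv neuv).
have G : straightens_at F (a ++ v :: u :: c) x y b.
  by apply: IHm => //; rewrite -catA /=; [move: sN; rewrite !size_cat /= !size_cat|lia].
move: R1 H Buv G Bxy; rewrite /straightens_at -!catA /= => -> -> -> -> ->.
rewrite /sgn; case: (sg u v); case: (sg x y); rewrite ?(expr0, expr1) ?(scaleN1r, scale1r); zmod.
Qed.

End Step.

Theorem straightens_straighten : straightens F.
Proof.
suff IH N a x y b : size (a ++ x :: y :: b) = N -> straightens_at F a x y b.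
  by move=> a x y b; exact: IH.
have [n] := ubnP N; elim: n N a x y b => // n IHn N a x y b leN sN.
have {}IHn a' x' y' b' : (size (a' ++ x' :: y' :: b') < N)%N -> straightens_at F a' x' y' b'.
  by move=> lt; apply: (IHn (size (a' ++ x' :: y' :: b'))) => //; lia.
have step a' x' y' b' m : ~~ ordered_pair x' y' -> size (a' ++ x' :: y' :: b') = N ->
    inversions (a' ++ x' :: y' :: b') = m -> straightens_at F a' x' y' b'.
  have [M] := ubnP m; elim: M m a' x' y' b' => // M IHM m a' x' y' b' lem nxy sz im.
  have {}IHM a1 x1 y1 b1 : ~~ ordered_pair x1 y1 -> size (a1 ++ x1 :: y1 :: b1) = N ->
      (inversions (a1 ++ x1 :: y1 :: b1) < m)%N -> straightens_at F a1 x1 y1 b1.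
    by move=> n1 s1 lt; apply: (IHM (inversions (a1 ++ x1 :: y1 :: b1))) => //; lia.
  have [e|[a2 [u [ea nux e]]]|[a2 [u [v [c [ea nuv e]]]]]] := first_descent_cat a' b' nxy.
  - exact: straightens_at_first.
  - subst a'; move: sz im e; rewrite cat_rcons => sz im e.
    by apply: (straighten_overlap IHn IHM) => //; exact: straightens_at_first.
  subst a'; move: sz im e; rewrite -catA => sz im e.
  by apply: (straighten_disjoint IHn IHM) => //; exact: straightens_at_first.
have [o|no] := boolP (ordered_pair x y); last exact: step.
apply: straightens_at_ordered o => no; apply: step => //.
by move: sN; rewrite !size_cat.
Qed.

End Straightening.
End PBW.

(** * Algebras presented by quadratic relations *)

Section QuotientLift.
Variables (K : pzRingType) (V X : lmodType K) (S : set V) (f : V -> X).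

Definition quot_lift (x : quotmod S) : X :=
  f (repr (x : Quotient.quot (span S))).

Hypothesis f_linear : linear f.
Hypothesis f_gens : forall s, S s -> f s = 0.

Lemma quot_lift_qmod v : quot_lift (qmod S v) = f v.
Proof.
have [f' e'] := linear_bundle f_linear.
apply/eqP; rewrite -subr_eq0 /quot_lift -!e' -linearB.
have : repr (qmod S v : Quotient.quot (span S)) - v \in span S.
  by apply/qmodP; rewrite qmod_repr.
move/spanP/(_ [pred x | f' x == 0]); apply.
  split=> [|k u w]; rewrite !inE ?linear0 // => /eqP hu /eqP hw.
  by rewrite linearP hu hw scaler0 addr0.
by move=> s /f_gens e; rewrite inE /= e' e.
Qed.

Lemma quot_lift_linear : linear quot_lift.
Proof.
move=> a; elim/quot_ind=> u; elim/quot_ind=> v.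
by rewrite -linearP !quot_lift_qmod f_linear.
Qed.

End QuotientLift.

Lemma alg_sandwich (K : fieldType) (A : algType K) (a b p q v : A) (c : K) :
  a * (p - (c *: q + v)) * b = a * p * b - (c *: (a * q * b) + a * v * b).
Proof. by rewrite mulrBr mulrBl mulrDr mulrDl -scalerAr -scalerAl. Qed.

Lemma malg_lift_mull (K : fieldType) (A : algType K) (X : choiceType) (a : A)
    (h : X -> A) v :
  malg_lift (fun k => a * h k) v = a * malg_lift h v.
Proof.
by rewrite /malg_lift mulr_sumr; apply: eq_bigr => k _; rewrite scalerAr.
Qed.

Lemma malg_lift_mulr (K : fieldType) (A : algType K) (X : choiceType) (a : A)
    (h : X -> A) v :
  malg_lift (fun k => h k * a) v = malg_lift h v * a.
Proof.
by rewrite /malg_lift mulr_suml; apply: eq_bigr => k _; rewrite scalerAl.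
Qed.

Section WordAlgebra.
Variables (K : fieldType) (B : choiceType).

(** The free algebra on a plain set of letters, whereas the letters of [freealg] are the vectors of
    a space. *)
Definition wordalg : Type := {malg K[{fmonom B}]}.

HB.instance Definition _ := GRing.Lalgebra.on wordalg.

Fact wordalg_scalerAr (k : K) (x y : wordalg) : k *: (x * y) = x * (k *: y).
Proof.
apply/malgP => m; rewrite mcoeffZ.
rewrite [X in k * X](mcoeffMl x y) mulr_sumr.
rewrite [RHS](mcoeffMlw m (fsubset_refl _) (msuppZ_le k y)).
apply: eq_bigr => i _; rewrite mulr_sumr; apply: eq_bigr => j _.
by rewrite mcoeffZ mulrnAr mulrCA.
Qed.

HB.instance Definition _ := GRing.Lalgebra_isAlgebra.Build K wordalg wordalg_scalerAr.

Definition monom (w : seq B) : wordalg := << FMonom w >>.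

Lemma monom_cat a b : monom (a ++ b) = monom a * monom b.
Proof.
rewrite /monom; have <- : mmul (FMonom a) (FMonom b) = FMonom (a ++ b) := fmmulE _ _.
by rewrite [RHS]malgM_def fgmulUU mulr1.
Qed.

Lemma wordalg_ind (P : wordalg -> Prop) :
  P 0 -> (forall c u v, P u -> P v -> P (c *: u + v)) ->
  (forall w, P (monom w)) -> forall g, P g.
Proof. by move=> P0 PD PU; apply: malg_lin_ind => // -[w]; exact: PU. Qed.

Definition word_lift (X : lmodType K) (F : seq B -> X) (g : wordalg) : X :=
  malg_lift (fun m : {fmonom B} => F m) g.

Lemma word_liftE (X : lmodType K) (F : seq B -> X) w : word_lift F (monom w) = F w.
Proof. exact: malg_liftU. Qed.

Lemma word_lift_linear (X : lmodType K) (F : seq B -> X) : linear (word_lift F).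
Proof. exact: malg_lift_linear. Qed.

HB.instance Definition _ (X : lmodType K) (F : seq B -> X) :=
  GRing.isLinear.Build K wordalg X *:%R (word_lift F) (word_lift_linear F).

End WordAlgebra.

Section ColorAlgebra.
Variables (K : fieldType) (B : choiceType).
Variables (sg : rel B) (br : B -> B -> {malg K[B]}).

Local Notation straightens := (straightens sg br).

Definition color_rel : set (wordalg K B) := fun r => exists x y,
  r = monom K [:: x; y] - (sgn K sg x y *: monom K [:: y; x]
        + bracketed (@monom K B) [::] (br x y) [::]).

Definition color_alg : Type := algquot color_rel.

HB.instance Definition _ := GRing.Lmodule.on color_alg.
HB.instance Definition _ := GRing.PzRing.on color_alg.

Definition word (w : seq B) : color_alg := qalg color_rel (monom K w).

Lemma word_cat a b : word (a ++ b) = word a * word b.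
Proof. by rewrite /word monom_cat qalgM. Qed.

Lemma word0 : word [::] = 1.
Proof. by rewrite /word /monom -fmoneE. Qed.

Lemma color_scalerAl (k : K) (x y : color_alg) : k *: (x * y) = (k *: x) * y.
Proof. exact: algquot_scalerAl. Qed.

Lemma color_scalerAr (k : K) (x y : color_alg) : k *: (x * y) = x * (k *: y).
Proof. exact: algquot_scalerAr. Qed.

Lemma color_ind (P : color_alg -> Prop) :
  P 0 -> (forall c u v, P u -> P v -> P (c *: u + v)) ->
  (forall w, P (word w)) -> forall a, P a.
Proof.
move=> P0 PD PU; elim/algquot_ind=> g; elim/wordalg_ind: g => //.
- by rewrite /qalg linear0.
- by move=> c u v hu hv; rewrite qalgD qalgZ; apply: PD.
Qed.

Lemma word_straightens2 x y : word [:: x; y] =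
  sgn K sg x y *: word [:: y; x] + bracketed word [::] (br x y) [::].
Proof.
have -> : bracketed word [::] (br x y) [::] =
    qalg color_rel (bracketed (@monom K B) [::] (br x y) [::]).
  by rewrite /bracketed [RHS](@malg_lift_comp _ _ _ _ (qalg color_rel)) //; exact: linearP.
rewrite /word -qalgZ -qalgD; apply/qalgP/span_gen.
exists 1, (monom K [:: x; y] - (sgn K sg x y *: monom K [:: y; x]
        + bracketed (@monom K B) [::] (br x y) [::])), 1.
by split; [exists x, y|rewrite mul1r mulr1].
Qed.

Lemma word_straightens : straightens word.
Proof.
move=> a x y b.
have e u v : word (a ++ u :: v :: b) = word a * word [:: u; v] * word b.
  by rewrite -!word_cat -catA.
rewrite !e word_straightens2 mulrDr mulrDl -color_scalerAr -color_scalerAl.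
congr (_ + _); rewrite /bracketed /malg_lift mulr_sumr mulr_suml.
apply: eq_bigr => k _; rewrite -color_scalerAr -color_scalerAl -!word_cat.
by rewrite -catA.
Qed.

Section Lift.
Variables (X : lmodType K) (F : seq B -> X).

Definition color_lift (a : color_alg) : X := word_lift F (qrepr a).

Hypothesis F_straightens : straightens F.

(** By linearity the two cofactors may be taken to be words, and on a relator between two words the
    claim is the straightening relation of [F] at that position. *)
Lemma word_lift_ideal r : ideal_gens color_rel r -> word_lift F r = 0.
Proof.
move=> [a [s [b [[x [y ->]] ->]]]]; elim/wordalg_ind: a => [|c u v hu hv|a].
- by rewrite !mul0r linear0.
- by rewrite mulrDl mulrDl -!scalerAl word_lift_linear
    [X in _ *: X + _ = _]hu [X in _ + X = _]hv scaler0 addr0.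
elim/wordalg_ind: b => [|c u v hu hv|b].
- by rewrite mulr0 linear0.
- by rewrite mulrDr -scalerAr word_lift_linear
    [X in _ *: X + _ = _]hu [X in _ + X = _]hv scaler0 addr0.
have e u v : monom K a * monom K [:: u; v] * monom K b = monom K (a ++ u :: v :: b).
  by rewrite -!monom_cat -catA.
have eb : monom K a * bracketed (@monom K B) [::] (br x y) [::] * monom K b
    = bracketed (@monom K B) a (br x y) b.
  rewrite /bracketed /malg_lift mulr_sumr mulr_suml; apply: eq_bigr => k _.
  by rewrite -scalerAr -scalerAl -!monom_cat -catA.
rewrite alg_sandwich [X in X - _]e [X in _ - (_ *: X + _)]e [X in _ - (_ + X)]eb.
rewrite linearB linearD linearZ /= !word_liftE F_straightens; apply/eqP.
rewrite subr_eq0; apply/eqP; congr (_ + _); rewrite /bracketed.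
rewrite (@malg_lift_comp _ _ _ _ (word_lift F)); last exact: word_lift_linear.
by apply: eq_malg_lift => k _; rewrite word_liftE.
Qed.

Lemma color_liftE w : color_lift (word w) = F w.
Proof.
apply: etrans (word_liftE F w).
exact: (quot_lift_qmod (@word_lift_linear _ _ _ F) word_lift_ideal).
Qed.

Lemma color_lift_linear : linear color_lift.
Proof.
exact: (quot_lift_linear (@word_lift_linear _ _ _ F) word_lift_ideal).
Qed.

End Lift.

(** The coefficient of the empty word descends to the quotient, because all words in the relations
    are nonempty; it separates 1 from 0. *)
Lemma color_alg_neq0 : (1 : color_alg) != 0.
Proof.
pose F (w : seq B) : K^o := (nilp w)%:R.
have cF : straightens F.
  move=> a x y b; rewrite /F /nilp !size_cat /= !addnS scaler0 add0r.
  by rewrite /bracketed /malg_lift big1 // => k _; rewrite size_cat /= addnS scaler0.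
apply/eqP => e; have := color_liftE cF [::]; rewrite word0 e.
have -> : color_lift F 0 = 0.
  have := color_lift_linear cF (-1) 0 0.
  by rewrite scaler0 addr0 scaleN1r addNr.
by move/eqP; rewrite eq_sym oner_eq0.
Qed.

HB.instance Definition _ := GRing.PzSemiRing_isNonZero.Build color_alg color_alg_neq0.
HB.instance Definition _ := GRing.Lmodule_isLalgebra.Build K color_alg color_scalerAl.
HB.instance Definition _ := GRing.Lalgebra_isAlgebra.Build K color_alg color_scalerAr.

End ColorAlgebra.

(* [wd] exhibits [A] as the algebra generated by [B] subject to the relations
   x y = sgn x y *: y x + br x y. *)
Record presentation (K : fieldType) (B : choiceType) (sg : rel B)
    (br : B -> B -> {malg K[B]}) (A : algType K) (wd : seq B -> A) : Prop := Presentation {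
  pres_nil : wd [::] = 1;
  pres_cat : forall a b, wd (a ++ b) = wd a * wd b;
  pres_straightens : straightens sg br wd;
  pres_ind : forall P : A -> Prop, P 0 ->
    (forall c u v, P u -> P v -> P (c *: u + v)) -> (forall w, P (wd w)) ->
    forall a, P a;
  pres_lift : forall (X : lmodType K) (F : seq B -> X), straightens sg br F ->
    exists L : {linear A -> X}, forall w, L (wd w) = F w }.

(** Hides the quotient construction: the cone algebra is later accessed through this record
    alone. *)
Lemma color_presentation (K : fieldType) (B : choiceType) (sg : rel B)
    (br : B -> B -> {malg K[B]}) :
  presentation sg br (word sg br).
Proof.
split; [exact: word0|exact: word_cat|exact: word_straightens|exact: color_ind|].
move=> X F cF; have [L e] := linear_bundle (color_lift_linear cF).
by exists L => w; rewrite e color_liftE.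
Qed.

Section NormalInduction.
Variables (K : fieldType) (B : choiceType) (le : rel B).
Variables (sg : rel B) (br : B -> B -> {malg K[B]}).
Hypotheses (le_refl : reflexive le) (le_total : total le).

(** Induction along straightening, on the length and then on the number of inversions. A repeated
    letter gives no hypothesis for the swapped word, which is the word itself; the applications
    settle that case by dividing by 2. *)
Lemma normal_word_ind (P : seq B -> Prop) :
  (forall w, normal_word le sg w -> P w) ->
  (forall a x y b, ~~ ordered_pair le sg x y -> (x = y -> sg x x) ->
     (x != y -> P (a ++ y :: x :: b)) ->
     (forall k, k \in msupp (br x y) -> P (a ++ k :: b)) -> P (a ++ x :: y :: b)) ->
  forall w, P w.
Proof.
move=> Pn Pd w; have [n] := ubnP (size w); elim: n w => // n IHn w leN.
have [m] := ubnP (inversions le w); elim: m w leN => // m IHm w leN lem.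
case e: (first_descent le sg w) => [[[[a x] y] b]|]; last first.
  exact/Pn/first_descent_None.
have [ew nxy] := first_descentP e; subst w.
apply: (Pd _ _ _ _ nxy) => [exy|nexy|k _].
- by subst y; rewrite -(@nordered_eq _ _ sg le_refl).
- apply: IHm; first by move: leN; rewrite !size_cat.
  by move: lem; rewrite (inversions_swap le_total _ _ (nordered_pair nxy nexy)); lia.
- by apply: IHn; move: leN; rewrite !size_cat /=; lia.
Qed.

End NormalInduction.

(** * The cone of a Lie superalgebra *)

(* The letter (true, i) is the barred twin of (false, i). *)
Section Cone.
Variables (K : fieldType) (I : choiceType) (sg : rel I) (br : I -> I -> {malg K[I]}).
Hypothesis sgC : symmetric sg.
Hypothesis br_skew : forall x y, br x y = - (sgn K sg x y *: br y x).
Hypothesis br_sg : forall x y k z, k \in msupp (br x y) -> sg k z = sg x z (+) sg y z.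
Hypothesis br_jacobi : forall u x y,
  malg_lift (br u) (br x y) =
  malg_lift (br^~ y) (br u x) + sgn K sg u x *: malg_lift (br x) (br u y).

Definition cone_sg : rel (bool * I) := fun x y => (x.1 && y.1) (+) sg x.2 y.2.

Definition mark (t : bool) (v : {malg K[I]}) : {malg K[(bool * I)%type]} :=
  malg_lift (fun i => << (t, i) >>) v.

Definition cone_br (x y : bool * I) : {malg K[(bool * I)%type]} :=
  if x.1 && y.1 then 0 else mark (x.1 || y.1) (br x.2 y.2).

Lemma mark_linear t : linear (mark t).
Proof. exact: malg_lift_linear. Qed.

Lemma markU t i : mark t << i >> = << (t, i) >>.
Proof. exact: malg_liftU. Qed.

Lemma mcoeff_mark t v x : (mark t v)@_x = if x.1 == t then v@_x.2 else 0.
Proof.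
elim/malg_lin_ind: v => [|c u v hu hv|i].
- by rewrite /mark linear0 !mcoeff0; case: ifP.
- rewrite mark_linear mcoeffD mcoeffZ hu hv mcoeffD mcoeffZ; case: ifP => // _.
  by rewrite mulr0 addr0.
rewrite markU !mcoeffU; case: x => t' j /=; rewrite xpair_eqE eq_sym.
by case: eqP.
Qed.

Lemma mark_supp t v x : x \in msupp (mark t v) -> x.1 = t /\ x.2 \in msupp v.
Proof.
rewrite -!mcoeff_neq0 mcoeff_mark; case: (eqVneq x.1 t) => [->|_]; last by rewrite eqxx.
by [].
Qed.

Lemma cone_sgC : symmetric cone_sg.
Proof. by move=> x y; rewrite /cone_sg sgC andbC. Qed.

Lemma cone_br_skew x y : cone_br x y = - (sgn K cone_sg x y *: cone_br y x).
Proof.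
case: x y => [t i] [t' j]; rewrite /cone_br /cone_sg /sgn /=.
by case: t; case: t' => /=; rewrite ?scaler0 ?oppr0 // br_skew /mark linearN linearZ.
Qed.

Lemma cone_br_sg x y k z : k \in msupp (cone_br x y) ->
  cone_sg k z = cone_sg x z (+) cone_sg y z.
Proof.
rewrite /cone_br; case: ifP => [_|e]; first by rewrite msupp0.
move=> /mark_supp[k1 k2]; rewrite /cone_sg (br_sg _ k2) k1.
move: e; case: x.1; case: y.1 => // _; case: z.1; case: (sg _ _); case: (sg _ _) => //.
Qed.

Lemma lift_mark (W : lmodType K) (h : bool * I -> W) t v :
  malg_lift h (mark t v) = malg_lift (fun i => h (t, i)) v.
Proof. by rewrite malg_liftA; apply: eq_malg_lift => i _; rewrite malg_liftU. Qed.

Lemma mark_lift t (h : I -> {malg K[I]}) v :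
  mark t (malg_lift h v) = malg_lift (fun i => mark t (h i)) v.
Proof. exact: malg_liftA. Qed.

Lemma malg_lift0 (X Y : choiceType) (v : {malg K[X]}) :
  malg_lift (fun=> 0) v = 0 :> {malg K[Y]}.
Proof. by rewrite /malg_lift big1 // => i _; rewrite scaler0. Qed.

(** With two or more bars every term vanishes; with at most one, this is the original identity with
    all its terms marked. *)
Lemma cone_br_jacobi u x y :
  malg_lift (cone_br u) (cone_br x y) =
  malg_lift (cone_br^~ y) (cone_br u x) + sgn K cone_sg u x *: malg_lift (cone_br x) (cone_br u y).
Proof.
case: u x y => [[] u] [[] x] [[] y]; rewrite /cone_br /=.
all: rewrite ?linear0 ?lift_mark /= ?malg_lift0 ?linear0 ?scaler0 ?addr0 ?add0r //.
all: by rewrite -!mark_lift br_jacobi /mark linearD linearZ.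
Qed.

End Cone.

(** * The differential of the cone *)

Section ConeDifferential.
Variables (K : fieldType) (I : choiceType) (sg : rel I) (br : I -> I -> {malg K[I]}).

Variables (A : algType K) (wd : seq (bool * I) -> A).
Hypothesis P : presentation (cone_sg sg) (cone_br br) wd.

Lemma pres_cons x w : wd (x :: w) = wd [:: x] * wd w.
Proof. by rewrite -(pres_cat P). Qed.

Lemma pres_swap x y : wd [:: x; y] =
  sgn K (cone_sg sg) x y *: wd [:: y; x] + bracketed wd [::] (cone_br br x y) [::].
Proof. exact: (pres_straightens P [::] x y [::]). Qed.

(** Only the bar counts: the parity of the index does not enter the Leibniz sign. *)
Definition degree_sign (x : bool * I) : K := (-1) ^+ x.1.

Section Derivation.
Variable delta : bool * I -> A.

(** The signed Leibniz rule on words. For [unmark] it descends to the algebra; for [bar], later, it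
    is used on words only. *)
Fixpoint word_derivation (w : seq (bool * I)) : A :=
  if w is x :: w' then
    delta x * wd w' + degree_sign x *: (wd [:: x] * word_derivation w')
  else 0.

Hypothesis delta_bracket : forall x y,
  delta x * wd [:: y] + degree_sign x *: (wd [:: x] * delta y) =
  sgn K (cone_sg sg) x y *: (delta y * wd [:: x] + degree_sign y *: (wd [:: y] * delta x))
  + malg_lift delta (cone_br br x y).

Lemma degree_sign_br x y k : k \in msupp (cone_br br x y) ->
  degree_sign k = degree_sign x * degree_sign y.
Proof.
rewrite /cone_br; case: ifP => [_|e]; first by rewrite msupp0.
move=> /mark_supp[k1 _]; rewrite /degree_sign k1; move: e.
by case: x.1; case: y.1 => // _; rewrite ?mul1r ?mulr1.
Qed.

Lemma word_derivation_cons x w : word_derivation (x :: w) =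
  delta x * wd w + degree_sign x *: (wd [:: x] * word_derivation w).
Proof. by []. Qed.

Lemma word_derivation_cons2 x y b : word_derivation (x :: y :: b) =
  (delta x * wd [:: y] + degree_sign x *: (wd [:: x] * delta y)) * wd b
  + (degree_sign x * degree_sign y) *: (wd [:: x; y] * word_derivation b).
Proof.
rewrite !word_derivation_cons (pres_cons y b) (pres_cons x [:: y]).
move: (wd b) (wd [:: x]) (wd [:: y]) (word_derivation b) => p q r t.
rewrite mulrDl mulrDr -scalerAl -!scalerAr scalerDr scalerA !mulrA.
by rewrite addrA.
Qed.

Lemma bracketed_derivation_cons c a x y b :
  bracketed word_derivation (c :: a) (cone_br br x y) b =
  delta c * bracketed wd a (cone_br br x y) b
  + degree_sign c *: (wd [:: c] * bracketed word_derivation a (cone_br br x y) b).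
Proof. by rewrite /bracketed -!malg_lift_mull -malg_liftZ -malg_liftD. Qed.

Lemma bracketed_derivation_nil x y b :
  bracketed word_derivation [::] (cone_br br x y) b =
  malg_lift delta (cone_br br x y) * wd b
  + (degree_sign x * degree_sign y) *:
     (bracketed wd [::] (cone_br br x y) [::] * word_derivation b).
Proof.
rewrite /bracketed -!malg_lift_mulr -malg_liftZ -malg_liftD.
by apply: eq_malg_lift => k kxy /=; rewrite (degree_sign_br kxy).
Qed.

(** It suffices that [delta] respects the relation between two letters: the Leibniz rule carries
    this past the letters on either side. *)
Lemma word_derivation_straightens :
  straightens (cone_sg sg) (cone_br br) word_derivation.
Proof.
move=> a x y b; elim: a => [|c a IH].
  rewrite !cat0s bracketed_derivation_nil !word_derivation_cons2 delta_bracket.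
  rewrite pres_swap.
  move: (delta y * wd [:: x] + _) (malg_lift delta _) (bracketed wd _ _ _) => p q r.
  move: (wd [:: y; x]) (wd b) (word_derivation b) => t u v.
  rewrite !mulrDl -!scalerAl !scalerDr !scalerA.
  by rewrite [degree_sign y * degree_sign x]mulrC [sgn _ _ _ _ * _]mulrC; zmod.
rewrite !cat_cons bracketed_derivation_cons !word_derivation_cons IH (pres_straightens P).
move: (wd (a ++ _)) (bracketed wd _ _ _) (bracketed word_derivation _ _ _) => p q r.
move: (word_derivation _) (wd [:: c]) (delta c) => t u v.
rewrite !mulrDr -!scalerAr !scalerDr !scalerA.
by rewrite [degree_sign c * _]mulrC; zmod.
Qed.

End Derivation.

Definition unmark (x : bool * I) : A := if x.1 then wd [:: (false, x.2)] else 0.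

Lemma word_marked t t' i j : ~~ (t && t') ->
  wd [:: (t, i); (t', j)] = sgn K sg i j *: wd [:: (t', j); (t, i)]
    + malg_lift (fun k => wd [:: (t || t', k)]) (br i j).
Proof.
move=> /negPf e; rewrite pres_swap /bracketed /cone_br /= e lift_mark.
by rewrite /sgn /cone_sg /= e.
Qed.

(** For two barred letters the Leibniz rule produces the brackets [x, y'] and [x', y]; both are
    [x, y]', and they enter with opposite signs, in accordance with [x', y'] = 0. *)
Lemma unmark_bracket x y :
  unmark x * wd [:: y] + degree_sign x *: (wd [:: x] * unmark y) =
  sgn K (cone_sg sg) x y *: (unmark y * wd [:: x] + degree_sign y *: (wd [:: y] * unmark x))
  + malg_lift unmark (cone_br br x y).
Proof.
case: x y => [[] i] [[] j]; rewrite /unmark /degree_sign /cone_br /sgn /cone_sg /=.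
all: rewrite ?lift_mark ?linear0 ?mulr0 ?mul0r ?expr0 ?expr1 ?scaler0 ?add0r ?addr0 ?scale1r.
- rewrite -!(pres_cat P) !cat1s (@word_marked false true i j) // (@word_marked true false i j) //.
  rewrite /sgn !scaleN1r.
  case: (sg i j) => /=; rewrite ?expr0 ?expr1 ?scaleN1r ?scale1r; zmod.
- by rewrite -!(pres_cat P) !cat1s [LHS]word_marked.
- by rewrite -!(pres_cat P) !cat1s [LHS]word_marked.
- by rewrite scaler0 add0r /malg_lift big1 // => k _; rewrite scaler0.
Qed.

Lemma unmark_derivation_ex :
  exists d : {linear A -> A}, forall w, d (wd w) = word_derivation unmark w.
Proof. exact/(pres_lift P)/word_derivation_straightens/unmark_bracket. Qed.

Variable d : {linear A -> A}.
Hypothesis d_word : forall w, d (wd w) = word_derivation unmark w.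

Lemma cone_d_cons x a :
  d (wd [:: x] * a) = unmark x * a + degree_sign x *: (wd [:: x] * d a).
Proof.
move: a; apply: (pres_ind P) => [|c u v hu hv|w].
- by rewrite !mulr0 !linear0 mulr0 scaler0 addr0.
- rewrite !mulrDr -!scalerAr !linearP hu hv /= !mulrDr -!scalerAr.
  by rewrite !scalerDr !scalerA [_ * c]mulrC; zmod.
by rewrite -pres_cons !d_word.
Qed.

Lemma cone_d1 : d 1 = 0.
Proof. by rewrite -(pres_nil P) d_word. Qed.

Lemma cone_dd a : d (d a) = 0.
Proof.
move: a; apply: (pres_ind P) => [|c u v hu hv|w].
- by rewrite !linear0.
- by rewrite !linearP hu hv /= scaler0 addr0.
elim: w => [|[[] i] w IH]; first by rewrite (pres_nil P) cone_d1 linear0.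
  rewrite pres_cons cone_d_cons linearD linearZ /= !cone_d_cons IH.
  rewrite /unmark /degree_sign /= expr1 expr0 mul0r add0r mulr0 scaler0 addr0.
  by rewrite scaleN1r scale1r addrN.
rewrite pres_cons cone_d_cons linearD linearZ /= /unmark /= mul0r linear0 cone_d_cons IH.
by rewrite /unmark /= mul0r mulr0 scaler0 !add0r scaler0.
Qed.

End ConeDifferential.

(** * The length filtration and acyclicity of the cone *)

Section ConeExact.
Variables (K : fieldType) (I : choiceType) (sg : rel I) (br : I -> I -> {malg K[I]}).
Hypothesis sgC : symmetric sg.
Hypothesis br_skew : forall x y, br x y = - (sgn K sg x y *: br y x).
Hypothesis br_sg : forall x y k z, k \in msupp (br x y) -> sg k z = sg x z (+) sg y z.
Hypothesis br_jacobi : forall u x y,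
  malg_lift (br u) (br x y) =
  malg_lift (br^~ y) (br u x) + sgn K sg u x *: malg_lift (br x) (br u y).
Hypothesis char0 : forall n, n.+1%:R != 0 :> K.
Variable le : rel (bool * I).
Hypotheses (le_refl : reflexive le) (le_anti : antisymmetric le).
Hypotheses (le_total : total le) (le_trans : transitive le).
Variables (A : algType K) (wd : seq (bool * I) -> A).
Hypothesis P : presentation (cone_sg sg) (cone_br br) wd.

(** The linear independence half of the Poincare-Birkhoff-Witt theorem, in the form of use: values
    on normal words may be prescribed at will. *)
Lemma cone_straighten_ex (X : lmodType K) (f : seq (bool * I) -> X) :
  exists L : {linear A -> X}, forall w, normal_word le (cone_sg sg) w -> L (wd w) = f w.
Proof.
have [L e] := pres_lift P (straightens_straighten f le_refl le_anti le_total le_trans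
  (char0 1) (char0 2) (cone_sgC sgC) (cone_br_skew br_skew)
  (cone_br_sg br_sg) (cone_br_jacobi br_jacobi)).
by exists L => w nw; rewrite e straighten_normal.
Qed.

(** The bound is strict: level 0 is zero, level 1 consists of the scalars, and a word of length n
    lies in level n + 1. *)
Definition filtration (n : nat) : {pred A} :=
  span (fun a => exists2 w, (size w < n)%N & a = wd w).

Lemma filtration_word n w : (size w < n)%N -> wd w \in filtration n.
Proof. by move=> lt; apply: span_gen; exists w. Qed.

Lemma filtration_ind n (Q : A -> Prop) : Q 0 ->
  (forall c u v, Q u -> Q v -> Q (c *: u + v)) ->
  (forall w, (size w < n)%N -> Q (wd w)) -> forall a, a \in filtration n -> Q a.
Proof.
move=> Q0 QD QW a /spanP/(_ (fun a => `[< Q a >])) h; apply/asboolP/h.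
  split; first exact/asboolP.
  by move=> c u v /asboolP hu /asboolP hv; apply/asboolP/QD.
by move=> _ [w lt ->]; apply/asboolP/QW.
Qed.

Lemma filtration_le m n a : (m <= n)%N -> a \in filtration m -> a \in filtration n.
Proof.
move=> le_mn; move: a; apply: filtration_ind => [|c u v hu hv|w lt].
- exact: rpred0.
- by apply: rpredD => //; apply: rpredZ.
by apply: filtration_word; lia.
Qed.

Lemma filtration_total a : exists n, a \in filtration n.
Proof.
move: a; apply: (pres_ind P) => [|c u v [m hu] [n hv]|w].
- by exists 0%N; apply: rpred0.
- exists (maxn m n); apply: rpredD; first apply: rpredZ.
    by apply: filtration_le hu; rewrite leq_maxl.
  by apply: filtration_le hv; rewrite leq_maxr.
by exists (size w).+1; apply: filtration_word.
Qed.

Lemma filtration_mull n w a : a \in filtration n -> wd w * a \in filtration (size w + n).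
Proof.
move: a; apply: filtration_ind => [|c u v hu hv|w' lt].
- by rewrite mulr0 rpred0.
- by rewrite mulrDr -scalerAr; apply: rpredD => //; apply: rpredZ.
by rewrite -(pres_cat P); apply: filtration_word; rewrite size_cat; lia.
Qed.

Lemma filtration_mulr n w a : a \in filtration n -> a * wd w \in filtration (size w + n).
Proof.
move: a; apply: filtration_ind => [|c u v hu hv|w' lt].
- by rewrite mul0r rpred0.
- by rewrite mulrDl -scalerAl; apply: rpredD => //; apply: rpredZ.
by rewrite -(pres_cat P); apply: filtration_word; rewrite size_cat; lia.
Qed.

Lemma filtration_lift (X : choiceType) n (h : X -> A) v :
  (forall k, k \in msupp v -> h k \in filtration n) -> malg_lift h v \in filtration n.
Proof.
by move=> hh; rewrite /malg_lift big_seq; apply: rpred_sum => k /hh ?; apply: rpredZ.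
Qed.

Lemma filtration_swap x y :
  wd [:: x; y] - sgn K (cone_sg sg) x y *: wd [:: y; x] \in filtration 2.
Proof.
rewrite (pres_swap P) addrAC addrN add0r.
by apply: filtration_lift => k _; apply: filtration_word.
Qed.

Definition bar (x : bool * I) : A := if x.1 then 0 else wd [:: (true, x.2)].

Local Notation bar_derivation := (word_derivation wd bar).
Local Notation eps := (@degree_sign K I).
Local Notation sign := (sgn K (cone_sg sg)).

Lemma sign_sqr x y : sign x y * sign x y = 1.
Proof. by rewrite /sgn; case: cone_sg; rewrite ?mulr1 // expr1 mulrNN mulr1. Qed.

(** A bar added to [x] multiplies its exchange sign with [y] by the bar sign of [y], and the bracket
    is a single letter. *)
Lemma bar_swap x y : bar x * wd [:: y] - (sign x y * eps y) *: (wd [:: y] * bar x)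
  \in filtration 2.
Proof.
case: x => [[] i]; rewrite /bar /=; first by rewrite mul0r mulr0 scaler0 subr0 rpred0.
have := filtration_swap (true, i) y; rewrite (pres_cons P) [wd [:: y; _]](pres_cons P).
suff -> : sign (true, i) y = sign (false, i) y * eps y by [].
rewrite /sgn /degree_sign /cone_sg /=; case: y.1 => /=; last by rewrite mulr1.
by case: sg; rewrite /= ?expr0 ?expr1 ?mulr1 ?mul1r ?mulrNN ?mulr1.
Qed.

Lemma filtration_scale n (c : K) a : a \in filtration n -> c *: a \in filtration n.
Proof. exact: rpredZ. Qed.

Lemma filtration_eq n a b : a \in filtration n -> b = a -> b \in filtration n.
Proof. by move=> + ->. Qed.

Lemma bar_derivation_filtration w : bar_derivation w \in filtration (size w).+1.
Proof.
elim: w => [|x w IH]; first exact: rpred0.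
rewrite /=; apply: rpredD; last by apply/filtration_scale/(filtration_mull [:: x]).
rewrite /bar; case: x.1; first by rewrite mul0r rpred0.
by rewrite -(pres_cat P); apply: filtration_word.
Qed.

(** Modulo shorter words the brackets disappear from the relations, and the sign rule that remains
    is respected by barring. *)
Lemma bar_derivation_swap a x y b :
  bar_derivation (a ++ x :: y :: b) - sign x y *: bar_derivation (a ++ y :: x :: b)
  \in filtration (size (a ++ x :: y :: b)).
Proof.
elim: a => [|c a IH].
  rewrite !cat0s !(word_derivation_cons2 P).
  (* The full-length products regroup into the errors of three exchanges: of [bar x] with y, of
     [bar y] with x, and of x with y. *)
  have -> : (bar x * wd [:: y] + eps x *: (wd [:: x] * bar y)) * wd b +
      eps x * eps y *: (wd [:: x; y] * bar_derivation b) -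
      sign x y *: ((bar y * wd [:: x] + eps y *: (wd [:: y] * bar x)) * wd b +
        eps y * eps x *: (wd [:: y; x] * bar_derivation b))
    = (bar x * wd [:: y] - (sign x y * eps y) *: (wd [:: y] * bar x)) * wd b
      - sign x y *: ((bar y * wd [:: x] - (sign y x * eps x) *: (wd [:: x] * bar y)) * wd b)
      + (eps x * eps y) *:
        ((wd [:: x; y] - sign x y *: wd [:: y; x]) * bar_derivation b).
    rewrite !(mulrDl, mulrBl) !mulNr -!scalerAl !scalerDr !scalerN !scalerA.
    have -> : sign y x = sign x y by rewrite /sgn cone_sgC.
    rewrite [sign x y * (sign x y * _)]mulrA sign_sqr mul1r.
    by rewrite [eps x * eps y * sign x y]mulrC [eps y * eps x]mulrC; zmod.
  apply: rpredD; first apply: rpredB.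
  - by have := filtration_mulr b (bar_swap x y); rewrite addnC.
  - apply: filtration_scale.
    by have := filtration_mulr b (bar_swap y x); rewrite addnC.
  apply: filtration_scale; rewrite (pres_swap P) addrAC addrN add0r /bracketed.
  rewrite -malg_lift_mulr; apply: filtration_lift => k _.
  exact: (filtration_mull [:: k] (bar_derivation_filtration b)).
rewrite !cat_cons !word_derivation_cons.
have -> : bar c * wd (a ++ [:: x, y & b]) +
    eps c *: (wd [:: c] * bar_derivation (a ++ [:: x, y & b])) -
    sign x y *: (bar c * wd (a ++ [:: y, x & b]) +
      eps c *: (wd [:: c] * bar_derivation (a ++ [:: y, x & b])))
  = bar c * bracketed wd a (cone_br br x y) b + eps c *: (wd [:: c] *
     (bar_derivation (a ++ [:: x, y & b]) - sign x y *: bar_derivation (a ++ [:: y, x & b]))).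
  rewrite (pres_straightens P) !(mulrDr, mulrN) -!scalerAr !(scalerDr, scalerN) !scalerA.
  by rewrite [eps c * _]mulrC; zmod.
apply: rpredD; last exact/filtration_scale/(filtration_mull [:: c] IH).
rewrite /bracketed -malg_lift_mull; apply: filtration_lift => k _.
rewrite /bar; case: c.1; first by rewrite mul0r rpred0.
by rewrite -(pres_cat P); apply: filtration_word; rewrite /= !size_cat /=; lia.
Qed.

Variable h : {linear A -> A}.
Hypothesis h_normal : forall w, normal_word le (cone_sg sg) w -> h (wd w) = bar_derivation w.

(** The maps [h] and [bar_derivation] agree on normal words and obey the same relations modulo
    shorter words, so straightening keeps them close on every word. *)
Lemma h_word w : h (wd w) - bar_derivation w \in filtration (size w).
Proof.
pattern w; apply: (@normal_word_ind K _ le (cone_sg sg) (cone_br br)) => //.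
  by move=> {}w nw; rewrite h_normal // subrr rpred0.
move=> a x y b _ eq_xy IHs IHb.
have sz k : (size (a ++ k :: b)).+1 = size (a ++ x :: y :: b).
  by rewrite !size_cat /= !addnS.
have hb : h (bracketed wd a (cone_br br x y) b) \in filtration (size (a ++ x :: y :: b)).
  rewrite /bracketed (malg_lift_comp (f := h)); last exact: linearP.
  apply: filtration_lift => k /IHb e.
  rewrite -[h _](subrK (bar_derivation (a ++ k :: b))); apply: rpredD.
    by apply: filtration_le e; rewrite -(sz k).
  by rewrite -(sz k); apply: bar_derivation_filtration.
have hs : h (wd (a ++ x :: y :: b)) - sign x y *: h (wd (a ++ y :: x :: b))
    \in filtration (size (a ++ x :: y :: b)).
  by rewrite (pres_straightens P) linearD linearZ /= addrAC addrN add0r.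
have ds := bar_derivation_swap a x y b.
have [exy|nexy] := eqVneq x y.
  (* For a repeated letter the relation bounds twice the difference, hence the division by 2. *)
  subst y; have sxx : sign x x = -1 by rewrite /sgn eq_xy.
  move: (rpredB hs ds); rewrite sxx !scaleN1r !opprK.
  set p := h _; set q := bar_derivation _ => pq.
  have -> : p - q = 2^-1 *: (p + p - (q + q)).
    have -> : p + p - (q + q) = (p - q) + (p - q) by zmod.
    by rewrite -mulr2n -scaler_nat scalerA mulVf ?scale1r //; exact: char0.
  exact: filtration_scale.
have -> : h (wd (a ++ x :: y :: b)) - bar_derivation (a ++ x :: y :: b) =
    h (wd (a ++ x :: y :: b)) - sign x y *: h (wd (a ++ y :: x :: b))
    - (bar_derivation (a ++ x :: y :: b) - sign x y *: bar_derivation (a ++ y :: x :: b))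
    + sign x y *: (h (wd (a ++ y :: x :: b)) - bar_derivation (a ++ y :: x :: b)).
  by rewrite !scalerDr scalerN; zmod.
apply: rpredD; first exact: rpredB.
apply: filtration_scale; have := IHs nexy.
by have -> : size (a ++ y :: x :: b) = size (a ++ x :: y :: b) by rewrite !size_cat.
Qed.

Lemma h_nil : h 1 = 0.
Proof. by rewrite -(pres_nil P) h_normal. Qed.

(** The Leibniz rule for [h] modulo shorter words, inherited from [bar_derivation] through
    [h_word]. *)
Lemma h_cons n x a : a \in filtration n ->
  h (wd [:: x] * a) - (bar x * a + eps x *: (wd [:: x] * h a)) \in filtration n.
Proof.
move: a; apply: filtration_ind => [|c u v hu hv|w lt].
- by rewrite !mulr0 !linear0 mulr0 scaler0 addr0 subrr rpred0.
- have -> : h (wd [:: x] * (c *: u + v)) -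
      (bar x * (c *: u + v) + eps x *: (wd [:: x] * h (c *: u + v))) =
    c *: (h (wd [:: x] * u) - (bar x * u + eps x *: (wd [:: x] * h u))) +
    (h (wd [:: x] * v) - (bar x * v + eps x *: (wd [:: x] * h v))).
    rewrite !mulrDr -!scalerAr !linearP /= !mulrDr -!scalerAr !(scalerDr, scalerN) !scalerA.
    by rewrite [eps x * _]mulrC; zmod.
  by apply: rpredD => //; apply: filtration_scale.
have -> : h (wd [:: x] * wd w) - (bar x * wd w + eps x *: (wd [:: x] * h (wd w))) =
    (h (wd (x :: w)) - bar_derivation (x :: w))
    - eps x *: (wd [:: x] * (h (wd w) - bar_derivation w)).
  by rewrite -(pres_cons P) word_derivation_cons mulrBr scalerBr; zmod.
apply: rpredB; first exact: filtration_le (h_word (x :: w)).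
apply: filtration_scale.
exact: filtration_le (filtration_mull [:: x] (h_word w)).
Qed.

Variable d : {linear A -> A}.
Hypothesis d_word : forall w, d (wd w) = word_derivation wd (unmark wd) w.

Lemma d_filtration n a : a \in filtration n -> d a \in filtration n.
Proof.
move: a; apply: filtration_ind => [|c u v hu hv|w lt].
- by rewrite linear0 rpred0.
- by rewrite linearP; apply: rpredD => //; apply: filtration_scale.
suff : d (wd w) \in filtration (size w).+1 by apply: filtration_le.
rewrite d_word; elim: w {lt} => [|x w IH]; first exact: rpred0.
rewrite /=; apply: rpredD; last exact/filtration_scale/(filtration_mull [:: x]).
rewrite /unmark; case: x.1; last by rewrite mul0r rpred0.
by rewrite -(pres_cat P); apply: filtration_word.
Qed.

(* On the graded algebra d and h are superderivations and dh + hd is the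
   derivation that fixes the letters, that is, multiplication by the length. *)
Lemma homotopy_word w :
  d (h (wd w)) + h (d (wd w)) - (size w)%:R *: wd w \in filtration (size w).
Proof.
elim: w => [|x w IH].
  by rewrite (pres_nil P) h_nil (cone_d1 P d_word) !linear0 scale0r subr0 addr0 rpred0.
have dx := cone_d_cons P d_word.
have wF : wd w \in filtration (size w).+1 by apply: filtration_word.
have dwF := d_filtration wF.
have key : d (h (wd (x :: w))) + h (d (wd (x :: w))) - (size w).+1%:R *: wd (x :: w)
   - wd [:: x] * (d (h (wd w)) + h (d (wd w)) - (size w)%:R *: wd w)
   \in filtration (size w).+1; last first.
  rewrite -[X in X \in _](subrK
    (wd [:: x] * (d (h (wd w)) + h (d (wd w)) - (size w)%:R *: wd w))).
  by apply: rpredD => //; exact: (filtration_mull [:: x] IH).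
rewrite (pres_cons P) mulrS scalerDl scale1r.
have H1 := d_filtration (h_cons x wF).
have H2 := h_cons x dwF.
rewrite dx linearD linearZ /=.
case: x dx H1 H2 => [[] i] dx; rewrite /bar /unmark /degree_sign /= ?expr0 ?expr1.
  have H3 := h_cons (false, i) wF; move: H3.
  rewrite /bar /degree_sign /= expr0 !mul0r !add0r !scaleN1r !scale1r => H3 H1 H2.
  rewrite linearB linearN /= dx /unmark /degree_sign /= expr1 scaleN1r in H1.
  apply: (filtration_eq (rpredD (rpredB H1 H2) H3)); rewrite !(mulrDr, mulrN) -!scalerAr; zmod.
rewrite !mul0r !linear0 !add0r !scale1r => H1 H2.
rewrite linearB linearD /= !dx /unmark /degree_sign /= expr1 expr0 mul0r in H1.
rewrite scaleN1r scale1r add0r in H1.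
apply: (filtration_eq (rpredD H1 H2)); rewrite !(mulrDr, mulrN) -!scalerAr; zmod.
Qed.

(** For a word shorter than n the factor n is wrong, but the word itself then lies in level n and
    absorbs the difference. *)
Lemma homotopy n a : a \in filtration n.+1 ->
  d (h a) + h (d a) - n%:R *: a \in filtration n.
Proof.
move: a; apply: filtration_ind => [|c u v hu hv|w lt].
- by rewrite !linear0 !addr0 rpred0.
- have -> : d (h (c *: u + v)) + h (d (c *: u + v)) - n%:R *: (c *: u + v) =
    c *: (d (h u) + h (d u) - n%:R *: u) + (d (h v) + h (d v) - n%:R *: v).
    rewrite !linearP /= !(scalerDr, scalerN) !scalerA; zmod.
  by apply: rpredD => //; apply: filtration_scale.
have -> : d (h (wd w)) + h (d (wd w)) - n%:R *: wd w =
    (d (h (wd w)) + h (d (wd w)) - (size w)%:R *: wd w) - (n - size w)%:R *: wd w.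
  by rewrite natrB // scalerBl; zmod.
apply: rpredB; first by apply: filtration_le (homotopy_word w).
have [e|ne] := eqVneq (size w) n; first by rewrite e subnn scale0r rpred0.
by apply/filtration_scale/filtration_word; lia.
Qed.

Lemma filtration1 a : a \in filtration 1 -> exists c, a = c *: 1.
Proof.
move: a; apply: filtration_ind => [|c u v [k ->] [l ->]|[|x w] // _].
- by exists 0; rewrite scale0r.
- by exists (c * k + l); rewrite scalerDl scalerA.
by exists 1; rewrite (pres_nil P) scale1r.
Qed.

(** Subtracting d (h a / n), where n is the top length, turns a cycle into a cycle of lower
    filtration; the descent stops at the scalars. *)
Lemma cone_exact_with a : d a = 0 -> exists b c, a = d b + c *: 1.
Proof.
have [n] := filtration_total a; elim: n a => [|n IH] a aF da.
  have [c ->] := filtration1 (filtration_le (leqnSn 0) aF).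
  by exists 0, c; rewrite linear0 add0r.
case: n IH aF => [|n] IH aF.
  by have [c ->] := filtration1 aF; exists 0, c; rewrite linear0 add0r.
have := homotopy aF; rewrite da linear0 addr0 => H.
pose a1 := a - d (n.+1%:R^-1 *: h a).
have a1F : a1 \in filtration n.+1.
  rewrite /a1 linearZ /=.
  have -> : a - n.+1%:R^-1 *: d (h a) = - n.+1%:R^-1 *: (d (h a) - n.+1%:R *: a).
    by rewrite scalerBr !scaleNr scalerA mulVf // scale1r opprK addrC.
  exact: filtration_scale.
have [b [c e]] : exists b c, a1 = d b + c *: 1.
  by apply: IH a1F _; rewrite /a1 linearB /= da (cone_dd P d_word) subrr.
exists (n.+1%:R^-1 *: h a + b), c.
by rewrite linearD -addrA -e /a1 addrC subrK.
Qed.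

End ConeExact.

(** * Bases *)

Section BasisExistence.
Variables (K : fieldType) (V : lmodType K).
Local Open Scope classical_set_scope.

Let combination (g : {malg K[V]}) : V := malg_lift id g.

Definition independent (S : set V) : Prop := forall g : {malg K[V]},
  (forall x, x \in msupp g -> S x) -> combination g = 0 -> g = 0.

(** A linear combination has finite support, which is contained in one member of the chain. *)
Lemma independent_bigcup (F : set (set V)) :
  F `<=` independent -> total_on F subset -> independent (\bigcup_(X in F) X).
Proof.
move=> indF totF g gF g0.
(* The empty list is kept apart because the chain may have no member at all. *)
have fin (s : seq V) : (forall x, x \in s -> (\bigcup_(X in F) X) x) ->
    s = [::] \/ exists2 X, F X & forall x, x \in s -> X x.
  elim: s => [|x s IH] h; [by left|right].
  have [X FX Xx] := h x (mem_head _ _).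
  have hs y : y \in s -> (\bigcup_(X in F) X) y by move=> ys; apply: h; rewrite inE ys orbT.
  have [->|[Y FY sY]] := IH hs.
    by exists X => // y; rewrite inE => /eqP->.
  have [XY|YX] := totF X Y FX FY.
    by exists Y => // y; rewrite inE => /orP[/eqP->|/sY //]; exact: XY.
  by exists X => // y; rewrite inE => /orP[/eqP->//|/sY]; exact: YX.
have [e|[X FX gX]] := fin (msupp g : seq V) gF.
  apply/malgP => k; rewrite mcoeff0; apply: mcoeff_outdom.
  by apply/negP => kg; have : k \in (msupp g : seq V) by []; rewrite e.
exact: (indF X FX).
Qed.

Lemma maximal_independent_spans (S : set V) : independent S ->
  (forall T, S `<` T -> ~ independent T) ->
  forall v, exists2 g : {malg K[V]}, (forall x, x \in msupp g -> S x) & combination g = v.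
Proof.
move=> indS maxS v; apply: contrapT => nv.
have nSv : ~ S v.
  move=> Sv; apply: nv; exists << v >>; last exact: malg_liftU.
  by move=> x /(fsubsetP msuppU_le); rewrite inE => /eqP->.
apply: (maxS (S `|` [set v])).
  split; first by move=> x Sx; left.
  by move=> h; apply: nSv; apply: h; right.
move=> g gS g0.
have [gv|gv] := eqVneq (g@_v) 0.
  apply: indS g0 => x xg; case: (gS x xg) => // xv.
  by move: xg; rewrite xv -mcoeff_neq0 gv eqxx.
(* The dependence relation is solved for [v], whose coefficient is nonzero. *)
case: nv; exists (<< v >> - (g@_v)^-1 *: g).
  move=> x; rewrite -mcoeff_neq0 mcoeffB mcoeffU mcoeffZ.
  have [<-|nxv] := eqVneq v x; first by rewrite mulr1n mulVf // subrr eqxx.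
  rewrite mulr0n sub0r oppr_eq0 mulf_eq0 negb_or mcoeff_neq0 => /andP[_ xg].
  by case: (gS x xg) => // xv; rewrite xv eqxx in nxv.
by rewrite /combination linearB linearZ /= malg_liftU -/(combination g) g0 scaler0 subr0.
Qed.

(** The coordinates are returned as a linear map into the free module on the index set, so that
    expansions in the basis become [malg_lift]. *)
Lemma exists_basis : exists (I : choiceType) (b : I -> V) (c : {linear V -> {malg K[I]}}),
  (forall i, c (b i) = << i >>) /\ (forall v, malg_lift b (c v) = v).
Proof.
have [S [indS maxS]] := Zorn_bigcup independent_bigcup.
have spanS := maximal_independent_spans indS maxS.
pose I : choiceType := {x : V | `[< S x >]}.
pose b (i : I) : V := val i.
have binj (g : {malg K[I]}) : malg_lift b g = 0 -> g = 0.
  pose g' : {malg K[V]} := malg_lift (fun i => << b i >>) g.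
  have g'E i : g'@_(b i) = g@_i.
    rewrite /g'; elim/malg_lin_ind: g {g'} => [|c u v hu hv|j].
    - by rewrite linear0 !mcoeff0.
    - by rewrite malg_lift_linear !mcoeffD !mcoeffZ hu hv.
    by rewrite malg_liftU !mcoeffU (inj_eq val_inj).
  have g'S x : x \in msupp g' -> S x.
    rewrite -mcoeff_neq0; apply: contra_neqP => nS.
    rewrite /g'; elim/malg_lin_ind: g {g' g'E} => [|c u v hu hv|j].
    - by rewrite linear0 mcoeff0.
    - by rewrite malg_lift_linear mcoeffD mcoeffZ hu hv mulr0 addr0.
    rewrite malg_liftU mcoeffU; case: eqP => // e; case: nS; rewrite -e.
    exact/asboolP/(valP j).
  move=> g0; apply/malgP => i; rewrite -g'E (indS g') ?mcoeff0 // /combination.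
  by rewrite /g' malg_liftA -[RHS]g0; apply: eq_malg_lift => j _; rewrite malg_liftU.
have coord v : exists g : {malg K[I]}, malg_lift b g = v.
  have [g gS <-] := spanS v.
  (* The default 0 is not met, since the support of [g] lies in S. *)
  exists (malg_lift (fun x => if insub x is Some i then << i >> else 0) g).
  rewrite malg_liftA; apply: eq_malg_lift => x /gS Sx.
  by case: insubP => [i _ <-|/asboolP//]; rewrite malg_liftU.
have [c cE] := choice coord.
have cL : linear c.
  move=> a u v; apply/eqP; rewrite -subr_eq0; apply/eqP/binj.
  by rewrite linearB linearP /= !cE subrr.
have [c' c'E] := linear_bundle cL.
exists I, b, c'; split=> [i|v]; last by rewrite c'E cE.
by apply/eqP; rewrite -subr_eq0; apply/eqP/binj; rewrite linearB /= c'E cE malg_liftU subrr.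
Qed.

End BasisExistence.

(** Any well-order will do; transitivity is read off the least of the three elements. *)
Lemma exists_total_order (T : eqType) : exists le : rel T,
  [/\ reflexive le, antisymmetric le, transitive le & total le].
Proof.
have [R Rwo] := well_ordering_principle T.
have wo : wo_chain R predT := withinW Rwo.
have Rr x : R x x by exact: (wo_chain_reflexive wo).
have Ra : antisymmetric R by move=> x y; exact: (wo_chain_antisymmetric wo).
have Rt : total R by move=> x y; exact: (wo_chainW wo).
exists R; split=> // y x z Rxy Ryz.
have [m [[]]] := Rwo (mem [:: x; y; z]) (ex_intro _ x (mem_head _ _)).
rewrite !inE => mm lb _.
have [lx ly lz] : [/\ R m x, R m y & R m z] by split; apply: lb; rewrite !inE eqxx ?orbT.
case/or3P: mm => /eqP em; subst m => //.
  by rewrite (Ra x y) // Rxy lx.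
by rewrite -(Ra y z) // Ryz ly.
Qed.

(** * Homogeneous bases and structure constants *)

Section StructureConstants.
Variables (K : fieldType) (L : lieSuper K).

(** The disjoint union of bases of the two parts. The last clause transfers the parity of a vector
    to the letters of its expansion, so that signs may be computed letter by letter. *)
Lemma adapted_basis : exists (I : choiceType) (par : pred I) (e : I -> total_space L)
    (c : {linear total_space L -> {malg K[I]}}),
  [/\ forall i, c (e i) = << i >>, forall v, malg_lift e (c v) = v,
      forall i, homogeneous (par i) (e i) &
      forall a v k, homogeneous a v -> k \in msupp (c v) -> par k = a].
Proof.
have [I0 [b0 [c0 [cb0 bc0]]]] := exists_basis (even_part L).
have [I1 [b1 [c1 [cb1 bc1]]]] := exists_basis (odd_part L).
pose I : choiceType := (I0 + I1)%type.
pose e (i : I) : total_space L := match i with inl j => (b0 j, 0) | inr j => (0, b1 j) end.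
pose par (i : I) := if i is inr _ then true else false.
pose cf (v : total_space L) : {malg K[I]} :=
  malg_lift (fun i => << inl i >>) (c0 v.1) + malg_lift (fun i => << inr i >>) (c1 v.2).
have cL : linear cf.
  by move=> a u v; rewrite /cf /= !linearP /= scalerDr addrACA.
have [c cE] := linear_bundle cL.
exists I, par, e, c; split.
- move=> [i|i]; rewrite cE /cf /=.
    by rewrite cb0 linear0 malg_liftU linear0 addr0.
  by rewrite cb1 linear0 malg_liftU linear0 add0r.
- move=> [v0 v1]; rewrite cE /cf /= linearD /= !malg_liftA.
  have -> : malg_lift (fun k => malg_lift e << inl k >>) (c0 v0) = (v0, 0).
    rewrite -[in RHS](bc0 v0) (malg_lift_comp (f := fun x : even_part L => (x, 0) : total_space L)).
      by apply: eq_malg_lift => k _; rewrite malg_liftU.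
    by move=> a x y; congr pair; rewrite /= scaler0 addr0.
  have -> : malg_lift (fun k => malg_lift e << inr k >>) (c1 v1) = (0, v1).
    rewrite -[in RHS](bc1 v1) (malg_lift_comp (f := fun x : odd_part L => (0, x) : total_space L)).
      by apply: eq_malg_lift => k _; rewrite malg_liftU.
    by move=> a x y; congr pair; rewrite /= scaler0 addr0.
  by congr pair; rewrite /= ?addr0 ?add0r.
- by move=> [i|i].
move=> a v k hv; rewrite cE /cf -mcoeff_neq0 mcoeffD.
have z0 i w : (malg_lift (fun j => << inl j >>) w : {malg K[I]})@_(inr i) = 0.
  elim/malg_lin_ind: w => [|d u w hu hw|j]; first by rewrite linear0 mcoeff0.
    by rewrite malg_lift_linear mcoeffD mcoeffZ hu hw mulr0 addr0.
  by rewrite malg_liftU mcoeffU.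
have z1 i w : (malg_lift (fun j => << inr j >>) w : {malg K[I]})@_(inl i) = 0.
  elim/malg_lin_ind: w => [|d u w hu hw|j]; first by rewrite linear0 mcoeff0.
    by rewrite malg_lift_linear mcoeffD mcoeffZ hu hw mulr0 addr0.
  by rewrite malg_liftU mcoeffU.
case: a hv k => /= -> [i|i] //=; rewrite !linear0 mcoeff0 ?z0 ?z1.
  by rewrite addr0 eqxx.
by rewrite addr0 eqxx.
Qed.

Section Constants.
Variables (I : choiceType) (par : pred I) (e : I -> total_space L).
Variable c : {linear total_space L -> {malg K[I]}}.
Hypothesis ce : forall i, c (e i) = << i >>.
Hypothesis ec : forall v, malg_lift e (c v) = v.
Hypothesis e_homogeneous : forall i, homogeneous (par i) (e i).
Hypothesis c_homogeneous : forall a v k, homogeneous a v -> k \in msupp (c v) -> par k = a.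

Definition parity_sg : rel I := fun i j => par i && par j.

Definition structure_constants (i j : I) : {malg K[I]} := c (bracket (e i) (e j)).

Lemma parity_sgC : symmetric parity_sg.
Proof. by move=> i j; rewrite /parity_sg andbC. Qed.

Lemma structure_skew i j : structure_constants i j =
  - (sgn K parity_sg i j *: structure_constants j i).
Proof.
by rewrite /structure_constants (bracket_skew (e_homogeneous i) (e_homogeneous j)) linearN linearZ.
Qed.

Lemma structure_sg i j k l : k \in msupp (structure_constants i j) ->
  parity_sg k l = parity_sg i l (+) parity_sg j l.
Proof.
move=> /(c_homogeneous (bracket_graded (e_homogeneous i) (e_homogeneous j))).
by rewrite /parity_sg => ->; case: (par i); case: (par j); case: (par l).
Qed.

Lemma structure_liftr i v : malg_lift (structure_constants i) (c v) = c (bracket (e i) v).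
Proof.
rewrite -[in RHS](ec v) (malg_lift_comp (f := fun w => c (bracket (e i) w))) //.
by move=> a x y; rewrite bracket_linearr linearP.
Qed.

Lemma structure_liftl j v : malg_lift (structure_constants^~ j) (c v) = c (bracket v (e j)).
Proof.
rewrite -[in RHS](ec v) (malg_lift_comp (f := fun w => c (bracket w (e j)))) //.
by move=> a x y; rewrite bracket_linearl linearP.
Qed.

Lemma structure_jacobi u i j :
  malg_lift (structure_constants u) (structure_constants i j) =
  malg_lift (structure_constants^~ j) (structure_constants u i)
  + sgn K parity_sg u i *: malg_lift (structure_constants i) (structure_constants u j).
Proof.
rewrite structure_liftr structure_liftl structure_liftr.
by rewrite (bracket_jacobi (e j) (e_homogeneous u) (e_homogeneous i)) linearD linearZ.
Qed.

End Constants.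
End StructureConstants.

(** * Exterior and symmetric powers, chains *)

(** In a noncommutative product the factors before and after the slot are collected separately;
    multilinearity then reduces to bilinearity of the product. *)
Lemma big_ord_slot (K : fieldType) (A : algType K) n (i : 'I_n) (G : 'I_n -> A) :
  exists p q, forall z, \prod_(j < n) (if j == i then z else G j) = p * z * q.
Proof.
have : i \in index_enum 'I_n by rewrite mem_index_enum.
have := index_enum_uniq 'I_n; move: (index_enum _) => r ur ir.
case/splitPr: ir ur => r1 r2; rewrite cat_uniq /= => /and3P[_ /norP[n1 _] /andP[n2 _]].
exists (\prod_(j <- r1) G j), (\prod_(j <- r2) G j) => z.
rewrite big_cat big_cons /= eqxx -mulrA; congr (_ * (_ * _)).
  by apply: eq_big_seq => j jr; case: eqP => // e; rewrite -e jr in n1.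
by apply: eq_big_seq => j jr; case: eqP => // e; rewrite -e jr in n2.
Qed.

Section Powers.
Variables (K : fieldType) (V : lmodType K).

Lemma tpure_linear n (v : {ffun 'I_n -> V}) i a x y :
  tpure (subst v i (a *: x + y)) = a *: tpure (subst v i x) + tpure (subst v i y).
Proof. by rewrite /tpure -linearP; apply/qmodP/span_gen; exists v, i, a, x, y. Qed.

Definition row_of n (s : seq V) : {ffun 'I_n -> V} := [ffun i : 'I_n => nth 0 s i].

Lemma wedgeE n s :
  wedge n s = qmod (@alternating_rel K V n) (tpure (row_of n s)).
Proof. by []. Qed.

Lemma symprodE n s :
  symprod n s = qmod (@symmetric_rel K V n) (tpure (row_of n s)).
Proof. by []. Qed.

(** The entry 0 is a placeholder that [subst] overwrites. *)
Lemma row_of_slot n a x b (lt : (size a < n)%N) :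
  row_of n (a ++ x :: b) = subst (row_of n (a ++ 0 :: b)) (Ordinal lt) x.
Proof.
apply/ffunP => j; rewrite !ffunE !nth_cat -val_eqE /=.
have [lj|gj|ej] := ltngtP j (size a).
- by [].
- by have -> : (j - size a)%N = (j - (size a).+1).+1 by lia.
by rewrite ej subnn.
Qed.

(** The bound on [a] ensures that the varied entry is not truncated. *)
Lemma wedge_linear n a b c x y : (size a < n)%N ->
  wedge n (a ++ (c *: x + y) :: b) =
  c *: wedge n (a ++ x :: b) + wedge n (a ++ y :: b) :> exterior V n.
Proof.
by move=> lt; rewrite !wedgeE (row_of_slot (c *: x + y) b lt) (row_of_slot x b lt)
  (row_of_slot y b lt) tpure_linear linearP.
Qed.

Lemma symprod_linear n a b c x y : (size a < n)%N ->
  symprod n (a ++ (c *: x + y) :: b) =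
  c *: symprod n (a ++ x :: b) + symprod n (a ++ y :: b) :> sympower V n.
Proof.
by move=> lt; rewrite !symprodE (row_of_slot (c *: x + y) b lt) (row_of_slot x b lt)
  (row_of_slot y b lt) tpure_linear linearP.
Qed.

Lemma wedge_alternate n a x b : ((size a).+1 < n)%N ->
  wedge n (a ++ x :: x :: b) = 0 :> exterior V n.
Proof.
move=> lt; have lt' := ltnW lt.
rewrite wedgeE -[RHS](linear0 (qmod (@alternating_rel K V n))); apply/qmodP.
rewrite subr0; apply: span_gen; exists (row_of n (a ++ x :: x :: b)), (Ordinal lt'), (Ordinal lt).
split=> //; first by rewrite -val_eqE /= neq_ltn ltnSn.
by rewrite !ffunE !nth_cat /= ltnn subnn ltnNge leqnSn subSnn.
Qed.

Lemma symprod_swap n a x y b : ((size a).+1 < n)%N ->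
  symprod n (a ++ x :: y :: b) = symprod n (a ++ y :: x :: b) :> sympower V n.
Proof.
move=> lt; have lt' := ltnW lt; pose i := Ordinal lt'; pose j := Ordinal lt.
apply/qmodP/span_gen; exists (row_of n (a ++ y :: x :: b)), (tperm i j); congr (_ - _).
congr tpure; apply/ffunP => k; rewrite !ffunE.
case: tpermP => [->|->|/eqP ni /eqP nj].
- by rewrite !nth_cat /= ltnn subnn ltnNge leqnSn subSnn.
- by rewrite !nth_cat /= ltnn subnn ltnNge leqnSn subSnn.
rewrite !nth_cat; case: ltnP => // ge.
move: ni nj ge; rewrite -!val_eqE /=; move: (nat_of_ord k) => m ni nj ge.
by have -> : (m - size a)%N = (m - (size a).+2).+2 by lia.
Qed.

Lemma row_of_codom n (v : {ffun 'I_n -> V}) : row_of n [seq v i | i <- enum 'I_n] = v.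
Proof.
apply/ffunP => i; rewrite ffunE (nth_map i) ?size_enum_ord //.
by rewrite nth_ord_enum.
Qed.

Lemma tpower_lin_ind n (P : tpower V n -> Prop) :
  P 0 -> (forall c u v, P u -> P v -> P (c *: u + v)) ->
  (forall s, size s = n -> P (tpure (row_of n s))) -> forall t, P t.
Proof.
move=> P0 PD PU; elim/quot_ind=> g; elim/malg_lin_ind: g => [|c u v hu hv|v].
- by rewrite linear0.
- by rewrite linearP; apply: PD.
have := PU [seq v i | i <- enum 'I_n]; rewrite row_of_codom; apply.
by rewrite size_map size_enum_ord.
Qed.

Section Lift.
Variables (A : algType K) (f : {linear V -> A}).

Let product n (v : {ffun 'I_n -> V}) : A := \prod_(i < n) f (v i).

Lemma product_row n s : size s = n -> product (row_of n s) = \prod_(x <- s) f x.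
Proof.
move=> sz; rewrite /product (big_nth 0) sz big_mkord.
by apply: eq_bigr => i _; rewrite ffunE.
Qed.

Lemma tpower_lift n : exists g : {linear tpower V n -> A},
  forall v, g (tpure v) = product v.
Proof.
have fS r : @multilinear_rel K V n r -> malg_lift (@product n) r = 0.
  move=> [v [i [a [x [y ->]]]]]; rewrite linearB linearD linearZ /= !malg_liftU.
  have [p [q e]] := big_ord_slot i (fun j => f (v j)).
  have eP z : product (subst v i z) = p * f z * q.
    rewrite -e; apply: eq_bigr => j _; rewrite ffunE.
    by case: (j == i).
  by rewrite !eP linearP mulrDr mulrDl -scalerAr -scalerAl subrr.
have [g gE] := linear_bundle (quot_lift_linear (malg_lift_linear (@product n)) fS).
exists g => v; rewrite gE; apply: etrans (malg_liftU _ _).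
exact: (quot_lift_qmod (malg_lift_linear (@product n)) fS).
Qed.

(** Two equal entries are brought together by anticommutation across the factors between them, and
    then the square-zero hypothesis kills the product. *)
Lemma exterior_lift n : (forall x y, f x * f y = - (f y * f x)) -> (forall x, f x * f x = 0) ->
  exists g : {linear exterior V n -> A},
  forall s, size s = n -> g (wedge n s) = \prod_(x <- s) f x.
Proof.
move=> fN f2; have [g0 g0E] := tpower_lift n.
have fX x (r : seq 'I_n) (v : {ffun 'I_n -> V}) :
    f x * \prod_(i <- r) f (v i) * f x = 0.
  elim: r => [|j r IH]; first by rewrite big_nil mulr1 f2.
  rewrite -mulrA in IH.
  by rewrite big_cons !mulrA fN !mulNr -!mulrA IH mulr0 oppr0.
have fX2 x y p q (r : seq 'I_n) (v : {ffun 'I_n -> V}) : x = y ->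
    p * (f x * (\prod_(i <- r) f (v i) * (f y * q))) = 0.
  by move=> <-; rewrite [f x * (_ * _)]mulrA [f x * _ * (_ * _)]mulrA fX mul0r mulr0.
have g0S r : @alternating_rel K V n r -> g0 r = 0.
  move=> [v [i [j [nij eij ->]]]]; rewrite g0E /product.
  have : i \in index_enum 'I_n by rewrite mem_index_enum.
  have : j \in index_enum 'I_n by rewrite mem_index_enum.
  move: (index_enum _) => s js is_; case/splitPr: is_ js => r1 r2.
  rewrite mem_cat inE eq_sym (negPf nij) /= => /orP[] jr; case/splitPr: jr => r3 r4.
    by rewrite -catA big_cat /= big_cons big_cat /= big_cons fX2.
  by rewrite big_cat big_cons big_cat big_cons /= fX2.
have [g gE] := linear_bundle (quot_lift_linear (linearP g0) g0S).
exists g => s sz; rewrite gE -(product_row sz) -g0E.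
exact: (quot_lift_qmod (linearP g0) g0S).
Qed.

Lemma prod_perm_comm (s1 s2 : seq V) : (forall x y, f x * f y = f y * f x) ->
  perm_eq s1 s2 -> \prod_(x <- s1) f x = \prod_(x <- s2) f x.
Proof.
move=> fC p12; pattern s2; apply: (catCA_perm_ind _ p12) => // a b c ->.
have comm x s : f x * \prod_(y <- s) f y = \prod_(y <- s) f y * f x.
  elim: s => [|y s IH]; first by rewrite big_nil mulr1 mul1r.
  by rewrite big_cons mulrA fC -!mulrA IH.
have comms s t : \prod_(x <- s) f x * \prod_(y <- t) f y
    = \prod_(y <- t) f y * \prod_(x <- s) f x.
  elim: s => [|y s IH]; first by rewrite big_nil mulr1 mul1r.
  by rewrite big_cons -mulrA IH mulrA comm -mulrA.
by rewrite !big_cat /= !mulrA comms.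
Qed.

Lemma sympower_lift n : (forall x y, f x * f y = f y * f x) ->
  exists g : {linear sympower V n -> A},
  forall s, size s = n -> g (symprod n s) = \prod_(x <- s) f x.
Proof.
move=> fC; have [g0 g0E] := tpower_lift n.
have g0S r : @symmetric_rel K V n r -> g0 r = 0.
  move=> [v [s ->]]; rewrite linearB /= !g0E /product; apply/eqP.
  rewrite subr_eq0; apply/eqP.
  have e (w : 'I_n -> V) : \prod_(i < n) f (w i)
      = \prod_(x <- [seq w i | i <- index_enum 'I_n]) f x.
    by rewrite big_map.
  under eq_bigr do rewrite ffunE.
  rewrite (e (fun i => v (s i))) (e v); apply: prod_perm_comm => //.
  rewrite (map_comp v s); apply: perm_map; apply: uniq_perm.
  - by rewrite map_inj_uniq ?index_enum_uniq //; exact: perm_inj.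
  - exact: index_enum_uniq.
  move=> i; rewrite mem_index_enum; apply/mapP; exists ((s^-1)%g i); rewrite ?mem_index_enum //.
  by rewrite permKV.
have [g gE] := linear_bundle (quot_lift_linear (linearP g0) g0S).
exists g => s sz; rewrite gE -(product_row sz) -g0E.
exact: (quot_lift_qmod (linearP g0) g0S).
Qed.

End Lift.
End Powers.

Section DirectSumTheory.
Variables (K : fieldType) (I : finType) (V : I -> lmodType K).

Lemma dsum_inE (i : I) (x : V i) : dsum_in x i = x.
Proof. by rewrite /dsum_in dfwith_in. Qed.

Lemma dsum_in_out (i j : I) (x : V i) : i != j -> dsum_in x j = 0.
Proof. by move=> ne; rewrite /dsum_in dfwith_out. Qed.

Lemma dsum_in_linear i : linear (@dsum_in K I V i).
Proof.
move=> a x y; apply: functional_extensionality_dep => j.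
rewrite -[(a *: dsum_in x + dsum_in y) j]/(a *: dsum_in x j + dsum_in y j).
have [eij|ne] := eqVneq i j; first by subst j; rewrite !dsum_inE.
by rewrite !dsum_in_out // scaler0 addr0.
Qed.

HB.instance Definition _ i :=
  GRing.isLinear.Build K (V i) (dsum V) *:%R (@dsum_in K I V i) (@dsum_in_linear i).

Lemma dsum_proj_linear i : linear (fun c : dsum V => c i).
Proof. by []. Qed.

Lemma dsum_sum (c : dsum V) : c = \sum_i dsum_in (c i).
Proof.
apply: functional_extensionality_dep => j.
have [g gE] := linear_bundle (dsum_proj_linear j).
rewrite -[LHS]gE -[RHS]gE linear_sum (bigD1 j) //= !gE dsum_inE big1 ?addr0 // => i ne.
by rewrite gE dsum_in_out.
Qed.

Lemma dsum_lift (X : lmodType K) (T : forall i, {linear V i -> X}) :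
  exists J : {linear dsum V -> X}, forall i x, J (dsum_in x) = T i x.
Proof.
have JL : linear (fun c : dsum V => \sum_i T i (c i)).
  move=> a u v; rewrite scaler_sumr -big_split; apply: eq_bigr => i _.
  exact: linearP.
have [J JE] := linear_bundle JL; exists J => i x.
rewrite JE (bigD1 i) //= dsum_inE big1 ?addr0 // => j ne.
by rewrite dsum_in_out ?linear0 // eq_sym.
Qed.

End DirectSumTheory.

(** Alternating implies skew: [g] stands for the value of a biadditive form at (x + y, x + y), and
    the other letters for the terms of its expansion. *)
Lemma polarize (W : zmodType) (g s1 s2 xx xy yx yy : W) :
  g = 0 -> g = s1 + s2 -> s1 = xx + xy -> s2 = yx + yy -> xx = 0 -> yy = 0 ->
  xy + yx = 0.
Proof. by move=> -> e e1 e2 e3 e4; move: e; rewrite e1 e2 e3 e4 add0r addr0. Qed.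

Section TensorTheory.
Variables (K : fieldType) (V W : lmodType K).

Lemma tens0r (v : V) : tens v (0 : W) = 0.
Proof. exact: (linear_zero (tens_linearr v)). Qed.

Lemma tens0l (w : W) : tens (0 : V) w = 0.
Proof. exact: (linear_zero (fun a x y => tens_linearl w a x y)). Qed.

Lemma tens_scalel (a : K) (v : V) (w : W) : a *: tens v w = tens (a *: v) w.
Proof. by rewrite -[a *: v]addr0 tens_linearl tens0l addr0. Qed.

Lemma tens_comp (X : lmodType K) (f : X -> W) (v : V) a x y : linear f ->
  tens v (f (a *: x + y)) = tens (a *: v) (f x) + tens v (f y).
Proof. by move=> fL; rewrite fL tens_linearr tens_scalel. Qed.

Lemma tens_comp2 (X : lmodType K) (f : X -> W) (v : V) a x y : linear f ->
  tens v (f (a *: x + y)) = a *: tens v (f x) + tens v (f y).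
Proof. by move=> fL; rewrite fL tens_linearr. Qed.

End TensorTheory.

Lemma power_tensor_ind (K : fieldType) (V0 V1 : lmodType K) n m
    (Q : tensor (exterior V0 n) (sympower V1 m) -> Prop) :
  Q 0 -> (forall a w1 w2, Q w1 -> Q w2 -> Q (a *: w1 + w2)) ->
  (forall xs ys, size xs = n -> size ys = m -> Q (tens (wedge n xs) (symprod m ys))) ->
  forall w, Q w.
Proof.
move=> Q0 QD QG; apply: tensor_ind => [l s|w1 w2 h1 h2]; last first.
  by rewrite -[w1]scale1r; apply: QD.
pose ext := qmod (@alternating_rel K V0 n); pose sym := qmod (@symmetric_rel K V1 m).
have extP : linear ext by exact: linearP.
have symP : linear sym by exact: linearP.
elim/quot_ind: l => l; rewrite -/(ext l); move: l.
apply: tpower_lin_ind => [|a l1 l2 h1 h2|xs sx].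
- by rewrite (linear_zero extP) tens0l.
- by rewrite extP tens_linearl; exact: QD.
elim/quot_ind: s => s; rewrite -/(sym s); move: s.
apply: tpower_lin_ind => [|a l1 l2 h1 h2|ys sy].
- by rewrite (linear_zero symP) tens0r.
- by rewrite symP tens_linearr; exact: QD.
exact: QG.
Qed.

(** * Generators of the chain spaces *)

Section ChainSpace.
Variables (K : fieldType) (L : lieSuper K) (U : algType K).

Local Notation V0 := (even_part L).
Local Notation V1 := (odd_part L).
Local Notation chains k := (superpower L k).
Local Notation summand k p := (tensor (exterior V0 p) (sympower V1 (k - p))).

Definition chain_in k (p : 'I_k.+1) (t : summand k p) : chains k := dsum_in (i := p) t.

Lemma chain_in_linear k p : linear (@chain_in k p).
Proof. exact: dsum_in_linear. Qed.

Lemma chain_sum k (c : chains k) : c = \sum_p chain_in (c p).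
Proof. exact: dsum_sum. Qed.

Lemma chain_lift k (X : lmodType K) (T : forall p : 'I_k.+1, {linear summand k p -> X}) :
  exists J : {linear chains k -> X}, forall p t, J (chain_in t) = T p t.
Proof.
have [J JE] := dsum_lift T.
have JL : linear (J : chains k -> X) by exact: linearP.
by have [J' J'E] := linear_bundle JL; exists J' => p t; rewrite J'E -JE.
Qed.

(** The counterpart of [cgen] in the vector space over K, with an arbitrary algebra in place of the
    enveloping algebra: maps into the cone are linear over K. *)
Definition gen k (u : U) (xs : seq V0) (ys : seq V1) : tensor U (chains k) :=
  tens u (chain_in (p := inord (size xs)) (tens (wedge _ xs) (symprod _ ys))).

Lemma gen_linear_u k xs ys : linear (fun u => gen k u xs ys).
Proof. by move=> a u v; rewrite /gen tens_linearl. Qed.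

(** The size condition rules out truncation and padding in [wedge] and [symprod], and makes [inord]
    exact. *)
Lemma gen_linear_x k u (a b : seq V0) (ys : seq V1) c x y : (size a + size b + size ys)%N.+1 = k ->
  gen k u (a ++ (c *: x + y) :: b) ys =
  c *: gen k u (a ++ x :: b) ys + gen k u (a ++ y :: b) ys.
Proof.
move=> sz; rewrite /gen.
have -> z : size (a ++ z :: b) = (size a + size b).+1 by rewrite size_cat /= addnS.
rewrite !size_cat /= !addnS.
set p : 'I_k.+1 := inord _.
have lt : (size a < p)%N by rewrite inordK; lia.
pose w z := tens (wedge p (a ++ z :: b)) (symprod (k - p) ys).
have e : w (c *: x + y) = c *: w x + w y by rewrite /w wedge_linear // tens_linearl.
rewrite -!/(w _) e.
exact: (tens_comp2 u c _ _ (@chain_in_linear k p)).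
Qed.

Lemma gen_linear_y k u (xs : seq V0) (a b : seq V1) c x y : (size xs + size a + size b)%N.+1 = k ->
  gen k u xs (a ++ (c *: x + y) :: b) =
  c *: gen k u xs (a ++ x :: b) + gen k u xs (a ++ y :: b).
Proof.
move=> sz; rewrite /gen; set p : 'I_k.+1 := inord _.
have lt : (size a < k - p)%N by rewrite inordK; lia.
pose w z := tens (wedge p xs) (symprod (k - p) (a ++ z :: b)).
have e : w (c *: x + y) = c *: w x + w y by rewrite /w symprod_linear // tens_linearr.
rewrite -!/(w _) e.
exact: (tens_comp2 u c _ _ (@chain_in_linear k p)).
Qed.

Lemma gen_alternate k u (a : seq V0) x (b : seq V0) (ys : seq V1) :
  (size a + size b + size ys)%N.+2 = k ->
  gen k u (a ++ x :: x :: b) ys = 0.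
Proof.
move=> sz; rewrite /gen size_cat /= !addnS.
set p : 'I_k.+1 := inord _.
have lt : ((size a).+1 < p)%N by rewrite inordK; lia.
rewrite wedge_alternate //.
have -> : tens (0 : exterior V0 p) (symprod (k - p) ys) = 0 by exact: tens0l.
rewrite (linear_zero (@chain_in_linear k p)).
exact: tens0r.
Qed.

Lemma gen_add_x k u (a b : seq V0) (ys : seq V1) x y :
  (size a + size b + size ys)%N.+1 = k ->
  gen k u (a ++ (x + y) :: b) ys = gen k u (a ++ x :: b) ys + gen k u (a ++ y :: b) ys.
Proof. by move=> sz; rewrite -[x in x + y]scale1r gen_linear_x // scale1r. Qed.

Lemma gen_swap_y k u (xs : seq V0) (a : seq V1) x y (b : seq V1) :
  (size xs + size a + size b)%N.+2 = k ->
  gen k u xs (a ++ x :: y :: b) = gen k u xs (a ++ y :: x :: b).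
Proof.
move=> sz; rewrite /gen; set p : 'I_k.+1 := inord _.
have lt : ((size a).+1 < k - p)%N by rewrite inordK; lia.
by rewrite symprod_swap.
Qed.

Lemma gen_swap_x k u (a : seq V0) x y (b : seq V0) (ys : seq V1) :
  (size a + size b + size ys)%N.+2 = k ->
  gen k u (a ++ x :: y :: b) ys = - gen k u (a ++ y :: x :: b) ys.
Proof.
move=> sz; apply/eqP; rewrite -addr_eq0; apply/eqP.
have g0 := gen_alternate u (x + y) sz.
have szb z : (size a + size (z :: b) + size ys).+1 = k by rewrite /= addnS addSn.
have sza z : (size (rcons a z) + size b + size ys).+1 = k by rewrite size_rcons !addSn.
have e z : gen k u (a ++ z :: (x + y) :: b) ys =
    gen k u (a ++ z :: x :: b) ys + gen k u (a ++ z :: y :: b) ys.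
  by have := gen_add_x u (a := rcons a z) x y (sza z); rewrite !cat_rcons.
exact: polarize g0 (gen_add_x u x y (szb (x + y))) (e x) (e y)
  (gen_alternate u x sz) (gen_alternate u y sz).
Qed.

Lemma gen_ind k (P : tensor U (chains k) -> Prop) : P 0 ->
  (forall m n, P m -> P n -> P (m + n)) ->
  (forall u xs ys, (size xs + size ys)%N = k -> P (gen k u xs ys)) -> forall m, P m.
Proof.
move=> P0 PD PG; apply: tensor_ind => // u c.
have [t tE] := linear_bundle (@tens_linearr K U (chains k) u).
rewrite (chain_sum c) -tE linear_sum; apply: big_ind => // p _.
rewrite tE; move: (c p) => {c t tE} /= w.
pose Q (w : tensor (exterior V0 p) (sympower V1 (k - p))) :=
  forall u, P (tens u (chain_in w)).
suff : Q w by apply.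
have dL := @chain_in_linear k p.
have QD a w1 w2 : Q w1 -> Q w2 -> Q (a *: w1 + w2).
  by move=> h1 h2 v; rewrite [X in P X](tens_comp v a w1 w2 dL); apply: PD.
have Q0 : Q 0 by move=> v; rewrite (linear_zero dL) [X in P X]tens0r.
move: w; apply: power_tensor_ind Q0 QD _ => xs ys sx sy.
move=> v; have := PG v xs ys; rewrite /gen sx inord_val; apply.
by rewrite sy subnKC // -ltnS.
Qed.

(** Yields the embeddings of the chain spaces into the cone algebra, and also the augmentation. *)
Lemma gen_lift (A : algType K) (phi : {linear U -> A}) (f0 : {linear V0 -> A})
    (f1 : {linear V1 -> A}) k :
  (forall x y, f0 x * f0 y = - (f0 y * f0 x)) -> (forall x, f0 x * f0 x = 0) ->
  (forall x y, f1 x * f1 y = f1 y * f1 x) ->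
  exists i : {linear tensor U (chains k) -> A},
  forall u xs ys, (size xs + size ys)%N = k ->
  i (gen k u xs ys) = phi u * (\prod_(x <- xs) f0 x * \prod_(y <- ys) f1 y).
Proof.
move=> f0N f02 f1C.
have lift2 (X Y : lmodType K) (g : {linear X -> A}) (h : {linear Y -> A}) :
    exists T : {linear tensor X Y -> A}, forall x y, T (tens x y) = g x * h y.
  have hl w : linear (fun v => g v * h w) by move=> a x y; rewrite linearP mulrDl -scalerAl.
  have hr v : linear (fun w => g v * h w) by move=> a x y; rewrite linearP mulrDr -scalerAr.
  have [T TE] := linear_bundle (tensor_lift_linear hl hr).
  by exists T => x y; rewrite TE (tensor_liftE hl hr).
have ex (p : 'I_k.+1) : exists T : {linear tensor (exterior V0 p) (sympower V1 (k - p)) -> A},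
    forall xs ys, size xs = p -> size ys = (k - p)%N ->
    T (tens (wedge p xs) (symprod (k - p) ys)) = \prod_(x <- xs) f0 x * \prod_(y <- ys) f1 y.
  have [g gE] := exterior_lift p f0N f02; have [h hE] := sympower_lift (k - p) f1C.
  by have [T TE] := lift2 _ _ g h; exists T => xs ys sx sy; rewrite TE gE // hE.
pose T p := projT1 (cid (ex p)).
have TE p : _ := projT2 (cid (ex p)).
have [J JE] := chain_lift T.
have [i iE] := lift2 _ _ phi J.
exists i => u xs ys sz; rewrite /gen iE JE TE //; rewrite inordK; lia.
Qed.

End ChainSpace.

(** * The enveloping algebra *)

Lemma multiplicative_from_gens (K : fieldType) (F A : algType K) (T : Type) (m : T -> F)
    (g : {linear F -> A}) :
  (forall P : F -> Prop, P 0 -> (forall c u v, P u -> P v -> P (c *: u + v)) ->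
     (forall t, P (m t)) -> forall x, P x) ->
  (forall s t, g (m s * m t) = g (m s) * g (m t)) -> forall x y, g (x * y) = g x * g y.
Proof.
move=> ind gm; apply: (@ind) => [y|c u v hu hv y|s].
- by rewrite !(mul0r, linear0).
- by rewrite mulrDl -scalerAl !linearP hu hv mulrDl -scalerAl.
apply: ind => [|c u v hu hv|t].
- by rewrite !(mulr0, linear0).
- by rewrite mulrDr -scalerAr !linearP hu hv mulrDr -scalerAr.
exact: gm.
Qed.

Lemma sub_sub_eq0 (V : zmodType) (p q r : V) : p - (q - r) = 0 -> q = r + p.
Proof. by move=> /subr0_eq->; zmod. Qed.

Lemma linear_sub_add (K : pzRingType) (V W : lmodType K) (f : V -> W) a p q r :
  linear f -> f (p - (a *: q + r)) = f p - (a *: f q + f r).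
Proof. by move=> /linear_bundle[g e]; rewrite -!e linearB linearP. Qed.

Lemma linear_sub_sub (K : pzRingType) (V W : lmodType K) (f : V -> W) a p q r :
  linear f -> f (p - (q - a *: r)) = f p - (f q - a *: f r).
Proof. by move=> /linear_bundle[g e]; rewrite -!e !linearB linearZ. Qed.

Section AlgebraQuotientTheory.
Variables (K : fieldType) (A0 : algType K) (S : set A0).

Lemma qalg_linear : linear (qalg S).
Proof. by move=> a u v; rewrite qalgD qalgZ. Qed.

Lemma qalg_eq0 s : S s -> qalg S s = 0.
Proof.
move=> Ss; rewrite -(linear_zero qalg_linear); apply/qalgP; rewrite subr0.
by apply: span_gen; exists 1, s, 1; rewrite mul1r mulr1.
Qed.

Lemma algquot_lift (A : algType K) (f : {linear A0 -> A}) :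
  f 1 = 1 -> (forall x y, f (x * y) = f x * f y) -> (forall s, S s -> f s = 0) ->
  exists g : {linear algquot S -> A}, [/\ forall a, g (qalg S a) = f a, g 1 = 1 &
    forall x y, g (x * y) = g x * g y].
Proof.
move=> f1 fM fS.
have fI r : ideal_gens S r -> f r = 0.
  by move=> [a [s [b [Ss ->]]]]; rewrite !fM (fS s Ss) mulr0 mul0r.
have [g gE] := linear_bundle (quot_lift_linear (linearP f) fI).
have gq a : g (qalg S a) = f a.
  by rewrite gE; exact: (quot_lift_qmod (linearP f) fI).
exists g; split=> //; first by rewrite -[RHS]f1 -gq.
by elim/algquot_ind=> a; elim/algquot_ind=> b; rewrite -qalgM !gq fM.
Qed.

End AlgebraQuotientTheory.

Section TensorAlgebraTheory.
Variables (K : fieldType) (V : lmodType K).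

Definition free_monom (s : seq V) : freealg V := mkmalgU (FMonom s) 1.

Lemma free_monom_cat s t : free_monom (s ++ t) = free_monom s * free_monom t.
Proof.
rewrite /free_monom; have <- : mmul (FMonom s) (FMonom t) = FMonom (s ++ t) := fmmulE _ _.
by rewrite [RHS]malgM_def fgmulUU mulr1.
Qed.

Lemma free_monom_nil : free_monom [::] = 1.
Proof. by rewrite /free_monom -fmoneE. Qed.

Lemma letterE x : letter x = free_monom [:: x].
Proof. by rewrite /letter fmuE. Qed.

Lemma freealg_ind (P : freealg V -> Prop) :
  P 0 -> (forall c u v, P u -> P v -> P (c *: u + v)) ->
  (forall s, P (free_monom s)) -> forall g, P g.
Proof. by move=> P0 PD PU; apply: malg_lin_ind => // -[s]; exact: PU. Qed.

Lemma freealg_lift (A : algType K) (f : V -> A) :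
  exists g : {linear freealg V -> A}, [/\ forall s, g (free_monom s) = \prod_(x <- s) f x,
    g 1 = 1 & forall x y, g (x * y) = g x * g y].
Proof.
pose F (m : {fmonom V}) := \prod_(x <- (m : seq V)) f x.
have [g gE] := linear_bundle (malg_lift_linear F : linear (malg_lift F : freealg V -> A)).
have gm s : g (free_monom s) = \prod_(x <- s) f x by rewrite gE; exact: malg_liftU.
exists g; split=> //; first by rewrite -free_monom_nil gm big_nil.
apply: (multiplicative_from_gens freealg_ind) => s t.
by rewrite -free_monom_cat !gm big_cat.
Qed.

Lemma talg_lift (A : algType K) (f : {linear V -> A}) :
  exists g : {linear talg V -> A}, [/\ forall x, g (tin x) = f x,
    g 1 = 1 & forall x y, g (x * y) = g x * g y].
Proof.
have [g0 [g0m g01 g0M]] := freealg_lift f.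
have g0S s : @linear_rel K V s -> g0 s = 0.
  move=> [a [x [y ->]]]; rewrite (linear_sub_add a (letter (a *: x + y)) (letter x)
    (letter y) (linearP g0)).
  rewrite !letterE !g0m !big_seq1.
  by rewrite linearP subrr.
have [g [gE g1 gM]] := algquot_lift g01 g0M g0S.
by exists g; split=> // x; rewrite gE letterE g0m big_seq1.
Qed.

Lemma tin_linear : linear (@tin K V).
Proof.
move=> a x y; rewrite /tin -qalg_linear; apply/qalgP/span_gen.
exists 1, (letter (a *: x + y) - (a *: letter x + letter y)), 1.
by split; [exists a, x, y|rewrite mul1r mulr1].
Qed.

Lemma talg_ind (P : talg V -> Prop) :
  P 0 -> (forall c u v, P u -> P v -> P (c *: u + v)) ->
  (forall s, P (\prod_(x <- s) tin x)) -> forall t, P t.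
Proof.
move=> P0 PD PU; elim/algquot_ind=> g; move: g.
apply: freealg_ind => [|c u v hu hv|s].
- by rewrite (linear_zero (@qalg_linear _ _ _)).
- by rewrite qalg_linear; exact: PD.
suff -> : qalg (@linear_rel K V) (free_monom s) = \prod_(x <- s) tin x by exact: PU.
elim: s => [|x s IH]; first by rewrite big_nil free_monom_nil.
by rewrite big_cons -IH /tin letterE -qalgM -free_monom_cat.
Qed.

End TensorAlgebraTheory.

Section EnvelopingTheory.
Variables (K : fieldType) (L : lieSuper K).

Lemma env_in_linear : linear (@env_in K L).
Proof. by move=> a x y; rewrite /env_in tin_linear qalg_linear. Qed.

HB.instance Definition _ :=
  GRing.isLinear.Build K (total_space L) (env L) *:%R (@env_in K L) env_in_linear.

Lemma env_ind (P : env L -> Prop) :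
  P 0 -> (forall c u v, P u -> P v -> P (c *: u + v)) ->
  (forall s, P (\prod_(x <- s) env_in x)) -> forall u, P u.
Proof.
move=> P0 PD PU; elim/algquot_ind=> t; move: t; apply: talg_ind => [|c u v hu hv|s].
- by rewrite (linear_zero (@qalg_linear _ _ _)).
- by rewrite qalg_linear; exact: PD.
suff -> : qalg (@env_rel K L) (\prod_(x <- s) tin x) = \prod_(x <- s) env_in x by exact: PU.
elim: s => [|x s IH]; first by rewrite !big_nil.
by rewrite !big_cons -IH -qalgM.
Qed.

Lemma env_in_bracket a b (x y : total_space L) : homogeneous a x -> homogeneous b y ->
  env_in x * env_in y = (-1) ^+ (a && b) *: (env_in y * env_in x) + env_in (bracket x y).
Proof.
move=> hx hy; set r := tin (bracket x y : total_space L)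
  - (tin x * tin y - (-1) ^+ (a && b) *: (tin y * tin x)).
have : qalg (@env_rel K L) r = 0.
  by apply: qalg_eq0; exists a, b, x, y.
rewrite /r (linear_sub_sub _ _ _ _ (@qalg_linear _ _ _)) !qalgM.
exact: sub_sub_eq0.
Qed.

(** The universal property of the enveloping algebra, to be applied to the unbarred copy of L in the
    cone algebra. *)
Lemma env_lift (A : algType K) (f : {linear total_space L -> A}) :
  (forall a b x y, homogeneous a x -> homogeneous b y ->
     f x * f y = (-1) ^+ (a && b) *: (f y * f x) + f (bracket x y)) ->
  exists g : {linear env L -> A}, [/\ forall x, g (env_in x) = f x,
    g 1 = 1 & forall x y, g (x * y) = g x * g y].
Proof.
move=> fB; have [g0 [g0i g01 g0M]] := talg_lift f.
have g0S s : @env_rel K L s -> g0 s = 0.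
  move=> [a [b [x [y [hx hy ->]]]]]; rewrite (linear_sub_sub _ _ _ _ (linearP g0)) !g0M !g0i.
  by rewrite (fB a b) // addrAC addrN add0r subrr.
have [g [gE g1 gM]] := algquot_lift g01 g0M g0S.
by exists g; split=> // x; rewrite gE g0i.
Qed.

End EnvelopingTheory.

(** * The differential of the cone in terms of the boundary formula *)

(** Pairs are separated according to whether they involve the head, as required by inductions on
    lists. *)
Lemma sum_pairs_recl (V : zmodType) n (F : nat -> nat -> V) :
  \sum_(s < n.+1) \sum_(t < n.+1 | (s < t)%N) F s t =
  \sum_(t < n) F 0%N t.+1 + \sum_(s < n) \sum_(t < n | (s < t)%N) F s.+1 t.+1.
Proof.
rewrite big_ord_recl; congr (_ + _).
  by rewrite big_mkcond big_ord_recl /= add0r.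
by apply: eq_bigr => s _; rewrite big_mkcond big_ord_recl /= add0r -big_mkcond.
Qed.

Lemma omit0 (T : Type) (x : T) s : omit 0 (x :: s) = s.
Proof. by rewrite /omit /= drop0. Qed.

Lemma omitS (T : Type) i (x : T) s : omit i.+1 (x :: s) = x :: omit i s.
Proof. by []. Qed.

Section ConeOfSuperalgebra.
Variables (K : fieldType) (L : lieSuper K).
Variables (I : choiceType) (par : pred I) (e : I -> total_space L).
Variable c : {linear total_space L -> {malg K[I]}}.
Hypothesis ce : forall i, c (e i) = << i >>.
Hypothesis ec : forall v, malg_lift e (c v) = v.
Hypothesis e_homogeneous : forall i, homogeneous (par i) (e i).
Hypothesis c_homogeneous : forall a v k, homogeneous a v -> k \in msupp (c v) -> par k = a.

Local Notation V := (total_space L).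
Local Notation sg := (parity_sg par).
Local Notation br := (structure_constants e c).

Variables (A : algType K) (wd : seq (bool * I) -> A).
Hypothesis P : presentation (cone_sg sg) (cone_br br) wd.

(** Extends the letters linearly from basis vectors to all of L, so that the boundary formula can be
    compared without coordinates. *)
Definition mk (t : bool) (v : V) : A := malg_lift (fun i => wd [:: (t, i)]) (c v).

Fact mk_linear t : linear (mk t).
Proof. by move=> a u v; rewrite /mk !linearP. Qed.

HB.instance Definition _ t := GRing.isLinear.Build K V A *:%R (mk t) (mk_linear t).

Lemma mk_e t i : mk t (e i) = wd [:: (t, i)].
Proof. by rewrite /mk ce malg_liftU. Qed.

Lemma mk_linear_lift (W : lmodType K) (f : V -> W) v : linear f ->
  f v = malg_lift (fun i => f (e i)) (c v).
Proof. by move=> fL; rewrite -{1}(ec v) (malg_lift_comp _ _ fL). Qed.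

(** The bracket of the cone for bars [t] and [t'], once the bracket [v] in L is known. *)
Definition mk_pair (t t' : bool) (v : V) : A :=
  if t && t' then 0 else mk (t || t') v.

Lemma mk_pair_linear t t' : linear (mk_pair t t').
Proof.
by move=> a u v; rewrite /mk_pair; case: ifP => _; rewrite ?scaler0 ?addr0 ?linearP.
Qed.

(** Expansion in the basis reduces this to the defining relation between letters; homogeneity gives
    all letters of an expansion the same sign. *)
Lemma mk_bracket t t' a b v w : homogeneous a v -> homogeneous b w ->
  mk t v * mk t' w = (-1) ^+ ((t && t') (+) (a && b)) *: (mk t' w * mk t v)
  + mk_pair t t' (bracket v w).
Proof.
move=> hv hw.
have L1 : linear (fun v => mk_pair t t' (bracket v w)).
  by move=> k x y; rewrite bracket_linearl mk_pair_linear.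
have L2 i : linear (fun w => mk_pair t t' (bracket (e i) w)).
  by move=> k x y; rewrite bracket_linearr mk_pair_linear.
rewrite (mk_linear_lift v L1) /mk -malg_lift_mulr -malg_lift_mull -malg_liftZ -malg_liftD.
apply: eq_malg_lift => i iv.
rewrite (mk_linear_lift w (L2 i)) -malg_lift_mulr -malg_lift_mull -malg_liftZ -malg_liftD.
apply: eq_malg_lift => j jw.
rewrite -!(pres_cat P) !cat1s (pres_swap P) /sgn /cone_sg /parity_sg /=.
rewrite (c_homogeneous hv iv) (c_homogeneous hw jw); congr (_ + _).
rewrite /bracketed /cone_br /mk_pair /=; case: ifP => _; first by rewrite linear0.
by rewrite lift_mark.
Qed.

Lemma homogeneous_ev x : homogeneous false (ev x : V).
Proof. by []. Qed.

Lemma homogeneous_od y : homogeneous true (od y : V).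
Proof. by []. Qed.

Lemma bracket_even_even x x' : bracket (ev x) (ev x') = ev (bracket (ev x) (ev x')).1 :> V.
Proof.
have := @bracket_graded _ L false false _ _ (homogeneous_ev x) (homogeneous_ev x').
by case: (bracket _ _) => u v /= ->.
Qed.

Lemma bracket_even_odd x y : bracket (ev x) (od y) = od (bracket (ev x) (od y)).2 :> V.
Proof.
have := @bracket_graded _ L false true _ _ (homogeneous_ev x) (homogeneous_od y).
by case: (bracket _ _) => u v /= ->.
Qed.

Lemma bracket_odd_odd y y' : bracket (od y) (od y') = ev (bracket (od y) (od y')).1 :> V.
Proof.
have := @bracket_graded _ L true true _ _ (homogeneous_od y) (homogeneous_od y').
by case: (bracket _ _) => u v /= ->.
Qed.

Definition evl (x : even_part L) : A := mk true (ev x).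
Definition odl (y : odd_part L) : A := mk true (od y).

Fact evl_linear : linear evl.
Proof.
move=> a x y; rewrite /evl -linearP; congr (mk true _).
by congr pair; rewrite /= scaler0 addr0.
Qed.
Fact odl_linear : linear odl.
Proof.
move=> a x y; rewrite /odl -linearP; congr (mk true _).
by congr pair; rewrite /= scaler0 addr0.
Qed.

HB.instance Definition _ := GRing.isLinear.Build K (even_part L) A *:%R evl evl_linear.
HB.instance Definition _ := GRing.isLinear.Build K (odd_part L) A *:%R odl odl_linear.

Lemma evl_anti x x' : evl x * evl x' = - (evl x' * evl x).
Proof.
rewrite /evl (mk_bracket true true (homogeneous_ev x) (homogeneous_ev x')).
by rewrite /mk_pair /= expr1 scaleN1r addr0.
Qed.

Lemma odl_comm y y' : odl y * odl y' = odl y' * odl y.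
Proof.
rewrite /odl (mk_bracket true true (homogeneous_od y) (homogeneous_od y')).
by rewrite /mk_pair /= scale1r addr0.
Qed.

Definition evs (xs : seq (even_part L)) : A := \prod_(x <- xs) evl x.
Definition ods (ys : seq (odd_part L)) : A := \prod_(y <- ys) odl y.

Lemma evs_cons x xs : evs (x :: xs) = evl x * evs xs.
Proof. exact: big_cons. Qed.

Lemma ods_cons y ys : ods (y :: ys) = odl y * ods ys.
Proof. exact: big_cons. Qed.

Lemma evs_evl xs x : evs xs * evl x = (-1) ^+ size xs *: (evl x * evs xs).
Proof.
elim: xs => [|x' xs IH]; first by rewrite /evs big_nil mulr1 mul1r scale1r.
rewrite evs_cons -mulrA IH -scalerAr !mulrA (evl_anti x') !mulNr scalerN.
by rewrite exprS -scalerA scaleN1r.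
Qed.

Lemma odl_swap y y' :
  odl y * mk false (od y') = - (mk false (od y') * odl y) + evl (bracket (od y) (od y')).1.
Proof.
rewrite /odl (mk_bracket true false (homogeneous_od y) (homogeneous_od y')).
by rewrite /mk_pair /= expr1 scaleN1r {1}bracket_odd_odd.
Qed.

Lemma odl_evl y x : odl y * evl x = - (evl x * odl y).
Proof.
rewrite /odl (mk_bracket true true (homogeneous_od y) (homogeneous_ev x)).
by rewrite /mk_pair /= expr1 scaleN1r addr0.
Qed.

Lemma evl_swap x x' :
  evl x * mk false (ev x') = mk false (ev x') * evl x + evl (bracket (ev x) (ev x')).1.
Proof.
rewrite /evl (mk_bracket true false (homogeneous_ev x) (homogeneous_ev x')).
by rewrite /mk_pair /= scale1r {1}bracket_even_even.
Qed.

Lemma evl_od x y :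
  evl x * mk false (od y) = mk false (od y) * evl x + odl (bracket (ev x) (od y)).2.
Proof.
rewrite /evl (mk_bracket true false (homogeneous_ev x) (homogeneous_od y)).
by rewrite /mk_pair /= scale1r {1}bracket_even_odd.
Qed.

(** Exchanging y with the letter at index s creates a barred odd letter, and the exponent counts the
    barred even letters to the right of s that it still has to cross. *)
Lemma evs_od xs y : evs xs * mk false (od y) = mk false (od y) * evs xs
  + \sum_(s < size xs) (-1) ^+ (size xs - s.+1) *:
      (evs (omit s xs) * odl (bracket (ev (nth 0 xs s)) (od y)).2).
Proof.
have oe x z : odl z * evs x = (-1) ^+ size x *: (evs x * odl z).
  elim: x => [|x' x IH]; first by rewrite /evs big_nil mulr1 mul1r scale1r.
  rewrite evs_cons mulrA odl_evl mulNr -(mulrA _ (odl z)) IH -scalerAr mulrA.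
  by rewrite exprS -scalerA scaleN1r.
elim: xs => [|x xs IH]; first by rewrite /evs big_nil mulr1 mul1r big_ord0 addr0.
rewrite evs_cons -mulrA IH mulrDr mulrA evl_od mulrDl big_ord_recl /= omit0 subn1 /=.
rewrite oe -!mulrA -addrA; congr (_ + (_ + _)).
rewrite mulr_sumr; apply: eq_bigr => s _.
by rewrite omitS evs_cons -scalerAr !mulrA subSS.
Qed.

Variable d : {linear A -> A}.
Hypothesis d_word : forall w, d (wd w) = word_derivation wd (unmark wd) w.

Lemma d_mk t v a :
  d (mk t v * a) = (if t then mk false v * a else 0) + (-1) ^+ t *: (mk t v * d a).
Proof.
have -> : (if t then mk false v * a else 0) =
    malg_lift (fun i => if t then wd [:: (false, i)] * a else 0) (c v).
  by case: t; rewrite ?malg_lift_mulr // /malg_lift big1 // => i _; rewrite scaler0.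
rewrite {1 2}/mk -!malg_lift_mulr (malg_lift_comp _ _ (linearP d)) -malg_liftZ -malg_liftD.
apply: eq_malg_lift => i _; rewrite (cone_d_cons P d_word) /unmark /degree_sign /=.
by case: t; rewrite // mul0r.
Qed.

Lemma d_evl x a : d (evl x * a) = mk false (ev x) * a - evl x * d a.
Proof. by rewrite /evl d_mk expr1 scaleN1r. Qed.

Lemma d_odl y a : d (odl y * a) = mk false (od y) * a - odl y * d a.
Proof. by rewrite /odl d_mk expr1 scaleN1r. Qed.

Lemma d_evs_mul xs a : d (evs xs * a) = d (evs xs) * a + (-1) ^+ size xs *: (evs xs * d a).
Proof.
elim: xs => [|x xs IH].
  by rewrite /evs big_nil !mul1r (cone_d1 P d_word) mul0r add0r scale1r.
rewrite evs_cons -mulrA !d_evl IH mulrBl mulrDr -!mulrA -scalerAr exprS -scalerA scaleN1r.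
by zmod.
Qed.

(** Every letter that d unbars is carried to the front; the brackets met on the way form the double
    sum. *)
Lemma d_evs xs : d (evs xs) =
  \sum_(s < size xs) (-1) ^+ s *: (mk false (ev (nth 0 xs s)) * evs (omit s xs))
  + \sum_(s < size xs) \sum_(t < size xs | (s < t)%N) (-1) ^+ (s + t) *:
      (evl (bracket (ev (nth 0 xs s)) (ev (nth 0 xs t))).1 * evs (omit s (omit t xs))).
Proof.
elim: xs => [|x xs IH]; first by rewrite /evs big_nil (cone_d1 P d_word) !big_ord0 addr0.
pose F s t : A := (-1) ^+ (s + t) *: (evl (bracket (ev (nth 0 (x :: xs) s))
  (ev (nth 0 (x :: xs) t))).1 * evs (omit s (omit t (x :: xs)))).
rewrite [X in _ = _ + X](sum_pairs_recl _ F) big_ord_recl /= omit0 scale1r.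
rewrite evs_cons d_evl IH mulrDr opprD -!addrA; congr (_ + _).
rewrite [in RHS]addrA; congr (_ + _).
  rewrite mulr_sumr -sumrN -big_split; apply: eq_bigr => s _.
  rewrite /F omitS omit0 evs_cons /= add0n /bump /= add1n !exprS !mulN1r !scaleNr.
  by rewrite -scalerAr (mulrA (evl x)) evl_swap mulrDl -(mulrA _ (evl x)) scalerDr opprD.
rewrite mulr_sumr -sumrN; apply: eq_bigr => s _.
rewrite mulr_sumr -sumrN; apply: eq_bigr => t _.
rewrite /F !omitS evs_cons /= addSn addnS !exprS mulN1r mulN1r opprK.
by rewrite -scalerAr (mulrA (evl x)) evl_anti mulNr scalerN opprK -(mulrA _ (evl x)).
Qed.

(** The Leibniz sign of a barred odd letter cancels the sign of carrying an unbarred odd letter past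
    it, so the single sum has no signs. *)
Lemma d_ods ys : d (ods ys) =
  \sum_(t < size ys) mk false (od (nth 0 ys t)) * ods (omit t ys)
  - \sum_(s < size ys) \sum_(t < size ys | (s < t)%N)
      evl (bracket (od (nth 0 ys s)) (od (nth 0 ys t))).1 * ods (omit s (omit t ys)).
Proof.
elim: ys => [|y ys IH].
  by rewrite /ods big_nil (cone_d1 P d_word) !big_ord0 subr0.
pose F s t : A := evl (bracket (od (nth 0 (y :: ys) s))
  (od (nth 0 (y :: ys) t))).1 * ods (omit s (omit t (y :: ys))).
rewrite [X in _ = _ - X](sum_pairs_recl _ F) big_ord_recl /= omit0.
have E1 : odl y * (\sum_(t < size ys) mk false (od (nth 0 ys t)) * ods (omit t ys)) =
    \sum_(t < size ys) F 0%N t.+1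
    - \sum_(t < size ys) mk false (od (nth 0 ys t)) * ods (omit t.+1 (y :: ys)).
  rewrite mulr_sumr -sumrB; apply: eq_bigr => t _.
  rewrite /F omitS omit0 ods_cons /=.
  by rewrite (mulrA (odl y)) odl_swap mulrDl mulNr -(mulrA _ (odl y)); zmod.
have E2 : odl y * (\sum_(s < size ys) \sum_(t < size ys | (s < t)%N)
      evl (bracket (od (nth 0 ys s)) (od (nth 0 ys t))).1 * ods (omit s (omit t ys))) =
    - \sum_(s < size ys) \sum_(t < size ys | (s < t)%N) F s.+1 t.+1.
  rewrite mulr_sumr -sumrN; apply: eq_bigr => s _.
  rewrite mulr_sumr -sumrN; apply: eq_bigr => t _.
  by rewrite /F !omitS ods_cons /= (mulrA (odl y)) odl_evl mulNr -(mulrA _ (odl y)).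
rewrite ods_cons d_odl IH mulrBr E1 E2.
zmod.
Qed.

(** The mixed brackets arise when an unbarred y is carried past the x's. A barred even letter
    [y_s, y_t] also crosses all the x's, with a sign that cancels the Leibniz sign of the block of
    x's. *)
Lemma d_evs_ods xs ys : d (evs xs * ods ys) =
  \sum_(s < size xs) \sum_(t < size xs | (s < t)%N) (-1) ^+ (s.+1 + t.+1) *:
    (evs ((bracket (ev (nth 0 xs s)) (ev (nth 0 xs t))).1 :: omit s (omit t xs)) * ods ys)
  + \sum_(s < size xs) \sum_(t < size ys) (-1) ^+ s.+1 *:
    (evs (omit s xs) * ods ((bracket (ev (nth 0 xs s)) (od (nth 0 ys t))).2 :: omit t ys))
  - \sum_(s < size ys) \sum_(t < size ys | (s < t)%N)
    (evs ((bracket (od (nth 0 ys s)) (od (nth 0 ys t))).1 :: xs) * ods (omit s (omit t ys)))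
  + \sum_(s < size xs) (-1) ^+ s.+2 *:
    (mk false (ev (nth 0 xs s)) * (evs (omit s xs) * ods ys))
  + (-1) ^+ size xs *: \sum_(t < size ys)
    mk false (od (nth 0 ys t)) * (evs xs * ods (omit t ys)).
Proof.
rewrite d_evs_mul d_evs d_ods mulrDl mulrBr scalerBr.
have -> : (\sum_(s < size xs) (-1) ^+ s *:
      (mk false (ev (nth 0 xs s)) * evs (omit s xs))) * ods ys =
    \sum_(s < size xs) (-1) ^+ s.+2 *:
      (mk false (ev (nth 0 xs s)) * (evs (omit s xs) * ods ys)).
  rewrite mulr_suml; apply: eq_bigr => s _.
  by rewrite !exprS !mulN1r opprK -scalerAl mulrA.
have -> : (\sum_(s < size xs) \sum_(t < size xs | (s < t)%N) (-1) ^+ (s + t) *: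
      (evl (bracket (ev (nth 0 xs s)) (ev (nth 0 xs t))).1 * evs (omit s (omit t xs)))) * ods ys =
    \sum_(s < size xs) \sum_(t < size xs | (s < t)%N) (-1) ^+ (s.+1 + t.+1) *:
    (evs ((bracket (ev (nth 0 xs s)) (ev (nth 0 xs t))).1 :: omit s (omit t xs)) * ods ys).
  rewrite mulr_suml; apply: eq_bigr => s _; rewrite mulr_suml; apply: eq_bigr => t _.
  by rewrite addSn addnS !exprS !mulN1r opprK -scalerAl evs_cons.
have -> : (-1) ^+ size xs *: (evs xs * \sum_(s < size ys) \sum_(t < size ys | (s < t)%N)
      evl (bracket (od (nth 0 ys s)) (od (nth 0 ys t))).1 * ods (omit s (omit t ys))) =
    \sum_(s < size ys) \sum_(t < size ys | (s < t)%N)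
    (evs ((bracket (od (nth 0 ys s)) (od (nth 0 ys t))).1 :: xs) * ods (omit s (omit t ys))).
  rewrite mulr_sumr scaler_sumr; apply: eq_bigr => s _.
  rewrite mulr_sumr scaler_sumr; apply: eq_bigr => t _.
  rewrite mulrA evs_evl -scalerAl scalerA -exprD addnn -signr_odd odd_double.
  by rewrite scale1r evs_cons.
have -> : (-1) ^+ size xs *: (evs xs * \sum_(t < size ys)
      mk false (od (nth 0 ys t)) * ods (omit t ys)) =
    (-1) ^+ size xs *: (\sum_(t < size ys) mk false (od (nth 0 ys t)) * (evs xs * ods (omit t ys)))
    + \sum_(s < size xs) \sum_(t < size ys) (-1) ^+ s.+1 *:
    (evs (omit s xs) * ods ((bracket (ev (nth 0 xs s)) (od (nth 0 ys t))).2 :: omit t ys)).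
  rewrite exchange_big /= mulr_sumr !scaler_sumr -big_split; apply: eq_bigr => t _ /=.
  rewrite mulrA evs_od mulrDl scalerDr -mulrA; congr (_ + _).
  rewrite mulr_suml scaler_sumr; apply: eq_bigr => s _.
  rewrite -scalerAl scalerA -exprD -mulrA -ods_cons; congr (_ *: _).
  by rewrite -signr_odd -[RHS]signr_odd; congr (_ ^+ nat_of_bool _); have := ltn_ord s; lia.
zmod.
Qed.

End ConeOfSuperalgebra.

(** * Transfer to the chain complex *)

(** Entries are replaced by basis vectors from the left; the prefix already replaced is generalized
    in the induction. *)
Lemma multilinear_ext (K : fieldType) (V W : lmodType K) (J : choiceType) (b : J -> V)
    (co : V -> {malg K[J]}) (good : pred J) (T : seq V -> W) :
  (forall v, malg_lift b (co v) = v) ->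
  (forall v j, j \in msupp (co v) -> good j) ->
  (forall s t, linear (fun x => T (s ++ x :: t))) ->
  (forall s, all good s -> T (map b s) = 0) -> forall xs, T xs = 0.
Proof.
move=> bco gco TL T0 xs; suff h s : all good s -> T (map b s ++ xs) = 0 by exact: (h [::]).
elim: xs s => [|x xs IH] s gs; first by rewrite cats0 T0.
rewrite -(bco x) (malg_lift_comp _ _ (TL (map b s) xs)) /malg_lift big_seq big1 // => j jx.
by rewrite -cat_rcons -map_rcons IH ?scaler0 // all_rcons (gco _ _ jx).
Qed.

(** * The order of the letters *)

Section LetterOrder.
Variables (I : choiceType) (par : pred I) (le0 : rel (bool * I)).
Hypotheses (le0_refl : reflexive le0) (le0_anti : antisymmetric le0).
Hypotheses (le0_total : total le0) (le0_trans : transitive le0).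

(* Sorting by rank puts the unbarred letters before the barred even ones, and these
   before the barred odd ones. *)
Definition rank (x : bool * I) : nat := if x.1 then (par x.2).+1 else 0%N.

Definition letter_le : rel (bool * I) :=
  fun x y => (rank x < rank y)%N || ((rank x == rank y) && le0 x y).

Lemma letter_le_refl : reflexive letter_le.
Proof. by move=> x; rewrite /letter_le eqxx le0_refl orbT. Qed.

Lemma letter_le_anti : antisymmetric letter_le.
Proof.
move=> x y; rewrite /letter_le; case: ltngtP => //= _; exact: le0_anti.
Qed.

Lemma letter_le_total : total letter_le.
Proof. by move=> x y; rewrite /letter_le; case: ltngtP => //= _; exact: le0_total. Qed.

Lemma letter_le_trans : transitive letter_le.
Proof.
move=> y x z /orP[lt|/andP[/eqP e le1]] /orP[lt'|/andP[/eqP e' le2]]; rewrite /letter_le.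
- by rewrite (ltn_trans lt lt').
- by rewrite -e' lt.
- by rewrite e lt'.
- by rewrite e e' eqxx (le0_trans le1 le2) orbT.
Qed.

Definition part (r : nat) (w : seq (bool * I)) : seq I := [seq x.2 | x <- w & rank x == r].

Lemma part_cat r a b : part r (a ++ b) = part r a ++ part r b.
Proof. by rewrite /part filter_cat map_cat. Qed.

Lemma part_cons r x w : part r (x :: w) = if rank x == r then x.2 :: part r w else part r w.
Proof. by rewrite /part /=; case: ifP. Qed.

Lemma part_map r (t : bool) s : (forall i, i \in s -> rank (t, i) = r) ->
  part r (map (pair t) s) = s.
Proof.
elim: s => [//|i s IH] h; rewrite /= part_cons h ?mem_head // eqxx IH // => j js.
by apply: h; rewrite inE js orbT.
Qed.

Lemma part_map_out r (t : bool) s : (forall i, i \in s -> rank (t, i) != r) ->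
  part r (map (pair t) s) = [::].
Proof.
elim: s => [//|i s IH] h; rewrite /= part_cons (negPf (h i _)) ?mem_head // IH // => j js.
by apply: h; rewrite inE js orbT.
Qed.

(** Weaker than [normal_word]: the three blocks come in the right order but may be unsorted
    inside. *)
Definition shaped (w : seq (bool * I)) : bool := sorted leq (map rank w).

Lemma part_all r s w : all (leq s) (map rank w) -> (r < s)%N -> part r w = [::].
Proof.
elim: w => [//|x w IH] /= /andP[lx aw] lt; rewrite part_cons IH //.
by case: eqP => // e; lia.
Qed.

Lemma shaped_split w : shaped w ->
  w = map (pair false) (part 0 w) ++ map (pair true) (part 1 w) ++ map (pair true) (part 2 w).
Proof.
elim: w => [//|x w IH]; rewrite /shaped /= => pw.
have ax : all (leq (rank x)) (map rank w).
  by move: pw; rewrite (path_sortedE leq_trans) => /andP[].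
have {IH} := IH (path_sorted pw); rewrite !part_cons.
case: x pw ax => [t i] _ ax; case: (eqVneq t false) ax => [-> ax|]; first by move=> {1}->.
rewrite eqbF_neg negbK => -> /=; rewrite {1 2 3 4}/rank /=.
case: (par i) => /= ax.
  by rewrite (part_all ax) // (part_all ax) // => {1}->.
by rewrite (part_all ax) // => {1}->.
Qed.

Lemma normal_shaped (sg : rel (bool * I)) w : normal_word letter_le sg w -> shaped w.
Proof.
rewrite /shaped sorted_map; apply: sub_sorted => x y /andP[+ _].
by rewrite /letter_le => /orP[/ltnW|/andP[/eqP e _]] //=; rewrite /= e.
Qed.

End LetterOrder.

(** * The projections of the cone algebra onto the chain spaces *)

Section Projection.
Variables (K : fieldType) (L : lieSuper K).
Hypothesis char0 : forall n, n.+1%:R != 0 :> K.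
Variables (I : choiceType) (par : pred I) (e : I -> total_space L).
Variable c : {linear total_space L -> {malg K[I]}}.
Hypothesis ce : forall i, c (e i) = << i >>.
Hypothesis ec : forall v, malg_lift e (c v) = v.
Hypothesis e_homogeneous : forall i, homogeneous (par i) (e i).
Hypothesis c_homogeneous : forall a v k, homogeneous a v -> k \in msupp (c v) -> par k = a.
Variable le0 : rel (bool * I).
Hypotheses (le0_refl : reflexive le0) (le0_anti : antisymmetric le0).
Hypotheses (le0_total : total le0) (le0_trans : transitive le0).

Local Notation V := (total_space L).
Local Notation V0 := (even_part L).
Local Notation V1 := (odd_part L).
Local Notation sg := (parity_sg par).
Local Notation br := (structure_constants e c).
Local Notation le := (letter_le par le0).

Variables (A : algType K) (wd : seq (bool * I) -> A).
Hypothesis P : presentation (cone_sg sg) (cone_br br) wd.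

Variables (U : algType K) (uin : {linear V -> U}).
Hypothesis U_ind : forall Q : U -> Prop, Q 0 ->
  (forall k u v, Q u -> Q v -> Q (k *: u + v)) ->
  (forall s, Q (\prod_(x <- s) uin x)) -> forall u, Q u.
Hypothesis U_bracket : forall a b x y, homogeneous a x -> homogeneous b y ->
  uin x * uin y = (-1) ^+ (a && b) *: (uin y * uin x) + uin (bracket x y).
Variable phi : {linear U -> A}.
Hypothesis phi1 : phi 1 = 1.
Hypothesis phiM : forall u v, phi (u * v) = phi u * phi v.
Hypothesis phi_in : forall v, phi (uin v) = mk c wd false v.

Variables (M : nat -> lmodType K) (g : forall k, U -> seq V0 -> seq V1 -> M k).
Hypothesis g_u : forall k xs ys, linear (fun u => g k u xs ys).
Hypothesis g_x : forall k u (a b : seq V0) (ys : seq V1) l x y,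
  (size a + size b + size ys)%N.+1 = k ->
  g k u (a ++ (l *: x + y) :: b) ys = l *: g k u (a ++ x :: b) ys + g k u (a ++ y :: b) ys.
Hypothesis g_y : forall k u (xs : seq V0) (a b : seq V1) l x y,
  (size xs + size a + size b)%N.+1 = k ->
  g k u xs (a ++ (l *: x + y) :: b) = l *: g k u xs (a ++ x :: b) + g k u xs (a ++ y :: b).
Hypothesis g_swap_x : forall k u (a : seq V0) x y (b : seq V0) (ys : seq V1),
  (size a + size b + size ys)%N.+2 = k ->
  g k u (a ++ x :: y :: b) ys = - g k u (a ++ y :: x :: b) ys.
Hypothesis g_swap_y : forall k u (xs : seq V0) (a : seq V1) x y (b : seq V1),
  (size xs + size a + size b)%N.+2 = k ->
  g k u xs (a ++ x :: y :: b) = g k u xs (a ++ y :: x :: b).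
Hypothesis g_ind : forall k (Q : M k -> Prop), Q 0 ->
  (forall m n, Q m -> Q n -> Q (m + n)) ->
  (forall u xs ys, (size xs + size ys)%N = k -> Q (g k u xs ys)) -> forall m, Q m.

Local Notation evs := (evs c wd).
Local Notation ods := (ods c wd).

(* Unlike [g], [gz] is linear, alternating and symmetric without conditions on the
   sizes. *)
Definition gz k u xs ys : M k := if (size xs + size ys == k)%N then g k u xs ys else 0.

Lemma gz_u k xs ys : linear (fun u => gz k u xs ys).
Proof.
by move=> a u v; rewrite /gz; case: ifP => _; rewrite ?g_u ?scaler0 ?addr0.
Qed.

Lemma gz_x k u a b ys : linear (fun x => gz k u (a ++ x :: b) ys).
Proof.
move=> l x y; rewrite /gz !size_cat /= !addnS !addSn.
by case: eqP => [sz|_]; rewrite ?g_x ?scaler0 ?addr0.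
Qed.

Lemma gz_y k u xs a b : linear (fun x => gz k u xs (a ++ x :: b)).
Proof.
move=> l x y; rewrite /gz !size_cat /= !addnS !addnA.
by case: eqP => [sz|_]; rewrite ?g_y ?scaler0 ?addr0.
Qed.

Lemma gz_swap_x k u a x y b ys :
  gz k u (a ++ x :: y :: b) ys = - gz k u (a ++ y :: x :: b) ys.
Proof.
rewrite /gz !size_cat /= !addnS !addSn.
by case: eqP => [sz|_]; rewrite ?oppr0 // g_swap_x.
Qed.

Lemma gz_swap_y k u xs a x y b :
  gz k u xs (a ++ x :: y :: b) = gz k u xs (a ++ y :: x :: b).
Proof.
rewrite /gz !size_cat /= !addnS !addnA.
by case: eqP => [sz|_] //; rewrite g_swap_y.
Qed.

Definition u_of (s : seq I) : U := \prod_(i <- s) uin (e i).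
Definition x_of (s : seq I) : seq V0 := [seq (e i).1 | i <- s].
Definition y_of (s : seq I) : seq V1 := [seq (e i).2 | i <- s].

(** The value prescribed on normal words for the projection onto M_k; through [gz] it is 0 unless
    the word has exactly k barred letters. *)
Definition word_gen k (w : seq (bool * I)) : M k :=
  gz k (u_of (part par 0 w)) (x_of (part par 1 w)) (y_of (part par 2 w)).

Lemma u_of_cat s t : u_of (s ++ t) = u_of s * u_of t.
Proof. exact: big_cat. Qed.

Lemma u_of_cons i s : u_of (i :: s) = uin (e i) * u_of s.
Proof. exact: big_cons. Qed.

(** Inside the three blocks the relations of the cone are those of U, of the exterior power and of
    the symmetric power. Across blocks nothing is claimed. *)
Lemma word_gen_straightens k a x y b : rank par x = rank par y ->
  word_gen k (a ++ x :: y :: b) =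
  sgn K (cone_sg sg) x y *: word_gen k (a ++ y :: x :: b)
  + bracketed (word_gen k) a (cone_br br x y) b.
Proof.
rewrite /word_gen !part_cat !part_cons => rxy; rewrite -!rxy.
case: x y rxy => [[] i] [[] j] // rxy.
  have {}rxy : par i = par j by move: rxy; rewrite /rank /=; do 2! case: par.
  rewrite /cone_br /= /bracketed linear0 addr0 /sgn /cone_sg /parity_sg /rank /= -rxy andbb.
  case: (par i) => /=; rewrite ?expr0 ?expr1 ?scale1r ?scaleN1r /x_of /y_of !map_cat /=.
    exact: gz_swap_y.
  exact: gz_swap_x.
rewrite /cone_br /= /bracketed lift_mark /sgn /cone_sg /parity_sg /rank /=.
set X := x_of _; set Y := y_of _.
rewrite !u_of_cat !u_of_cons !mulrA -[_ * uin (e i) * _]mulrA.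
rewrite -[_ * uin (e j) * uin (e i)]mulrA.
rewrite (U_bracket (e_homogeneous i) (e_homogeneous j)).
have GL : linear (fun u => gz k (u_of (part par 0 a) * u * u_of (part par 0 b)) X Y).
  by move=> l u v; rewrite mulrDr mulrDl -scalerAr -scalerAl gz_u.
rewrite (GL _ (uin (e j) * uin (e i))); congr (_ + _).
have UL : linear (fun v => gz k (u_of (part par 0 a) * uin v * u_of (part par 0 b)) X Y).
  by move=> l u v; rewrite linearP GL.
rewrite (mk_linear_lift ec _ UL); apply: eq_malg_lift => l _.
by rewrite !part_cat !part_cons /rank /= u_of_cat u_of_cons mulrA.
Qed.

Lemma double_eq (W : lmodType K) (p q : W) : p + p = q + q -> p = q.
Proof. exact: (double_inj (char0 1)). Qed.

Section Project.
Variables (k : nat) (p : {linear A -> M k}).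
Hypothesis p_normal : forall w, normal_word le (cone_sg sg) w -> p (wd w) = word_gen k w.

(** Straightening a shaped word exchanges letters of equal rank only, and both the swapped and the
    bracketed words are again shaped, so the formula spreads from normal words by the relations
    inside the blocks. *)
Lemma p_shaped w : shaped par w -> p (wd w) = word_gen k w.
Proof.
pattern w; apply: (@normal_word_ind K _ le (cone_sg sg) (cone_br br)).
- exact: letter_le_refl.
- exact: letter_le_total.
- by move=> {}w nw _; exact: p_normal.
move=> a x y b nxy eq_xy IHs IHb sw.
have le_rank : (rank par x <= rank par y)%N.
  have sub : subseq [:: rank par x; rank par y] (map (rank par) (a ++ x :: y :: b)).
    rewrite map_cat; apply: subseq_trans (suffix_subseq _ _).
    exact: (prefix_subseq [:: rank par x; rank par y]).
  by have /= := subseq_sorted leq_trans sub sw; rewrite andbT.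
have rxy : rank par x = rank par y.
  have [->//|nexy] := eqVneq x y.
  by move: (nordered_pair nxy nexy); rewrite /letter_le negb_or -leqNgt; lia.
have pb : p (bracketed wd a (cone_br br x y) b) = bracketed (word_gen k) a (cone_br br x y) b.
  rewrite /bracketed (malg_lift_comp _ _ (linearP p)); apply: eq_malg_lift => l lxy.
  apply: IHb => //; apply: (subseq_sorted leq_trans) sw.
  rewrite !map_cat; apply: cat_subseq => //; rewrite !map_cons.
  have -> : rank par l = rank par x.
    move: lxy rxy; rewrite /cone_br; case: ifP => [_|exy]; first by rewrite msupp0.
    move=> /mark_supp[l1 _]; move: exy l1; rewrite /rank.
    by case: x.1; case: y.1 => //= _ ->.
  rewrite -[X in subseq X _]cat1s -[X in subseq _ X]cat1s.
  by apply: cat_subseq => //; exact: subseq_cons.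
have pxy : p (wd (a ++ x :: y :: b)) = sgn K (cone_sg sg) x y *: p (wd (a ++ y :: x :: b))
    + bracketed (word_gen k) a (cone_br br x y) b.
  by rewrite (pres_straightens P) linearD linearZ /= pb.
have [exy|nexy] := eqVneq x y; last first.
  rewrite pxy (word_gen_straightens k a b rxy) IHs //.
  by move: sw; rewrite /shaped !map_cat /= rxy.
subst y; have sxx : sgn K (cone_sg sg) x x = -1 by rewrite /sgn eq_xy.
move: pxy (word_gen_straightens k a b rxy); rewrite sxx !scaleN1r.
set s := p _; set t := word_gen _ _; set z := bracketed _ _ _ _ => e1 e2.
apply: double_eq.
by apply: (zmod_from (eq_addr e1 (esym e2))); zmod.
Qed.

(** Products of arbitrary vectors are expanded in the basis. The auxiliary [R] is the span of these
    monomials, and the point is that left multiplication by a basis vector preserves it. *)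
Lemma U_span (Q : U -> Prop) : Q 0 ->
  (forall l u v, Q u -> Q v -> Q (l *: u + v)) -> (forall s, Q (u_of s)) -> forall u, Q u.
Proof.
pose R (u : U) := forall Q : U -> Prop, Q 0 ->
  (forall l u v, Q u -> Q v -> Q (l *: u + v)) -> (forall s, Q (u_of s)) -> Q u.
suff h u : R u by move=> Q0 QD QS u; apply: h.
have R0 : R 0 by move=> Q' Q0.
have RD l u1 v1 : R u1 -> R v1 -> R (l *: u1 + v1).
  by move=> hu hv Q' Q0 QD QS; exact: (QD _ _ _ (hu Q' Q0 QD QS) (hv Q' Q0 QD QS)).
have RM i v : R v -> R (uin (e i) * v).
  move=> hv Q' Q0 QD QS; apply: (hv (fun v => Q' (uin (e i) * v))).
  - by rewrite mulr0.
  - by move=> l u1 v1 h1 h2; rewrite mulrDr -scalerAr; apply: QD.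
  by move=> s; rewrite -u_of_cons.
move: u; apply: U_ind => // s; elim: s => [|v s IH].
  by rewrite big_nil => Q' _ _ QS; have := QS [::]; rewrite /u_of big_nil.
rewrite big_cons (mk_linear_lift ec v (linearP uin)) -malg_lift_mulr /malg_lift.
apply: big_ind => // [u1 v1 h1 h2|i _]; first by rewrite -[u1]scale1r; apply: RD.
by rewrite -[_ *: _]addr0; apply: RD => //; apply: RM.
Qed.

Lemma ev_e i : ~~ par i -> ev (e i).1 = e i :> V.
Proof.
by move=> /negPf ne; have := e_homogeneous i; rewrite ne; case: (e i) => u v /= ->.
Qed.

Lemma od_e i : par i -> od (e i).2 = e i :> V.
Proof. by move=> ne; have := e_homogeneous i; rewrite ne; case: (e i) => u v /= ->. Qed.

Lemma phi_u_of s : phi (u_of s) = wd (map (pair false) s).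
Proof.
elim: s => [|i s IH]; first by rewrite /u_of big_nil phi1 (pres_nil P).
by rewrite u_of_cons phiM phi_in mk_e //= IH -(pres_cons P).
Qed.

Lemma evs_x_of s : all (fun i => ~~ par i) s -> evs (x_of s) = wd (map (pair true) s).
Proof.
elim: s => [_|i s IH /= /andP[ni ns]]; first by rewrite /evs big_nil (pres_nil P).
by rewrite evs_cons IH // /evl ev_e // mk_e // -(pres_cons P).
Qed.

Lemma ods_y_of s : all par s -> ods (y_of s) = wd (map (pair true) s).
Proof.
elim: s => [_|i s IH /= /andP[ni ns]]; first by rewrite /ods big_nil (pres_nil P).
by rewrite ods_cons IH // /odl od_e // mk_e // -(pres_cons P).
Qed.

Lemma shaped_blocks s xs ys : all (fun i => ~~ par i) xs -> all par ys ->
  shaped par (map (pair false) s ++ map (pair true) xs ++ map (pair true) ys).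
Proof.
move=> ax ay; rewrite /shaped !map_cat -!map_comp.
have -> : map (rank par \o pair false) s = nseq (size s) 0%N by elim: s => //= i s ->.
have -> : map (rank par \o pair true) xs = nseq (size xs) 1%N.
  elim: xs ax => [//|i xs IH] /= /andP[ni /IH->].
  by rewrite {1}/rank /= (negPf ni).
have -> : map (rank par \o pair true) ys = nseq (size ys) 2%N.
  elim: ys ay => [//|i ys IH] /= /andP[ni /IH->].
  by rewrite {1}/rank /= ni.
rewrite (sorted_pairwise leq_trans) !pairwise_cat.
have pn n m : pairwise leq (nseq n m).
  by elim: n => [//|n IH]; rewrite /= IH andbT all_nseq leqnn orbT.
have al n m n' m' : (m <= m')%N -> allrel leq (nseq n m) (nseq n' m').
  by move=> le_m; apply/allrelP => x y /nseqP[-> _] /nseqP[-> _].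
by rewrite allrel_catr !pn !al.
Qed.

Lemma word_gen_blocks s xs ys : all (fun i => ~~ par i) xs -> all par ys ->
  word_gen k (map (pair false) s ++ map (pair true) xs ++ map (pair true) ys) =
  gz k (u_of s) (x_of xs) (y_of ys).
Proof.
move=> /allP ax /allP ay; rewrite /word_gen !part_cat.
have rx i : i \in xs -> rank par (true, i) = 1%N.
  by move=> /ax ni; rewrite /rank /= (negPf ni).
have ry i : i \in ys -> rank par (true, i) = 2%N.
  by move=> /ay ni; rewrite /rank /= ni.
rewrite (@part_map _ _ 0 false) // !(@part_map_out _ _ _ false) //.
rewrite (@part_map _ _ 1 true xs) // (@part_map _ _ 2 true ys) //.
rewrite !(@part_map_out _ _ _ true) ?cats0 ?cat0s //.
all: by move=> i ii; rewrite ?(rx i ii) ?(ry i ii).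
Qed.

(** Both sides are linear in u and in every entry of xs and ys, so all vectors may be taken from the
    basis; the product is then a shaped word. *)
Lemma p_gen u xs ys : p (phi u * (evs xs * ods ys)) = gz k u xs ys.
Proof.
apply/eqP; rewrite -subr_eq0; apply/eqP; move: u.
have lin (W : lmodType K) (f : {linear W -> A}) (q r : A) l x y :
    p (q * f (l *: x + y) * r) = l *: p (q * f x * r) + p (q * f y * r).
  by rewrite linearP mulrDr mulrDl -scalerAr -scalerAl linearP.
have lx (u : U) ys' a b : linear (fun x => p (phi u * (evs (a ++ x :: b) * ods ys'))
    - gz k u (a ++ x :: b) ys').
  have ex x : phi u * (evs (a ++ x :: b) * ods ys')
      = phi u * evs a * evl c wd x * (evs b * ods ys').
    by rewrite /evs big_cat big_cons /= !mulrA.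
  by move=> l x y; rewrite gz_x !ex lin scalerBr; zmod.
have ly (u : U) xs' a b : linear (fun y => p (phi u * (evs xs' * ods (a ++ y :: b)))
    - gz k u xs' (a ++ y :: b)).
  have ex x : phi u * (evs xs' * ods (a ++ x :: b))
      = phi u * (evs xs' * ods a) * odl c wd x * ods b.
    by rewrite /ods big_cat big_cons /= !mulrA.
  by move=> l x y; rewrite gz_y !ex lin scalerBr; zmod.
apply: U_span => [|l u v hu hv|s].
- by rewrite linear0 mul0r linear0 (linear_zero (gz_u k xs ys)) subr0.
- rewrite gz_u linearP mulrDl -scalerAl linearP.
  rewrite (_ : _ - _ = l *: (p (phi u * (evs xs * ods ys)) - gz k u xs ys) +
    (p (phi v * (evs xs * ods ys)) - gz k v xs ys)); first by rewrite hu hv scaler0 addr0.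
  by rewrite scalerBr; zmod.
pose b0 (i : I) : V0 := (e i).1; pose b1 (i : I) : V1 := (e i).2.
have b0c v : malg_lift b0 (c (ev v)) = v.
  have f0 : linear (fun w : V => w.1) by [].
  by rewrite -(mk_linear_lift ec (ev v) f0).
have b1c v : malg_lift b1 (c (od v)) = v.
  have f0 : linear (fun w : V => w.2) by [].
  by rewrite -(mk_linear_lift ec (od v) f0).
have g0 v j : j \in msupp (c (ev v)) -> ~~ par j.
  by move=> /(c_homogeneous (homogeneous_ev v)) ->.
have g1 v j : j \in msupp (c (od v)) -> par j.
  by move=> /(c_homogeneous (homogeneous_od v)) ->.
move: xs; apply: (multilinear_ext b0c g0) => [a b|xs ax]; first exact: lx.
move: ys; apply: (multilinear_ext b1c g1) => [a b|ys ay]; first exact: ly.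
rewrite phi_u_of evs_x_of // ods_y_of // -!(pres_cat P) p_shaped ?shaped_blocks //.
by rewrite word_gen_blocks // subrr.
Qed.

End Project.

(** The spanning half of the Poincare-Birkhoff-Witt theorem, phrased for maps out of A. *)
Lemma normal_ext (W : lmodType K) (f1 f2 : {linear A -> W}) :
  (forall w, normal_word le (cone_sg sg) w -> f1 (wd w) = f2 (wd w)) -> f1 =1 f2.
Proof.
move=> fn; suff h w : f1 (wd w) = f2 (wd w).
  apply: (pres_ind P) => // [|l u v hu hv]; first by rewrite !linear0.
  by rewrite !linearP hu hv.
pattern w; apply: (@normal_word_ind K _ le (cone_sg sg) (cone_br br)) => //.
- exact: letter_le_refl.
- exact: letter_le_total.
move=> a x y b _ eq_xy IHs IHb.
have fb : f1 (bracketed wd a (cone_br br x y) b) = f2 (bracketed wd a (cone_br br x y) b).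
  rewrite /bracketed (malg_lift_comp _ _ (linearP f1)) (malg_lift_comp _ _ (linearP f2)).
  exact: eq_malg_lift.
have fxy (f : {linear A -> W}) : f (wd (a ++ x :: y :: b)) =
    sgn K (cone_sg sg) x y *: f (wd (a ++ y :: x :: b)) + f (bracketed wd a (cone_br br x y) b).
  by rewrite (pres_straightens P) linearP.
have [exy|nexy] := eqVneq x y; last by rewrite !fxy fb IHs.
subst y; have sxx : sgn K (cone_sg sg) x x = -1 by rewrite /sgn eq_xy.
move: (fxy f1) (fxy f2); rewrite sxx !scaleN1r fb => e1 e2.
apply: double_eq.
by apply: (zmod_from (eq_addr e1 (esym e2))); zmod.
Qed.

Lemma all_part r w (q : pred I) : (forall j, rank par (true, j) == r -> q j) -> (0 < r)%N ->
  all q (part par r w).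
Proof.
move=> rq r0; apply/allP => j /mapP[[t j'] + ->]; rewrite mem_filter => /andP[/= h _].
by apply: rq; case: t h => //; rewrite /rank /= => /eqP e0; rewrite -e0 in r0.
Qed.

(** Places every normal word in the image of some M_k; together with [normal_ext], identities of
    linear maps on A can be checked on these images. *)
Lemma normal_wordE w : normal_word le (cone_sg sg) w -> wd w =
  phi (u_of (part par 0 w)) * (evs (x_of (part par 1 w)) * ods (y_of (part par 2 w))).
Proof.
move=> /normal_shaped /shaped_split {1}->; rewrite phi_u_of evs_x_of ?ods_y_of -?(pres_cat P) //.
  by apply: all_part => // j; rewrite /rank /=; case: (par j).
by apply: all_part => // j; rewrite /rank /=; case: (par j).
Qed.

(** * The chain complex inside the cone algebra *)

Section Resolution.
Variable d : {linear A -> A}.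
Hypothesis d_word : forall w, d (wd w) = word_derivation wd (unmark wd) w.
Variable p : forall k, {linear A -> M k}.
Hypothesis p_normal : forall k w, normal_word le (cone_sg sg) w -> p k (wd w) = word_gen k w.
Variable i : forall k, {linear M k -> A}.
Hypothesis i_gen : forall k u xs ys, (size xs + size ys)%N = k ->
  i k (g k u xs ys) = phi u * (evs xs * ods ys).

Definition chain_boundary k (u : U) (xs : seq V0) (ys : seq V1) : M k :=
  \sum_(s < size xs) \sum_(t < size xs | (s < t)%N) (-1) ^+ (s.+1 + t.+1) *:
     g k u ((bracket (ev (nth 0 xs s)) (ev (nth 0 xs t))).1 :: omit s (omit t xs)) ys
  + \sum_(s < size xs) \sum_(t < size ys) (-1) ^+ s.+1 *:
     g k u (omit s xs) ((bracket (ev (nth 0 xs s)) (od (nth 0 ys t))).2 :: omit t ys)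
  - \sum_(s < size ys) \sum_(t < size ys | (s < t)%N)
     g k u ((bracket (od (nth 0 ys s)) (od (nth 0 ys t))).1 :: xs) (omit s (omit t ys))
  + \sum_(s < size xs) (-1) ^+ s.+2 *: g k (u * uin (ev (nth 0 xs s))) (omit s xs) ys
  + (-1) ^+ size xs *: \sum_(t < size ys) g k (u * uin (od (nth 0 ys t))) xs (omit t ys).

Lemma size_omit (T : Type) s (xs : seq T) : (s < size xs)%N -> size (omit s xs) = (size xs).-1.
Proof. by move=> lt; rewrite /omit size_cat size_take size_drop lt; lia. Qed.

Lemma size_omit2 (T : Type) s t (xs : seq T) : (s < t)%N -> (t < size xs)%N ->
  size (omit s (omit t xs)) = (size xs).-2.
Proof. by move=> st lt; rewrite size_omit size_omit //; lia. Qed.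

(** The image of [phi] is generated by unbarred letters, which d kills and which contribute no
    sign. *)
Lemma d_phi u a : d (phi u * a) = phi u * d a.
Proof.
move: u; apply: U_ind => [|l u v hu hv|s].
- by rewrite linear0 !mul0r linear0.
- by rewrite linearP !mulrDl -!scalerAl linearP hu hv.
elim: s a => [|v s IH] a; first by rewrite big_nil phi1 !mul1r.
by rewrite big_cons phiM phi_in -!mulrA (d_mk P d_word) IH add0r scale1r.
Qed.

Lemma i_boundary k u xs ys : (size xs + size ys)%N = k.+1 ->
  i k (chain_boundary k u xs ys) = d (phi u * (evs xs * ods ys)).
Proof.
move=> sz; rewrite d_phi (d_evs_ods ec c_homogeneous P d_word) /chain_boundary.
rewrite !(mulrDr, mulrN) !linearD linearN /=.
congr (_ + _ - _ + _ + _).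
- rewrite linear_sum mulr_sumr; apply: eq_bigr => s _.
  rewrite linear_sum mulr_sumr; apply: eq_bigr => t st.
  by rewrite linearZ /= i_gen ?scalerAr //= size_omit2 //; have := ltn_ord t; lia.
- rewrite linear_sum mulr_sumr; apply: eq_bigr => s _.
  rewrite linear_sum mulr_sumr; apply: eq_bigr => t _.
  rewrite linearZ /= i_gen ?scalerAr //= !size_omit //.
  by have := ltn_ord t; have := ltn_ord s; lia.
- rewrite linear_sum mulr_sumr; apply: eq_bigr => s _.
  rewrite linear_sum mulr_sumr; apply: eq_bigr => t st.
  by rewrite i_gen //= size_omit2 //; have := ltn_ord t; lia.
- rewrite linear_sum mulr_sumr; apply: eq_bigr => s _.
  rewrite linearZ /= i_gen ?phiM ?phi_in -?scalerAr -?mulrA // size_omit //.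
  by have := ltn_ord s; lia.
rewrite linearZ /= -scalerAr; congr (_ *: _).
rewrite linear_sum mulr_sumr; apply: eq_bigr => t _.
rewrite i_gen ?phiM ?phi_in -?mulrA // size_omit //.
by have := ltn_ord t; lia.
Qed.

Lemma p_i k m : p k (i k m) = m.
Proof.
move: m; apply: g_ind => [|m n hm hn|u xs ys sz]; first by rewrite !linear0.
  by rewrite !linearD /= hm hn.
by rewrite i_gen // (p_gen (p_normal k)) /gz sz eqxx.
Qed.

Lemma p_i_neq k j m : j != k -> p k (i j m) = 0.
Proof.
move=> ne; move: m; apply: g_ind => [|m n hm hn|u xs ys sz]; first by rewrite !linear0.
  by rewrite !linearD /= hm hn addr0.
by rewrite i_gen // (p_gen (p_normal k)) /gz sz (negPf ne).
Qed.

(** Passing through A, where d is already defined, makes well-definedness and linearity automatic;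
    that the boundary formula holds is proved afterwards. *)
Definition chain_d k : M k.+1 -> M k := p k \o d \o i k.+1.

HB.instance Definition _ k := GRing.Linear.on (@chain_d k).

Lemma chain_d_gen k u xs ys : (size xs + size ys)%N = k.+1 ->
  chain_d (g k.+1 u xs ys) = chain_boundary k u xs ys.
Proof. by move=> sz; rewrite /chain_d /= i_gen // -(i_boundary u sz) p_i. Qed.

Lemma i_chain_d k m : i k (chain_d m) = d (i k.+1 m).
Proof.
move: m; apply: g_ind => [|m n hm hn|u xs ys sz]; first by rewrite !linear0.
  by rewrite !linearD /= hm hn.
by rewrite chain_d_gen // i_boundary // i_gen.
Qed.

Lemma d_i0 m : d (i 0 m) = 0.
Proof.
move: m; apply: g_ind => [|m n hm hn|u xs ys sz]; first by rewrite !linear0.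
  by rewrite !linearD /= hm hn addr0.
rewrite i_gen // d_phi; case: xs ys sz => [|//] [|//] _.
by rewrite /evs /ods !big_nil mulr1 (cone_d1 P d_word) mulr0.
Qed.

(** The projections form a chain map: on the image of each M_j the differential lands in the image
    of M_(j-1), and for j = 0 it vanishes. *)
Lemma p_d k a : p k (d a) = chain_d (p k.+1 a).
Proof.
move: a; apply: (@normal_ext (M k) (p k \o d) (@chain_d k \o p k.+1)) => w nw.
rewrite /= (normal_wordE nw); set u := u_of _; set xs := x_of _; set ys := y_of _.
rewrite -(i_gen u (erefl (size xs + size ys)%N)); move: (size xs + size ys)%N (g _ _ _ _).
case=> [|j] m; first by rewrite d_i0 linear0 p_i_neq // linear0.
rewrite -i_chain_d; have [ejk|ne] := eqVneq j k; first by subst j; rewrite !p_i.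
by rewrite !p_i_neq ?linear0.
Qed.

Hypothesis cone_exact : forall a, d a = 0 -> exists b z, a = d b + z *: 1.

Lemma i_one : 1 = i 0 (g 0 1 [::] [::]).
Proof. by rewrite i_gen // /evs /ods !big_nil phi1 !mulr1. Qed.

(** A bounding element of the cone is projected to the right degree; the scalar lies in M_0 and has
    no component in positive degree. *)
Lemma chain_exact k (m : M k.+1) : chain_d m = 0 -> exists m', @chain_d k.+1 m' = m.
Proof.
move=> dm; have [|b [z ab]] := cone_exact (a := i k.+1 m).
  by rewrite -i_chain_d dm linear0.
exists (p k.+2 b); rewrite -p_d -[RHS]p_i ab linearD /= linearZ /=.
by rewrite i_one p_i_neq // scaler0 addr0.
Qed.

Lemma chain_dd k (m : M k.+2) : chain_d (chain_d m) = 0.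
Proof. by rewrite -[LHS]p_i !i_chain_d (cone_dd P d_word) linear0. Qed.

Variables (aug : U -> K) (e0 : {linear M 0 -> K^o}).
Hypothesis aug1 : aug 1 = 1.
Hypothesis aug_in : forall u v, aug (u * uin v) = 0.
Hypothesis e0_gen : forall u, e0 (g 0 u [::] [::]) = aug u.

(** A generator of M_1 carries a single vector, even or odd, so only the term that multiplies it
    into u survives, and [aug] kills this product. *)
Lemma chain_aug_d m : e0 (chain_d m) = 0.
Proof.
move: m; apply: g_ind => [|m n hm hn|u xs ys sz]; first by rewrite !linear0.
  by rewrite !linearD /= hm hn addr0.
rewrite chain_d_gen // /chain_boundary.
case: xs ys sz => [|x [|//]] [|y [|//]] //= _; rewrite !big_ord0 !big_ord1 /=.
all: rewrite ?big_ord0 ?big_mkcond ?big_ord1 /= ?(add0r, addr0, subr0, oppr0, scaler0).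
  by rewrite expr0 scale1r /omit /= e0_gen aug_in.
by rewrite linearZ /= /omit /= e0_gen aug_in scaler0.
Qed.

(** The scalar left over by the cone equals the augmentation of m, hence is 0. *)
Lemma chain_exact0 (m : M 0) : e0 m = 0 -> exists m', @chain_d 0 m' = m.
Proof.
move=> em; have [b [z ab]] := cone_exact (d_i0 m).
have mE : m = chain_d (p 1 b) + z *: g 0 1 [::] [::].
  by rewrite -p_d -[LHS]p_i ab linearD /= linearZ /= i_one p_i.
have z0 : z = 0.
  move: em; rewrite mE linearD linearZ /= chain_aug_d e0_gen aug1 add0r.
  by rewrite /GRing.scale /= mulr1.
by exists (p 1 b); rewrite [RHS]mE z0 scale0r addr0.
Qed.

End Resolution.

Theorem cone_resolution (aug : U -> K) : aug 1 = 1 -> (forall u v, aug (u * uin v) = 0) ->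
  (forall k, exists i : {linear M k -> A}, forall u xs ys, (size xs + size ys)%N = k ->
     i (g k u xs ys) = phi u * (evs xs * ods ys)) ->
  exists dd : forall k, {linear M k.+1 -> M k},
  [/\ forall k u xs ys, (size xs + size ys)%N = k.+1 ->
        dd k (g k.+1 u xs ys) = chain_boundary k u xs ys,
      forall k m, dd k (dd k.+1 m) = 0,
      forall k m, dd k m = 0 -> exists m', dd k.+1 m' = m &
      forall e0 : {linear M 0 -> K^o}, (forall u, e0 (g 0 u [::] [::]) = aug u) ->
        (forall m, e0 (dd 0%N m) = 0) /\ (forall m, e0 m = 0 -> exists m', dd 0%N m' = m)].
Proof.
move=> aug1 aug_in i_ex.
have lr : reflexive le by exact: letter_le_refl.
have la : antisymmetric le by exact: letter_le_anti.
have lt : total le by exact: letter_le_total.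
have ltr : transitive le by exact: letter_le_trans.
have sgC := parity_sgC par.
have skew := structure_skew c e_homogeneous.
have brsg := structure_sg e_homogeneous c_homogeneous.
have jacobi := structure_jacobi ec e_homogeneous.
have pw (X : lmodType K) (f : seq (bool * I) -> X) : exists f' : {linear A -> X},
    forall w, normal_word le (cone_sg sg) w -> f' (wd w) = f w.
  exact: (cone_straighten_ex sgC skew brsg jacobi char0 lr la lt ltr P).
have [d d_word] := unmark_derivation_ex P.
have [h h_normal] := pw A (word_derivation wd (bar wd)).
pose i k := projT1 (cid (i_ex k)); have i_gen k : _ := projT2 (cid (i_ex k)).
pose p k := projT1 (cid (pw (M k) (word_gen k))).
have p_normal k : _ := projT2 (cid (pw (M k) (word_gen k))).
have dex a : d a = 0 -> exists b z, a = d b + z *: 1.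
  exact: (cone_exact_with sgC char0 lr lt P h_normal d_word).
exists (fun k => chain_d d p i (k := k)); split.
- by move=> k u xs ys sz; exact: (chain_d_gen d_word p_normal i_gen).
- by move=> k m; exact: (chain_dd d_word p_normal i_gen).
- by move=> k m; exact: (chain_exact d_word p_normal i_gen dex).
move=> e0 e0_gen; split=> m.
  exact: (chain_aug_d d_word p_normal i_gen aug_in e0_gen).
exact: (chain_exact0 d_word p_normal i_gen dex aug1 aug_in e0_gen).
Qed.

End Projection.

(** * The free resolution *)

Section FreeExtension.
Variables (K : fieldType) (A : algType K) (W : lmodType K).

(** The elements 1 (x) w_i form a basis when the w_i form one of W over K. Uniqueness comes from the
    coordinate functionals of W, extended to A-valued maps on the tensor product. *)
Lemma extension_free : is_free (extension A W).
Proof.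
have [I [w [co [cw wc]]]] := exists_basis W.
pose b (i : I) : extension A W := tens 1 (w i).
exists I, b => m.
pose S (c : {malg A[I]}) : tensor A W := \sum_(i <- msupp c) tens c@_i (w i).
have SE c : \sum_(i <- msupp c) c@_i *: b i = S c.
  apply: eq_bigr => i _; rewrite -[LHS]/(ext_act c@_i (b i)).
  by rewrite /b ext_actE mulr1.
have Sw c (D : {fset I}) : (msupp c `<=` D)%fset -> S c = \sum_(i <- D) tens c@_i (w i).
  move=> le; rewrite /S (big_fset_incl _ le) //= => x xd /mcoeff_outdom ->.
  exact: tens0l.
have SD c c' : S (c + c') = S c + S c'.
  pose D := (msupp c `|` msupp c')%fset.
  rewrite (Sw _ D) ?msuppD_le // (Sw c D) ?fsubsetUl // (Sw c' D) ?fsubsetUr //.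
  rewrite -big_split; apply: eq_bigr => i _; rewrite mcoeffD.
  by rewrite -[c@_i]scale1r tens_linearl !scale1r.
have SU u i : S << u *g i >> = tens u (w i).
  by rewrite (Sw _ _ msuppU_le) big_seq_fset1 mcoeffUU.
have ex : exists c, m = S c.
  move: m; apply: tensor_ind => [u v|x y [c ->] [c' ->]]; last by exists (c + c').
  rewrite -(wc v) (malg_lift_comp _ _ (tens_linearr u)) /malg_lift.
  apply: (big_ind (fun x => exists c, x = S c)).
  - by exists 0; rewrite /S msupp0 big_seq_fset0.
  - by move=> _ _ [c ->] [c' ->]; exists (c + c').
  by move=> i _; exists << (co v)@_i *: u *g i >>; rewrite SU tens_scalel.
have inj c c' : S c = S c' -> c = c'.
  move=> e; apply/malgP => j.
  pose h (u : A) (v : W) : A := (co v)@_j *: u.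
  have hl v : linear (h^~ v) by move=> a x y; rewrite /h scalerDr !scalerA mulrC.
  have hr u : linear (h u).
    by move=> a x y; rewrite /h linearP mcoeffD mcoeffZ scalerDl scalerA.
  have [f fE] := linear_bundle (tensor_lift_linear hl hr).
  have fS c1 : f (S c1) = c1@_j.
    rewrite (Sw _ (msupp c1 `|` [fset j])%fset) ?fsubsetUl // linear_sum.
    rewrite (big_fsetD1 j) /=; last by rewrite !inE eqxx orbT.
    rewrite fE (tensor_liftE hl hr) /h cw mcoeffUU scale1r big1_seq ?addr0 // => i.
    rewrite !inE => /and3P[_ ne _].
    by rewrite fE (tensor_liftE hl hr) /h cw mcoeffU (negPf ne) scale0r.
  by rewrite -!fS e.
have [c mc] := ex; exists c; split; first by rewrite SE.
by move=> c'; rewrite SE mc => /inj.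
Qed.

End FreeExtension.

Section SuperalgebraResolution.
Variables (K : fieldType) (L : lieSuper K).
Hypothesis char0 : forall n, n.+1%:R != 0 :> K.

Local Notation U := (env L).
Local Notation V0 := (even_part L).
Local Notation V1 := (odd_part L).
Local Notation M k := (tensor U (superpower L k)).
Local Notation gen := (@gen K L U).

Lemma aug_linear : linear (@aug K L : U -> K^o).
Proof. by move=> a u v; rewrite rmorphD /= aug_scalable. Qed.

(** An instance of [gen_lift] with target K and zero maps on both parts of L: in degree 0 the
    products of vectors are empty. *)
Lemma augmentation_ex : exists e : {linear M 0 -> K^o},
  forall u, e (gen 0 u [::] [::]) = aug u.
Proof.
have [a aE] := linear_bundle aug_linear.
have z (W : lmodType K) : linear (fun _ : W => 0 : K^o).
  by move=> l x y; rewrite scaler0 addr0.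
have [f0 f0E] := linear_bundle (z V0); have [f1 f1E] := linear_bundle (z V1).
have [|||e eE] := @gen_lift K L U K^o a f0 f1 0.
- by move=> x y; rewrite !f0E mulr0 oppr0.
- by move=> x; rewrite !f0E mulr0.
- by move=> x y; rewrite !f1E.
by exists e => u; rewrite eE // !big_nil !mulr1 aE.
Qed.

Local Notation u_in := (@env_in K L).

Theorem chain_resolution :
  exists dd : forall k, {linear M k.+1 -> M k},
  [/\ forall k u xs ys, (size xs + size ys)%N = k.+1 ->
        dd k (gen k.+1 u xs ys) = chain_boundary (@env_in K L) gen k u xs ys,
      forall k m, dd k (dd k.+1 m) = 0,
      forall k m, dd k m = 0 -> exists m', dd k.+1 m' = m &
      forall e : {linear M 0 -> K^o}, (forall u, e (gen 0 u [::] [::]) = aug u) ->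
        (forall m, e (dd 0%N m) = 0) /\ (forall m, e m = 0 -> exists m', dd 0%N m' = m)].
Proof.
have [I [par [e [c [ce ec eh ch]]]]] := adapted_basis L.
have [le0 [le_refl le_anti le_trans le_total]] := exists_total_order (bool * I)%type.
pose sg := parity_sg par; pose br := structure_constants e c.
have [A [wd P]] : exists (A : algType K) (wd : seq (bool * I) -> A),
    presentation (cone_sg sg) (cone_br br) wd.
  exists (color_alg (cone_sg sg) (cone_br br)), (word (cone_sg sg) (cone_br br)).
  exact: color_presentation.
have Ubr a b x y : homogeneous a x -> homogeneous b y ->
    u_in x * u_in y = (-1) ^+ (a && b) *: (u_in y * u_in x) + u_in (bracket x y).
  exact: env_in_bracket.
have Uind (Q : U -> Prop) : Q 0 -> (forall k u v, Q u -> Q v -> Q (k *: u + v)) ->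
    (forall s, Q (\prod_(x <- s) u_in x)) -> forall u, Q u.
  exact: env_ind.
have [phi [phi_in phi1 phiM]] : exists phi : {linear U -> A},
    [/\ forall x, phi (u_in x) = mk c wd false x, phi 1 = 1 &
     forall x y, phi (x * y) = phi x * phi y].
  have [phi [h1 h2 h3]] := @env_lift _ L A (mk c wd false) (fun a b x y hx hy =>
    mk_bracket ec ch P false false hx hy).
  by exists phi.
have evl2 x : evl c wd x * evl c wd x = 0.
  have e2 := evl_anti ec ch P x x.
  by apply: (double_eq char0); rewrite {1}e2 addNr addr0.
have i_ex k := @gen_lift K L U A phi (evl c wd) (odl c wd) k
  (evl_anti ec ch P) evl2 (odl_comm ec ch P).
apply: (cone_resolution char0 ce ec eh ch le_refl le_anti le_total le_trans P Uind Ubr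
  phi1 phiM phi_in).
- exact: gen_linear_u.
- exact: gen_linear_x.
- exact: gen_linear_y.
- exact: gen_swap_x.
- exact: gen_swap_y.
- exact: gen_ind.
- exact: rmorph1.
- by move=> u v; rewrite rmorphM /= aug_env_in mulr0.
exact: i_ex.
Qed.

End SuperalgebraResolution.

(** * From vector spaces over K to modules over the enveloping algebra *)

Lemma zmod_morphism0 (V W : zmodType) (f : V -> W) : zmod_morphism f -> f 0 = 0.
Proof. by move=> fB; rewrite -(subrr 0) fB subrr. Qed.

Lemma zmod_morphismD (V W : zmodType) (f : V -> W) : zmod_morphism f ->
  forall x y, f (x + y) = f x + f y.
Proof.
move=> fB x y; have fN z : f (- z) = - f z by rewrite -sub0r fB (zmod_morphism0 fB) sub0r.
by rewrite -[y in x + y]opprK fB fN opprK.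
Qed.

Lemma sign_scale (R : pzRingType) (V : lmodType R) n (m : V) :
  (-1) ^+ n *: m = if odd n then - m else m.
Proof. by rewrite -signr_odd; case: odd; rewrite ?expr1 ?scaleN1r ?scale1r. Qed.

Section BoundarySum.
Variables (K : fieldType) (L : lieSuper K).

(* The boundary formula with the scalings by signs left abstract: M_k carries a
   U-module and a K-module structure, in which they agree only propositionally. *)
Definition boundary_sum (W : zmodType) (sgn : nat -> W -> W)
    (g : env L -> seq (even_part L) -> seq (odd_part L) -> W)
    (u : env L) (xs : seq (even_part L)) (ys : seq (odd_part L)) : W :=
  \sum_(s < size xs) \sum_(t < size xs | (s < t)%N) sgn (s.+1 + t.+1)%N
     (g u ((bracket (ev (nth 0 xs s)) (ev (nth 0 xs t))).1 :: omit s (omit t xs)) ys)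
  + \sum_(s < size xs) \sum_(t < size ys) sgn s.+1
     (g u (omit s xs) ((bracket (ev (nth 0 xs s)) (od (nth 0 ys t))).2 :: omit t ys))
  - \sum_(s < size ys) \sum_(t < size ys | (s < t)%N)
     g u ((bracket (od (nth 0 ys s)) (od (nth 0 ys t))).1 :: xs) (omit s (omit t ys))
  + \sum_(s < size xs) sgn s.+2 (g (u * env_in (ev (nth 0 xs s))) (omit s xs) ys)
  + sgn (size xs) (\sum_(t < size ys) g (u * env_in (od (nth 0 ys t))) xs (omit t ys)).

(** Serves twice: to compare the module structures over U and over K, with f the identity, and to
    see that the boundary commutes with the action of U. *)
Lemma boundary_sum_morph (W W' : zmodType) (f : {additive W -> W'}) (h : env L -> env L)
    sgn sgn' g g' u xs ys :
  (forall n m, f (sgn n m) = sgn' n (f m)) ->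
  (forall u xs ys, f (g u xs ys) = g' (h u) xs ys) -> (forall u v, h (u * v) = h u * v) ->
  f (boundary_sum sgn g u xs ys) = boundary_sum sgn' g' (h u) xs ys.
Proof.
move=> fS fG hM; rewrite /boundary_sum 2!raddfD raddfB raddfD fS.
congr (_ + _ - _ + _ + sgn' _ _); rewrite raddf_sum; apply: eq_bigr => s _;
  rewrite ?fS ?fG ?hM //.
- by rewrite raddf_sum; apply: eq_bigr => t _; rewrite fS fG.
- by rewrite raddf_sum; apply: eq_bigr => t _; rewrite fS fG.
by rewrite raddf_sum; apply: eq_bigr => t _; rewrite fG.
Qed.

End BoundarySum.

Lemma scale_sign (R : pzRingType) (V : lmodType R) (a : R) n (m : V) :
  a *: ((-1) ^+ n *: m) = (-1) ^+ n *: (a *: m).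
Proof. by rewrite !scalerA commr_sign. Qed.

(** The two structures share the additive group, and a power of -1 acts as the identity or as
    negation in both. *)
Lemma extension_id (K : fieldType) (A : algType K) (W : lmodType K) :
  exists2 f : {additive extension A W -> tensor A W}, forall m, f m = m :> tensor A W &
  forall n m, f ((-1) ^+ n *: m) = (-1) ^+ n *: f m.
Proof.
pose F := GRing.isZmodMorphism.Build (extension A W) (tensor A W) (fun m => m)
  (fun _ _ => erefl).
pose f : {additive extension A W -> tensor A W} := HB.pack (fun m : extension A W => m) F.
by exists f => // n m; rewrite !sign_scale; case: odd.
Qed.

Section FreeResolution.
Variables (K : fieldType) (L : lieSuper K).
Hypothesis char0 : forall n, n.+1%:R != 0 :> K.

Local Notation gen := (@gen K L (env L)).
Local Notation M k := (tensor (env L) (superpower L k)).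

Lemma cmod_ind k (P : cmod L k -> Prop) : P 0 -> (forall m n, P m -> P n -> P (m + n)) ->
  (forall u xs ys, (size xs + size ys)%N = k -> P (cgen k u xs ys)) -> forall m, P m.
Proof. exact: gen_ind. Qed.

Lemma cmod_ext k (W : zmodType) (f g : cmod L k -> W) : zmod_morphism f -> zmod_morphism g ->
  (forall u xs ys, (size xs + size ys)%N = k -> f (cgen k u xs ys) = g (cgen k u xs ys)) ->
  f =1 g.
Proof.
move=> fB gB fg; apply: cmod_ind => [|m n hm hn|]; last exact: fg.
  by rewrite !zmod_morphism0.
by rewrite !zmod_morphismD // hm hn.
Qed.

Lemma boundary_sumE k u xs ys : boundary k u xs ys =
  boundary_sum (fun n (m : cmod L k) => (-1) ^+ n *: m) (@cgen K L k) u xs ys.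
Proof. by []. Qed.

Lemma boundaryE k u xs ys : boundary k u xs ys = chain_boundary (@env_in K L) gen k u xs ys.
Proof.
have [f fE fS] := extension_id (env L) (superpower L k).
have fG v s t : f (cgen k v s t) = gen k v s t by exact: fE.
have -> : chain_boundary (@env_in K L) gen k u xs ys =
    boundary_sum (fun n (m : M k) => (-1) ^+ n *: m) (@gen k) u xs ys by [].
rewrite boundary_sumE -[LHS]fE; exact: (@boundary_sum_morph K L _ _ f id
  (fun n m => (-1) ^+ n *: m) (fun n m => (-1) ^+ n *: m) (@cgen K L k) (@gen k) u xs ys
  fS fG (fun _ _ => erefl)).
Qed.

Lemma cgen_act k a u xs ys : a *: cgen k u xs ys = cgen (L := L) k (a * u) xs ys.
Proof. exact: ext_actE. Qed.

(** The formula multiplies vectors into u from the right, so left multiplication passes through. *)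
Lemma boundary_act k a u xs ys : boundary (L := L) k (a * u) xs ys = a *: boundary k u xs ys.
Proof.
rewrite !boundary_sumE; symmetry.
pose F := GRing.isZmodMorphism.Build (cmod L k) (cmod L k) ( *:%R a) (scalerBr a).
pose f : {additive cmod L k -> cmod L k} := HB.pack (fun m : cmod L k => a *: m) F.
have fS n (m : cmod L k) : f ((-1) ^+ n *: m) = (-1) ^+ n *: f m by exact: scale_sign.
have fG v s t : f (cgen k v s t) = cgen k (a * v) s t by exact: cgen_act.
exact: (@boundary_sum_morph K L _ _ f ( *%R a) (fun n m => (-1) ^+ n *: m)
  (fun n m => (-1) ^+ n *: m) (@cgen K L k) (@cgen K L k) u xs ys fS fG (mulrA a)).
Qed.

(** Linearity over U is recovered from additivity and the behaviour on generators, since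
    [is_differential] and [is_augmentation] ask for no more. *)
Lemma additive_linear k (N : lmodType (env L)) (f : cmod L k -> N) : zmod_morphism f ->
  (forall a u xs ys, (size xs + size ys)%N = k ->
    f (cgen k (a * u) xs ys) = a *: f (cgen k u xs ys)) ->
  linear f.
Proof.
move=> fB fA a m n; rewrite (zmod_morphismD fB); congr (_ + _).
move: m; apply: cmod_ind => [|m1 m2 h1 h2|u xs ys sz].
- by rewrite scaler0 (zmod_morphism0 fB) scaler0.
- by rewrite scalerDr !(zmod_morphismD fB) h1 h2 scalerDr.
exact: etrans (congr1 f (cgen_act k a u xs ys)) (fA a u xs ys sz).
Qed.

Lemma differential_unique (d d' : forall k, cmod L k.+1 -> cmod L k) :
  is_differential d -> is_differential d' -> d = d'.
Proof.
move=> dP d'P; apply: functional_extensionality_dep => k.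
apply: functional_extensionality_dep; have [[dB dG] [d'B d'G]] := (dP k, d'P k).
by apply: (cmod_ext dB d'B) => u xs ys sz; rewrite dG // d'G.
Qed.

Lemma gen0_ind (P : env L -> seq (even_part L) -> seq (odd_part L) -> Prop) :
  (forall u, P u [::] [::]) -> forall u xs ys, (size xs + size ys)%N = 0%N -> P u xs ys.
Proof. by move=> P0 u [|x xs] [|y ys]. Qed.

Lemma augmentation_unique (e e' : cmod L 0 -> trivial L) :
  is_augmentation e -> is_augmentation e' -> e = e'.
Proof.
move=> [eB eG] [e'B e'G]; apply: functional_extensionality_dep.
by apply: (cmod_ext eB e'B); apply: gen0_ind => u; rewrite eG e'G.
Qed.

Lemma augmentation_bundle : exists e : {linear M 0 -> K^o},
  (forall u, e (gen 0 u [::] [::]) = aug u) /\ @is_augmentation K L e.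
Proof.
have [e eG] := augmentation_ex L; exists e; split=> //; split; last exact: eG.
exact: (raddfB e).
Qed.

Lemma differential_bundle : exists dd : forall k, {linear M k.+1 -> M k},
  [/\ @is_differential K L dd,
      forall k m, dd k (dd k.+1 m) = 0,
      forall k m, dd k m = 0 -> exists m', dd k.+1 m' = m &
      forall e : {linear M 0 -> K^o}, (forall u, e (gen 0 u [::] [::]) = aug u) ->
        (forall m, e (dd 0%N m) = 0) /\ (forall m, e m = 0 -> exists m', dd 0%N m' = m)].
Proof.
have [dd [ddG h1 h2 h3]] := chain_resolution L char0; exists dd; split=> // k.
split=> [|u xs ys sz]; first exact: (raddfB (dd k)).
by rewrite boundaryE -ddG.
Qed.

Lemma resolution (d : forall k, cmod L k.+1 -> cmod L k) (e : cmod L 0 -> trivial L) :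
  is_differential d -> is_augmentation e -> free_resolution d e.
Proof.
move=> dP eP.
have [dd [ddP ddd ddE ddA]] := differential_bundle.
have [e0 [e0G e0P]] := augmentation_bundle.
have [e0d e0E] := ddA _ e0G.
have dE := differential_unique dP ddP; have eE := augmentation_unique eP e0P.
split.
- by move=> k; exact: extension_free.
- split=> [|k].
    apply: additive_linear; first by case: eP.
    move=> a; apply: gen0_ind => u; case: eP => _ eG.
    have aM : aug (a * u) = aug a * aug u by case: (aug_monoid L) => _; apply.
    exact: etrans (eG (a * u)) (etrans aM (congr1 (trivial_act a) (esym (eG u)))).
  have [dB dG] := dP k; apply: additive_linear => // a u xs ys sz.
  exact: etrans (dG (a * u) xs ys sz) (etrans (boundary_act k a u xs ys)
    (congr1 ( *:%R a) (esym (dG u xs ys sz)))).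
- move=> n; exists (cgen 0 ((n : K) *: 1) [::] [::]); case: eP => _ eG.
  have a1 : aug (1 : env L) = 1 by case: (aug_monoid L).
  exact: etrans (eG _) (etrans (aug_scalable (n : K) 1)
    (etrans (congr1 ( *%R (n : K)) a1) (mulr1 _))).
- move=> m; rewrite eE dE; split=> [|[m' <-]]; [exact: e0E | exact: e0d].
move=> k m; rewrite dE; split=> [|[m' <-]]; [exact: ddE | exact: ddd].
Qed.

End FreeResolution.

(** Existence and uniqueness of both maps are part of the claim, so that the conditions on [d] and
    [e] are not vacuous. The complex numbers are [R[i]] over any model R of the reals. *)
Theorem proposition3p1 (R : realType) (L : lieSuper R[i]) :
  (exists! d : forall k, cmod L k.+1 -> cmod L k, is_differential d) /\
  (exists! e : cmod L 0 -> trivial L, is_augmentation e) /\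
  (forall (d : forall k, cmod L k.+1 -> cmod L k) (e : cmod L 0 -> trivial L),
     is_differential d -> is_augmentation e ->
     free_resolution d e).
Proof.
have char0 n : n.+1%:R != 0 :> R[i] by rewrite Num.Theory.pnatr_eq0.
have [dd [ddP _ _ _]] := differential_bundle L char0.
have [e [_ eP]] := augmentation_bundle L.
split; last split; last by move=> d e'; exact: resolution.
  by eexists; split; [exact: ddP | move=> d'; exact: differential_unique].
by eexists; split; [exact: eP | move=> e'; exact: augmentation_unique].
Qed.
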